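(* Let $z\in\mathbb C\setminus\mathbb R$. In the Generic Case, i.e. if $\lambda=0$ is not an eigenvalue of the auxiliary Hamiltonian $\mathring H^{in}$, one has $$(H^\varepsilon - z)^{-1} = \begin{pmatrix} (\mathring H^{out} - z)^{-1} & \mathbb O\\ \mathbb O & \mathbb O\end{pmatrix} + \mathcal O_{\mathcal B(\mathcal H^{\varepsilon})}(\varepsilon),$$ where the block matrix is understood in the decomposition $\mathcal H^\varepsilon=\mathcal H^{out}\oplus\mathcal H^{in,\varepsilon}$.
   Context: **Functions on metric graphs.** Metric graphs have finitely many edges and vertices; each edge $e$ is identified with $[0,\ell_e]$ (finite length $\ell_e>0$) or $[0,+\infty)$. A function $\psi$ on a graph is the collection of its restrictions $\psi_e$ to the edges. For a vertex $v$, $d(v)$ is its degree (number of edge ends at $v$, loops counted twice). For $\psi\in\bigoplus_e H^2(e)$, $\Psi(v)\in\mathbb C^{d(v)}$ is the vector of boundary values ($\psi_e(0)$ or $\psi_e(\ell_e)$) of $\psi$ at the edge ends at $v$, and $\Psi'(v)\in\mathbb C^{d(v)}$ is the vector, in the same order, of derivatives in the outgoing direction ($\psi_e'(0)$ or $-\psi_e'(\ell_e)$). For an orthogonal projection $P$, $P^\perp$ denotes identity minus $P$. **Inner graph.** $\mathcal G^{in}$ is a compact metric graph (all edges of finite length), $0<\varepsilon<1$, and $\mathcal G^{in,\varepsilon}=\varepsilon\mathcal G^{in}$ (all lengths multiplied by $\varepsilon$). $N$ distinct vertices $v_1,\dots,v_N$ of $\mathcal G^{in}$ are selected, called connecting vertices;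 $\mathcal C$ is their set, and $\mathcal V^{in}$ is the (possibly empty) set of remaining vertices. For $v\in\mathcal C$, $d^{in}(v)$ is the degree of $v$ in $\mathcal G^{in}$. For each $v\in\mathcal V^{in}$ an orthogonal projection $P^{in}_v$ in $\mathbb C^{d(v)}$ and a self-adjoint operator $\Theta^{in}_v$ in $\operatorname{Ran}P^{in}_v$ are fixed, and $\Theta^{in,\varepsilon}_v=\varepsilon^{-1}\Theta^{in}_v$. $B^{in}:\mathcal G^{in}\to\mathbb R$ is bounded and $B^{in,\varepsilon}(x)=\varepsilon^{-2}B^{in}(x/\varepsilon)$ for $x\in\mathcal G^{in,\varepsilon}$. $\mathcal H^{in,\varepsilon}$ and $\mathcal H_2^{in,\varepsilon}$ are the direct sums of $L^2(e)$, resp. $H^2(e)$, over the edges of $\mathcal G^{in,\varepsilon}$; $\mathcal H^{in}$, $\mathcal H^{in}_2$ are these spaces for $\varepsilon=1$. **Outer graph and full graph.** The graph $\mathcal G^\varepsilon$ is obtained from $\mathcal G^{in,\varepsilon}$ by attaching to each $v_j$ one outer edge $e_j$ (of finite length independent of $\varepsilon$, or a half-line), with $v_j$ corresponding to $x=0$ on $e_j$, $j=1,\dots,N$. The other endpoint of each finite outer edge is a vertex of degree one; $\mathcal V^{out}$ is the set of these. The degree of $v\in\mathcal C$ in $\mathcal G^\varepsilon$ is $d(v)=d^{in}(v)+1$. $\mathcal G^{out}$ is the star-graph formed by the $e_j$ joined at $x=0$. $\mathcal H^{out}=\bigoplus_j L^2(e_j)$, $\mathcal H^{out}_2=\bigoplus_j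 H^2(e_j)$, $\mathcal H^\varepsilon=\mathcal H^{out}\oplus\mathcal H^{in,\varepsilon}$, $\mathcal H^\varepsilon_2=\mathcal H_2^{out}\oplus\mathcal H_2^{in,\varepsilon}$. For $\psi\in\mathcal H^{out}_2$ with components $\psi_j$: $\Psi(\mathbf 0)=(\psi_1(0),\dots,\psi_N(0))^T$, $\Psi'(\mathbf 0)=(\psi_1'(0),\dots,\psi_N'(0))^T$. For $v\in\mathcal V^{out}$ an orthogonal projection $P^{out}_v:\mathbb C\to\mathbb C$ and a self-adjoint operator $\Theta^{out}_v$ in $\operatorname{Ran}P^{out}_v$ are fixed. $B^{out}:\mathcal G^{out}\to\mathbb R$ is bounded and compactly supported; $B^\varepsilon=(B^{out},B^{in,\varepsilon})$. All data except the explicit scaling are independent of $\varepsilon$. **Kirchhoff projections.** For $v\in\mathcal C$, $K_v$ is the orthogonal projection in $\mathbb C^{d(v)}$ onto the span of $(1,\dots,1)$, and $K_v^{in}$ is the orthogonal projection in $\mathbb C^{d^{in}(v)}$ onto the span of $(1,\dots,1)$. **Operators.** - $H^\varepsilon$ in $\mathcal H^\varepsilon$: $H^\varepsilon\psi=-\psi''+B^\varepsilon\psi$, with domain the $\psi\in\mathcal H_2^\varepsilon$ such that ${P_v^{in}}^\perp\Psi(v)=0$, $P_v^{in}\Psi'(v)-\Theta_v^{in,\varepsilon}P_v^{in}\Psi(v)=0$ for all $v\in\mathcal V^{in}$; ${P_v^{out}}^\perp\Psi(v)=0$, $P_v^{out}\Psi'(v)-\Theta_v^{out}P_v^{out}\Psi(v)=0$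 for all $v\in\mathcal V^{out}$; $K_v^\perp\Psi(v)=0$, $K_v\Psi'(v)=0$ for all $v\in\mathcal C$. - Auxiliary Hamiltonian $\mathring H^{in}$ in $\mathcal H^{in}$: $\mathring H^{in}\psi=-\psi''+B^{in}\psi$, with domain the $\psi\in\mathcal H_2^{in}$ such that ${P_v^{in}}^\perp\Psi(v)=0$, $P_v^{in}\Psi'(v)-\Theta_v^{in}P_v^{in}\Psi(v)=0$ for all $v\in\mathcal V^{in}$; ${K_v^{in}}^\perp\Psi(v)=0$, $K_v^{in}\Psi'(v)=0$ for all $v\in\mathcal C$. - $\mathring H^{out}$ in $\mathcal H^{out}$: $\mathring H^{out}\psi=-\psi''+B^{out}\psi$, with domain the $\psi\in\mathcal H_2^{out}$ such that ${P_v^{out}}^\perp\Psi(v)=0$, $P_v^{out}\Psi'(v)-\Theta_v^{out}P_v^{out}\Psi(v)=0$ for all $v\in\mathcal V^{out}$, and $\Psi(\mathbf 0)=0$. These operators are self-adjoint. **Notation.** $\mathcal B(X,Y)$ is the space of bounded linear operators $X\to Y$, $\mathcal B(X)=\mathcal B(X,X)$. $\mathcal O_{\mathcal B(X,Y)}(\varepsilon^a)$ denotes an operator $X\to Y$ whose norm is at most $C\varepsilon^a$ for all sufficiently small $\varepsilon$, with $C$ independent of $\varepsilon$ ($z$ is fixed). $\mathbb O$ is a zero operator. *)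

(* Defs.v *)
From HB Require Import structures.
From mathcomp Require Import all_boot all_order all_algebra.
From mathcomp Require Import all_classical all_reals all_analysis.
From mathcomp Require Export complex.
Set Implicit Arguments.
Unset Strict Implicit.
Unset Printing Implicit Defensive.
Import Order.TTheory GRing.Theory Num.Theory.
Import numFieldNormedType.Exports.
Local Open Scope classical_set_scope.
Local Open Scope ring_scope.
Local Open Scope complex_scope.

(* The edge of length l, i.e. [0, l] if l is finite and [0, +oo[ if l = +oo. *)
Definition interval_of (R : realType) (l : \bar R) : set R :=
  [set x | 0 <= x /\ (x%:E <= l)%E].

(* Functions on a graph with set of edges I.  Only the values on
   [interval_of (l i)] are relevant.  Elements of L^2 are handled through their
   representatives, and compared with [ae_eq_on]. *)
Definition gfun (R : realType) (I : Type) := I -> R -> R[i].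

Section FunctionSpaces.
Variable R : realType.
Local Notation mu := (@lebesgue_measure R).

Definition sqmod (w : R[i]) : R := complex.Re w ^+ 2 + complex.Im w ^+ 2.

Definition inL2 (l : \bar R) (f : R -> R[i]) : Prop :=
  [/\ measurable_fun (interval_of l) (fun x => complex.Re (f x)),
      measurable_fun (interval_of l) (fun x => complex.Im (f x)) &
      (\int[mu]_(x in interval_of l) (sqmod (f x))%:E < +oo)%E].

Definition cintegral (D : set R) (f : R -> R[i]) : R[i] :=
  (\int[mu]_(x in D) complex.Re (f x)) +i* (\int[mu]_(x in D) complex.Im (f x)).

(* f is absolutely continuous on the edge, with a.e. derivative g *)
Definition primitive_of (l : \bar R) (g f : R -> R[i]) : Prop :=
  forall x, interval_of l x -> f x = f 0 + cintegral `[0, x] g.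

(* f belongs to H^2 of the edge, f1 and f2 being its first and second
   derivatives.  Both f and f1 are the continuous representatives (hence have
   well-defined boundary values); f2 is unique up to a null set. *)
Definition inH2 (l : \bar R) (f f1 f2 : R -> R[i]) : Prop :=
  [/\ inL2 l f, inL2 l f1, inL2 l f2, primitive_of l f1 f & primitive_of l f2 f1].

Variables (I : finType) (l : I -> \bar R).

Definition gL2 (f : gfun R I) : Prop := forall i, inL2 (l i) (f i).

Definition L2norm (f : gfun R I) : R :=
  Num.sqrt (\sum_i \int[mu]_(x in interval_of (l i)) sqmod (f i x)).

Definition ae_eq_on (f g : gfun R I) : Prop :=
  forall i, {ae mu, forall x, interval_of (l i) x -> f i x = g i x}.

Definition operator := set (gfun R I * gfun R I).

Definition is_eigenvalue (A : operator) (lam : R[i]) : Prop :=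
  exists psi g, [/\ A (psi, g), ~ ae_eq_on psi (fun _ _ => 0) &
                    ae_eq_on g (fun i x => lam * psi i x)].

(* psi lies in the domain of A and (A - z) psi = f *)
Definition solves (A : operator) (z : R[i]) (f psi : gfun R I) : Prop :=
  exists2 g, A (psi, g) & ae_eq_on (fun i x => g i x - z * psi i x) f.

Definition in_resolvent_set (A : operator) (z : R[i]) : Prop :=
  [/\ forall f, gL2 f -> exists psi, solves A z f psi,
      forall f psi phi, gL2 f -> solves A z f psi -> solves A z f phi ->
        ae_eq_on psi phi &
      exists M : R, forall f psi, gL2 f -> solves A z f psi ->
        L2norm psi <= M * L2norm f].

(* (A - z)^-1; the default value 0 is irrelevant for z in the resolvent set.
   The value depends only on the class of f modulo [ae_eq_on]. *)
Definition resolvent (A : operator) (z : R[i]) (f : gfun R I) : gfun R I :=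
  xget (fun _ _ => 0) [set psi | solves A z f psi].

Definition opnorm_le (T : gfun R I -> gfun R I) (M : R) : Prop :=
  forall f, gL2 f -> gL2 (T f) /\ L2norm (T f) <= M * L2norm f.

(* psi |-> - psi'' + B psi on the functions in H^2 which satisfy the boundary
   conditions bc, expressed through psi and psi' *)
Definition schrodinger (B : I -> R -> R) (bc : gfun R I -> gfun R I -> Prop) :
    operator :=
  [set p | exists psi1 psi2 : gfun R I,
     [/\ forall i, inH2 (l i) (p.1 i) (psi1 i) (psi2 i),
         bc p.1 psi1 &
         ae_eq_on p.2 (fun i x => - psi2 i x + (B i x)%:C * p.1 i x)]].

End FunctionSpaces.

Arguments operator : clear implicits.

Section VertexConditions.
Variable R : realType.

Definition adjoint n (M : 'M[R[i]]_n) : 'M[R[i]]_n := (map_mx Num.conj M)^T.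

Definition is_orthoproj n (P : 'M[R[i]]_n) : Prop :=
  P *m P = P /\ adjoint P = P.

(* A self-adjoint operator in Ran P is represented by its extension by 0 on the
   orthogonal complement of Ran P. *)
Definition is_selfadj_in n (P Th : 'M[R[i]]_n) : Prop :=
  P *m Th *m P = Th /\ adjoint Th = Th.

Definition vertex_condition n (P Th : 'M[R[i]]_n) (Psi Psi1 : 'cV[R[i]]_n) :=
  (1%:M - P) *m Psi = 0 /\ P *m Psi1 - Th *m (P *m Psi) = 0.

(* u u^* / (u^* u) with u = (1, ..., 1)^T, the orthogonal projection onto the
   span of u *)
Definition Kproj n : 'M[R[i]]_n := const_mx (n%:R^-1).

Definition kirchhoff n (Psi Psi1 : 'cV[R[i]]_n) :=
  (1%:M - Kproj n) *m Psi = 0 /\ Kproj n *m Psi1 = 0.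

End VertexConditions.

(* The end x = 0 of the edge e is (e, false) and the end x = len e is (e, true);
   [endpt] maps edge ends to vertices.  Loops and multiple edges are allowed. *)
Definition ends (V E : finType) (endpt : E * bool -> V) (v : V) :
    {set E * bool} := [set h | endpt h == v]%SET.

Notation deg endpt v := #|ends endpt v|.

Section Boundary.
Variables (R : realType) (V E : finType) (endpt : E * bool -> V) (len : E -> R).

Definition bvals (psi : gfun R E) (v : V) : 'cV[R[i]]_(deg endpt v) :=
  \col_k let: (e, b) := enum_val k in psi e (if b then len e else 0).

(* derivatives in the outgoing direction *)
Definition bders (psi1 : gfun R E) (v : V) : 'cV[R[i]]_(deg endpt v) :=
  \col_k let: (e, b) := enum_val k in
         if b then - psi1 e (len e) else psi1 e 0.

(* conditions at the vertices which are not connecting vertices *)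
Definition bc_Vin N (c : 'I_N -> V) (P Th : forall v, 'M[R[i]]_(deg endpt v))
    (psi psi1 : gfun R E) : Prop :=
  forall v, v \notin codom c ->
    vertex_condition (P v) (Th v) (bvals psi v) (bders psi1 v).

End Boundary.

(* The free end of the outer edge j, present only when lout j is finite, is a
   vertex of degree one. *)
Definition bc_Vout (R : realType) N (lout : 'I_N -> \bar R)
    (P Th : 'I_N -> 'M[R[i]]_1) (psi psi1 : gfun R 'I_N) : Prop :=
  forall j, lout j \is a fin_num ->
    vertex_condition (P j) (Th j) (const_mx (psi j (fine (lout j))))
                                  (const_mx (- psi1 j (fine (lout j)))).

Definition einr (R : realType) (A B : Type) (f : gfun R (A + B)) : gfun R B :=
  fun b => f (inr b).
Definition einl (R : realType) (A B : Type) (f : gfun R (A + B)) : gfun R A :=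
  fun a => f (inl a).

Section Hamiltonians.
Variables (R : realType) (V E : finType) (endpt : E * bool -> V) (N : nat).
Variables (c : 'I_N -> V) (len : E -> R) (lout : 'I_N -> \bar R).
Variables (Pin Thin : forall v, 'M[R[i]]_(deg endpt v)) (Bin : E -> R -> R).
Variables (Pout Thout : 'I_N -> 'M[R[i]]_1) (Bout : 'I_N -> R -> R).

Definition Hin : operator R E :=
  schrodinger (fun e => (len e)%:E) Bin (fun psi psi1 =>
    bc_Vin len c Pin Thin psi psi1 /\
    forall j, kirchhoff (bvals endpt len psi (c j)) (bders endpt len psi1 (c j))).

Definition Hout : operator R 'I_N :=
  schrodinger lout Bout (fun psi psi1 =>
    bc_Vout lout Pout Thout psi psi1 /\ (\col_j psi j 0) = 0 :> 'cV[R[i]]_N).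

Variable eps : R.

Definition len_eps (e : E) : R := eps * len e.

Definition lfull (s : 'I_N + E) : \bar R :=
  match s with inl j => lout j | inr e => (len_eps e)%:E end.

Definition Bfull (s : 'I_N + E) (x : R) : R :=
  match s with inl j => Bout j x | inr e => eps ^- 2 * Bin e (x / eps) end.

Definition Thin_eps v := (eps^-1)%:C *: Thin v.

(* At the connecting vertex c j of the full graph, of degree 1 + deg (c j), the
   end x = 0 of the outer edge j is listed first. *)
Definition Hfull : operator R ('I_N + E)%type :=
  schrodinger lfull Bfull (fun psi psi1 =>
    [/\ bc_Vin len_eps c Pin Thin_eps (einr psi) (einr psi1),
        bc_Vout lout Pout Thout (einl psi) (einl psi1) &
        forall j : 'I_N,
          kirchhoff
            (col_mx (const_mx (psi (inl j) 0) : 'cV_1)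
                    (bvals endpt len_eps (einr psi) (c j)))
            (col_mx (const_mx (psi1 (inl j) 0) : 'cV_1)
                    (bders endpt len_eps (einr psi1) (c j)))]).

End Hamiltonians.

(* the block operator (T O; O O) in the decomposition outer + inner *)
Definition block_out (R : realType) (A B : Type)
    (T : gfun R A -> gfun R A) (f : gfun R (A + B)) : gfun R (A + B) :=
  fun s => match s with inl a => T (einl f) a | inr _ => fun _ => 0 end.

(* Potentials are bounded and, as implicit in B psi being in L^2, measurable. *)
Definition bounded_potential (R : realType) (I : Type) (l : I -> \bar R)
    (B : I -> R -> R) : Prop :=
  (forall i, measurable_fun (interval_of (l i)) (B i)) /\
  exists M, forall i x, interval_of (l i) x -> `|B i x| <= M.

Definition compactly_supported (R : realType) (I : Type) (l : I -> \bar R)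
    (B : I -> R -> R) : Prop :=
  exists r, forall i x, interval_of (l i) x -> r < x -> B i x = 0.

(* Main.v *)
(* Let psi = (H^eps - z)^-1 f. Self-adjointness gives |psi| <= |f| / |Im z|, and a
   trace estimate on the outer edges bounds the derivatives psi_j'(0) by a
   multiple of |f|. On the inner graph put u(x) = psi(eps x): then u solves
   - u'' + B^in u = eps^2 (z u + f(eps .)), with the vertex conditions of the
   auxiliary Hamiltonian up to a defect of size eps |f| coming from the outer
   derivatives. As 0 is not an eigenvalue this boundary value problem is uniquely
   solvable with a sup bound by its data, and since |eps^2 f(eps .)|_{L^1} is of order
   eps |f|, the sup norm of u, thus the values psi_j(0), is of order eps |f|; the
   term eps^2 z u is absorbed for small eps. Finally psi^out - (H^out - z)^-1 f^out
   solves the homogeneous equation with boundary values psi_j(0) at 0, and the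
   imaginary part of Green's formula bounds it by these values.

   Every boundary condition is encoded by one scalar equation for each edge end,
   so that, in terms of the initial data at x = 0 of the edges, a boundary value
   problem is a square linear system: uniqueness is solvability with bounds. *)

(* Half-lines break the count of equations against unknowns: only one homogeneous solution,
   normalized at [x = 0], is kept there, and its square integrability has to be obtained from
   problems on segments with bounds uniform in the length. The fictitious second end restores the
   square shape. Injectivity of the matrix has two sources. For [Im z != 0] it is the isotropy of
   the boundary data for the form Im (x^* y), which also yields the resolvents of both Hamiltonians;
   for the inner problem it is the absence of the eigenvalue 0. As the inner problem is posed on the
   unscaled graph with spectral parameter 0, its matrix and its stability constant do not depend on
   [eps]. The scaling of [Thin_eps] matches the factor [eps] of the rescaled derivative, so the
   defect lives at the connecting vertices only. It decides the rate: by Cauchy-Schwarz on edges of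
   length [eps * len e], the rescaled [f] alone would contribute [eps^(3/2)]. *)
Require Import Defs.
From HB Require Import structures.
From mathcomp Require Import all_boot all_order all_algebra.
From mathcomp Require Import all_classical all_reals all_analysis.
From mathcomp Require Import measurable_realfun ring lra.
Set Implicit Arguments.
Unset Strict Implicit.
Unset Printing Implicit Defensive.
Import Order.TTheory GRing.Theory Num.Theory.
Import numFieldNormedType.Exports.
Local Open Scope classical_set_scope.
Local Open Scope ring_scope.
Local Open Scope complex_scope.

Local Notation Re := complex.Re.
Local Notation Im := complex.Im.

(** * Lebesgue integration on segments *)

Section Integrability.
Variable R : realType.
Local Notation mu := (@lebesgue_measure R).

Definition L1 (D : set (measurableTypeR R)) (f : R -> R) := mu.-integrable D (EFin \o f).

Definition L2 (D : set (measurableTypeR R)) (f : R -> R) :=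
  measurable_fun D f /\ L1 D (fun x => f x ^+ 2).

Variable D : set (measurableTypeR R).
Hypothesis mD : measurable D.
Implicit Types f g : R -> R.

Lemma L1_measurable f : L1 D f -> measurable_fun D f.
Proof. by move=> /integrableP[/measurable_EFinP]. Qed.

Lemma L1_ext f g : (forall x, D x -> f x = g x) -> L1 D f -> L1 D g.
Proof.
move=> fg; apply: eq_integrable => // x /set_mem Dx.
by rewrite /= fg.
Qed.

Lemma L1D f g : L1 D f -> L1 D g -> L1 D (fun x => f x + g x).
Proof. by move=> hf hg; apply: (eq_integrable mD _ _ _ (integrableD mD hf hg)). Qed.

Lemma L1N f : L1 D f -> L1 D (fun x => - f x).
Proof. by move=> hf; apply: (eq_integrable mD _ _ _ (integrableN hf)). Qed.

Lemma L1B f g : L1 D f -> L1 D g -> L1 D (fun x => f x - g x).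
Proof. by move=> hf hg; apply: L1D => //; apply: L1N. Qed.

Lemma L1Z (k : R) f : L1 D f -> L1 D (fun x => k * f x).
Proof. by move=> hf; apply: (eq_integrable mD _ _ _ (integrableZl mD k hf)). Qed.

Lemma L1_abs f : L1 D f -> L1 D (fun x => `|f x|).
Proof. by move=> hf; apply: (eq_integrable mD _ _ _ (integrable_norm hf)). Qed.

Lemma L1_le f g : measurable_fun D f -> (forall x, D x -> `|f x| <= g x) ->
  L1 D g -> L1 D f.
Proof.
move=> mf fg hg; apply: (le_integrable mD _ _ hg); first exact/measurable_EFinP.
by move=> x Dx /=; rewrite lee_fin (le_trans (fg _ Dx))// ler_norm.
Qed.

Lemma L1_sum (I : Type) (s : seq I) (F : I -> R -> R) :
  (forall i, L1 D (F i)) -> L1 D (fun x => \sum_(i <- s) F i x).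
Proof.
move=> h; elim: s => [|i s IH].
  apply: (@L1_ext (fun=> 0)); first by move=> x _; rewrite big_nil.
  exact: integrable0.
apply: (@L1_ext (fun x => F i x + \sum_(j <- s) F j x)); last exact: L1D.
by move=> x _; rewrite big_cons.
Qed.

Lemma L1_bounded_mul f g M : measurable_fun D f -> (forall x, D x -> `|f x| <= M) ->
  L1 D g -> L1 D (fun x => f x * g x).
Proof.
move=> mf fM hg; apply: (@L1_le _ (fun x => M * `|g x|)).
- exact: measurable_funM mf (L1_measurable hg).
- by move=> x Dx; rewrite normrM ler_wpM2r// fM.
- exact/L1Z/L1_abs.
Qed.

Lemma L1_cst k : (mu D < +oo)%E -> L1 D (fun=> k).
Proof.
move=> Dfin; apply: measurable_bounded_integrable => //.
exists `|k|; split; first exact: num_real.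
by move=> M kM x _ /=; exact: ltW.
Qed.

Lemma L1_finite_bounded f M : (mu D < +oo)%E -> measurable_fun D f ->
  (forall x, D x -> `|f x| <= M) -> L1 D f.
Proof.
move=> Dfin mf fM; apply: (L1_le mf fM).
exact: L1_cst.
Qed.

Lemma Rintegral_subset (A : set (measurableTypeR R)) f : measurable A -> A `<=` D ->
  (forall x, D x -> 0 <= f x) -> L1 D f ->
  \int[mu]_(x in A) f x <= \int[mu]_(x in D) f x.
Proof.
move=> mA AD f0 hf; rewrite /Rintegral fine_le//.
- by apply: integrable_fin_num => //; exact: integrableS hf.
- exact: integrable_fin_num.
- apply: ge0_subset_integral => //.
  exact: measurable_int hf.
Qed.

Lemma integral_abs_le f g : L1 D f -> L1 D g -> (forall x, D x -> `|f x| <= g x) ->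
  `|\int[mu]_(x in D) f x| <= \int[mu]_(x in D) g x.
Proof.
move=> hf hg fg; apply: (le_trans (le_normr_Rintegral mD hf)).
by apply: le_Rintegral => //; exact: L1_abs.
Qed.

Lemma sqr_le_mul (a b : R) : `|a * b| <= a ^+ 2 + b ^+ 2.
Proof.
rewrite normrM -(real_normK (num_real a)) -(real_normK (num_real b)).
have := normr_ge0 a; have := normr_ge0 b; move: `|a| `|b| => x y.
by nra.
Qed.

Lemma L2_mul f g : L2 D f -> L2 D g -> L1 D (fun x => f x * g x).
Proof.
move=> [mf hf] [mg hg].
apply: (@L1_le _ (fun x => f x ^+ 2 + g x ^+ 2)).
- exact: measurable_funM.
- by move=> x _; exact: sqr_le_mul.
- exact: L1D.
Qed.

Lemma L2_ext f g : (forall x, D x -> f x = g x) -> L2 D f -> L2 D g.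
Proof.
move=> fg [mf hf]; split.
  by apply: eq_measurable_fun mf => x /set_mem /fg.
by apply: L1_ext hf => x /fg ->.
Qed.

Lemma L2D f g : L2 D f -> L2 D g -> L2 D (fun x => f x + g x).
Proof.
move=> hf hg; split; first exact: measurable_funD hf.1 hg.1.
apply: (@L1_ext (fun x => f x ^+ 2 + (f x * g x + f x * g x) + g x ^+ 2)).
  by move=> x _; ring.
by apply: L1D hg.2; apply: L1D hf.2 _; apply: L1D; exact: L2_mul.
Qed.

Lemma L2Z (k : R) f : L2 D f -> L2 D (fun x => k * f x).
Proof.
move=> [mf hf]; split; first exact: measurable_funM.
apply: (@L1_ext (fun x => k ^+ 2 * f x ^+ 2)); last exact: L1Z.
by move=> x _; ring.
Qed.

Lemma L2N f : L2 D f -> L2 D (fun x => - f x).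
Proof. by move=> hf; apply: (L2_ext _ (L2Z (-1) hf)) => x _; rewrite mulN1r. Qed.

Lemma L2B f g : L2 D f -> L2 D g -> L2 D (fun x => f x - g x).
Proof. by move=> hf hg; apply: L2D => //; exact: L2N. Qed.

Lemma L2_bounded_mul f g M : measurable_fun D f -> (forall x, D x -> `|f x| <= M) ->
  L2 D g -> L2 D (fun x => f x * g x).
Proof.
move=> mf fM [mg hg]; split; first exact: measurable_funM.
apply: (@L1_ext (fun x => f x ^+ 2 * g x ^+ 2)); first by move=> x _; ring.
apply: (@L1_bounded_mul _ _ (M ^+ 2)) => //.
  exact: measurable_funX.
by move=> x Dx; rewrite normrX lerXn2r ?nnegrE ?(le_trans _ (fM _ Dx))// fM.
Qed.

Lemma L2_L1 f : (mu D < +oo)%E -> L2 D f -> L1 D f.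
Proof.
move=> Dfin [mf hf]; apply: (@L1_le _ (fun x => f x ^+ 2 + 1)) => //.
  move=> x _; rewrite -(real_normK (num_real (f x))).
  by have := normr_ge0 (f x); move: `|f x| => y; nra.
by apply: L1D => //; exact: L1_cst.
Qed.

Lemma L2_finite_bounded f M : (mu D < +oo)%E -> measurable_fun D f ->
  (forall x, D x -> `|f x| <= M) -> L2 D f.
Proof.
move=> Dfin mf fM; split => //; apply: (@L1_finite_bounded _ (M ^+ 2)) => //.
  exact: measurable_funX.
by move=> x Dx; rewrite normrX lerXn2r ?nnegrE ?(le_trans _ (fM _ Dx))// fM.
Qed.

End Integrability.

Lemma L1S (R : realType) (A B : set (measurableTypeR R)) f : measurable A -> measurable B -> A `<=` B ->
  L1 B f -> L1 A f.
Proof. by move=> mA mB AB; exact: integrableS. Qed.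

Lemma L2S (R : realType) (A B : set (measurableTypeR R)) f : measurable A -> measurable B -> A `<=` B ->
  L2 B f -> L2 A f.
Proof.
move=> mA mB AB [mf hf]; split; first exact: measurable_funS mf.
exact: L1S hf.
Qed.

Section Segments.
Variable R : realType.
Local Notation mu := (@lebesgue_measure R).
Implicit Types (f g F : R -> R) (a b x X : R).

Lemma segment_measure a b : a <= b -> mu `[a, b]%classic = (b - a)%:E.
Proof.
move=> ab; transitivity (mu (`[a, b]%classic : set R)) => //.
rewrite lebesgue_measure_itv/= lte_fin; case: ltP => // ba.
by have -> : b = a; [apply/eqP; rewrite eq_le ab ba|rewrite subrr].
Qed.

Lemma segment_finite a b : (mu `[a, b]%classic < +oo)%E.
Proof.
have [ab|ba] := leP a b; first by rewrite segment_measure// ltry.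
by rewrite set_itv_ge ?bnd_simp -?ltNge// measure0.
Qed.

Lemma subset_segment a b c d : c <= a -> b <= d -> `[a, b] `<=` `[c, d].
Proof.
move=> ca bd x /=; rewrite !in_itv/= => /andP[ax xb].
by rewrite (le_trans ca ax) (le_trans xb bd).
Qed.

Lemma integral_cst_segment a b r : a <= b -> \int[mu]_(_ in `[a, b]) r = r * (b - a).
Proof. by move=> ab; rewrite Rintegral_cst// [X in fine X](segment_measure ab). Qed.

Lemma L1_segmentS a b c d f : c <= a -> b <= d -> L1 `[c, d] f -> L1 `[a, b] f.
Proof. by move=> ca bd; apply: L1S => //; exact: subset_segment. Qed.

Lemma integral_cat a b c f : a <= b -> b <= c -> L1 `[a, c] f ->
  \int[mu]_(x in `[a, c]) f x =
  \int[mu]_(x in `[a, b]) f x + \int[mu]_(x in `[b, c]) f x.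
Proof.
move=> ab bc hf.
have h : L1 `]b, c] f.
  apply: (@L1S _ _ _ _ _ _ _ hf) => // x /=; rewrite !in_itv/= => /andP[/ltW bx ->].
  by rewrite (le_trans ab bx).
have E : \int[mu]_(x in `[b, c]) f x = \int[mu]_(x in `]b, c]) f x.
  exact/esym/Rintegral_itv_obnd_cbnd.
apply/eqP; rewrite E addrC -subr_eq; apply/eqP.
by apply: (@Rintegral_itvB _ f (BLeft a) (BRight c) b); rewrite ?bnd_simp.
Qed.

Lemma primitive_le a b x f : L1 `[a, b] f -> x \in `[a, b] ->
  `|\int[mu]_(t in `[a, x]) f t| <= \int[mu]_(t in `[a, b]) `|f t|.
Proof.
rewrite in_itv/= => hf /andP[ax xb].
have hx : L1 `[a, x] f by apply: L1_segmentS hf.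
apply: (le_trans (le_normr_Rintegral _ hx)) => //.
by apply: Rintegral_subset => //; [exact: subset_segment|exact: L1_abs].
Qed.

Lemma primitive_measurable a b f : L1 `[a, b] f ->
  measurable_fun `[a, b] (fun x => \int[mu]_(t in `[a, x]) f t).
Proof.
move=> hf; have [ab|ba] := leP a b; last first.
  by rewrite set_itv_ge ?bnd_simp -?ltNge//; exact: measurable_fun_set0.
apply: subspace_continuous_measurable_fun => //.
exact: parameterized_integral_continuous.
Qed.

Lemma integral_derive a b F f : a <= b -> (forall x, is_derive x 1 F (f x)) ->
  continuous f -> \int[mu]_(x in `[a, b]) f x = F b - F a.
Proof.
rewrite le_eqVlt => /predU1P[<-|ab] dF cf.
  by rewrite set_itv1 Rintegral_set1 subrr.
have cF : continuous F.
  by move=> x; apply/differentiable_continuous/derivable1_diffP; case: (dF x).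
rewrite /Rintegral (@continuous_FTC2 _ f F)//.
- exact: continuous_subspaceT.
- split.
  + by move=> x _; case: (dF x).
  + exact/cvg_at_right_filter/cF.
  + exact/cvg_at_left_filter/cF.
- by move=> x _; rewrite derive1E; case: (dF x).
Qed.

(* Cauchy-Schwarz against the constant 1. *)
Lemma integral_abs_sqr a b f : a < b -> L2 `[a, b] f ->
  (\int[mu]_(x in `[a, b]) `|f x|) ^+ 2 <= (b - a) * \int[mu]_(x in `[a, b]) f x ^+ 2.
Proof.
move=> ab hf; have ba0 : 0 < b - a by rewrite subr_gt0.
have h1 : L1 `[a, b] (fun x => `|f x|).
  by apply: L1_abs => //; apply: L2_L1 hf => //; exact: segment_finite.
set m := \int[mu]_(x in _) `|f x|; set S := \int[mu]_(x in _) f x ^+ 2.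
have : 0 <= \int[mu]_(x in `[a, b]) (`|f x| - m / (b - a)) ^+ 2.
  by apply: Rintegral_ge0 => x _; exact: sqr_ge0.
have -> : \int[mu]_(x in `[a, b]) (`|f x| - m / (b - a)) ^+ 2 =
   \int[mu]_(x in `[a, b]) (f x ^+ 2 - 2 * (m / (b - a)) * `|f x| + (m / (b - a)) ^+ 2).
  apply: eq_Rintegral => x _; rewrite sqrrB (real_normK (num_real _)).
  by ring.
have hc : L1 `[a, b] (fun=> (m / (b - a)) ^+ 2).
  by apply: L1_cst => //; exact: segment_finite.
rewrite RintegralD//; last by apply: L1B => //; [exact: hf.2|exact: L1Z].
rewrite RintegralB//; [|exact: hf.2|exact: L1Z].
rewrite RintegralZl// (integral_cst_segment _ (ltW ab)) -/m -/S => h.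
have : 0 <= (S - 2 * (m / (b - a)) * m + (m / (b - a)) ^+ 2 * (b - a)) * (b - a).
  by rewrite mulr_ge0// ltW.
have -> : (S - 2 * (m / (b - a)) * m + (m / (b - a)) ^+ 2 * (b - a)) * (b - a)
  = (b - a) * S - m ^+ 2 by field; rewrite gt_eqF.
by rewrite subr_ge0.
Qed.

End Segments.

(** * Linear change of variables *)

Section Scaling.
Variable R : realType.
Local Notation mu := (@lebesgue_measure R).
Variable k : R.
Hypothesis k0 : 0 < k.

Let scl : measurableTypeR R -> measurableTypeR R := fun x => k * x.

Let mscl : measurable_fun setT scl.
Proof. exact: mulrl_measurable. Qed.

Let knn : {nonneg R} := NngNum (ltW k0).

Let nu : {measure set (measurableTypeR R) -> \bar R}.
Proof. by unshelve refine (pushforward mu scl : {measure set _ -> \bar R}). Defined.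

(** Both sides are measures that agree on the intervals []a, b]], so uniqueness of Lebesgue measure
    identifies them. This gives the substitution rule for functions that are merely measurable. *)
Let lebesgue_measure_scale (A : set (measurableTypeR R)) : measurable A ->
  mu A = mscale knn nu A.
Proof.
move=> mA; apply: lebesgue_measure_unique => //= _ [[a b]] _ <-.
rewrite /mscale /= /pushforward.
have -> : scl @^-1` `]a, b] = `]k^-1 * a, k^-1 * b]%classic.
  apply/seteqP; split => x; rewrite /= !in_itv/= /scl.
    by rewrite !ler_pdivlMl// !ltr_pdivrMl.
  by rewrite !ler_pdivlMl// !ltr_pdivrMl.
have mE c d : mu (`]c, d]%classic : set R) = if c < d then (d - c)%:E else 0%E.
  by rewrite lebesgue_measure_itv/= lte_fin EFinB.
rewrite [X in (_ * X)%E](mE (k^-1 * a) (k^-1 * b)); rewrite [LHS](mE a b).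
rewrite ltr_pM2l ?invr_gt0//; case: ifP => _; last by rewrite mule0.
by rewrite -EFinM -mulrBr mulVKf// gt_eqF.
Qed.

Lemma ge0_integral_scale (D : set (measurableTypeR R)) (h : R -> \bar R) :
  measurable D -> measurable_fun D h -> (forall x, D x -> 0 <= h x)%E ->
  (\int[mu]_(x in D) h x = k%:E * \int[mu]_(x in (fun x => k * x)%R @^-1` D) h (k * x)%R)%E.
Proof.
move=> mD mh h0.
rewrite (@eq_measure_integral _ _ _ _ (mscale knn nu)); last first.
  by move=> A mA _; exact: lebesgue_measure_scale.
rewrite ge0_integral_mscale//; congr (_ * _)%E; rewrite ge0_integral_pushforward//.
by move=> x /set_mem/h0.
Qed.

End Scaling.

Section ScalingReal.
Variable R : realType.
Local Notation mu := (@lebesgue_measure R).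
Variables (k y : R).
Hypothesis k0 : 0 < k.
Implicit Types g : R -> R.

Lemma scale_preimage_segment : (fun x => k * x) @^-1` `[0, k * y] = `[0, y]%classic.
Proof.
by apply/seteqP; split => x; rewrite /= !in_itv/= ler_pM2l// pmulr_rge0.
Qed.

Lemma measurable_scale g : measurable_fun `[0, k * y] g ->
  measurable_fun `[0, y] (fun x => g (k * x)).
Proof.
move=> mg; apply: (@measurable_comp _ _ _ _ _ _ `[0, k * y]%classic g) => //.
- by rewrite -scale_preimage_segment; exact: image_preimage_subset.
Qed.

Lemma L1_scale g : L1 `[0, k * y] g -> L1 `[0, y] (fun x => g (k * x)).
Proof.
move=> /integrableP[/measurable_EFinP mg gfin]; apply/integrableP; split.
  by apply/measurable_EFinP; apply: measurable_scale.
move: gfin; rewrite (ge0_integral_scale k0)//; last first.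
  by apply/measurable_EFinP; exact: measurableT_comp mg.
rewrite scale_preimage_segment => h; apply: contraTT h; rewrite -!leNgt !leye_eq.
by move=> /eqP ->; rewrite gt0_muley// lte_fin.
Qed.

Lemma integral_scale g : L1 `[0, k * y] g ->
  \int[mu]_(x in `[0, k * y]) g x = k * \int[mu]_(x in `[0, y]) g (k * x).
Proof.
move=> hg; have hs := L1_scale hg.
rewrite /Rintegral -[k in RHS]/(fine k%:E) -fineM//; last exact: integrable_fin_num.
congr fine.
pose h x := g (k * x).
have mg : measurable_fun (`[0, k * y] : set (measurableTypeR R)) (EFin \o g).
  exact: measurable_int hg.
have E1 : (\int[mu]_(x in `[0%R, (k * y)%R]) (g x)%:E = \int[mu]_(x in `[0%R, (k * y)%R]) (EFin \o g)^\+ x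
   - \int[mu]_(x in `[0%R, (k * y)%R]) (EFin \o g)^\- x)%E by rewrite integralE.
have E2 : (\int[mu]_(x in `[0%R, y]) (h x)%:E = \int[mu]_(x in `[0%R, y]) (EFin \o h)^\+ x
   - \int[mu]_(x in `[0%R, y]) (EFin \o h)^\- x)%E by rewrite integralE.
rewrite E1 E2 (ge0_integral_scale k0)//; last exact: measurable_funepos.
rewrite [X in (_ - X)%E](ge0_integral_scale k0)//; last exact: measurable_funeneg.
(* In the extended reals [k] distributes over a difference once one term is finite; integrability
   provides this for the negative part. *)
have H (p q : \bar R) : q \is a fin_num -> (k%:E * p - k%:E * q = k%:E * (p - q))%E.
  by move=> qf; rewrite muleBr// fin_num_adde_defl// fin_numN.
have qf : (\int[mu]_(x in `[0%R, y]) (EFin \o h)^\- x)%E \is a fin_num.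
  exact: (integrable_neg_fin_num (mu := mu) _ hs).
rewrite scale_preimage_segment; apply: etrans (H _ _ qf).
congr (_ - _)%E; congr (_ * _)%E.
- by apply: eq_integral => x _; rewrite !funeposE.
- by apply: eq_integral => x _; rewrite !funenegE.
Qed.

End ScalingReal.

(** * The product of two primitives *)

Section ProductRule.
Variable R : realType.
Local Notation mu := (@lebesgue_measure R).

Lemma L1_restrict (D : set (measurableTypeR R)) (f : R -> R) : measurable D ->
  L1 D f -> L1 setT (f \_ D).
Proof.
move=> mD hf; have := (integrable_mkcond (mu := mu) (EFin \o f) mD).1 hf.
by apply: eq_integrable => // x _; rewrite restrict_EFin.
Qed.

(* Fubini on the two triangles of the square [0, X]^2. *)
Lemma integral_product_rule (X : R) (u v : R -> R) :
  L1 `[0, X] u -> L1 `[0, X] v ->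
  (\int[mu]_(x in `[0, X]) u x) * (\int[mu]_(x in `[0, X]) v x) =
  \int[mu]_(x in `[0, X]) (u x * \int[mu]_(t in `[0, x]) v t) +
  \int[mu]_(x in `[0, X]) (v x * \int[mu]_(t in `[0, x]) u t).
Proof.
move=> hu hv.
pose T := measurableTypeR R.
pose a : T -> R := u \_ `[0, X]; pose b : T -> R := v \_ `[0, X].
pose f (z : T * T) : R := if z.2 <= z.1 then a z.1 * b z.2 else 0.
have ia : L1 setT a by apply: L1_restrict.
have ib : L1 setT b by apply: L1_restrict.
have ma := L1_measurable ia; have mb := L1_measurable ib.
have mf : measurable_fun setT f.
  apply: measurable_fun_ifT => //=.
  - by apply: measurable_fun_ler; [exact: measurable_snd|exact: measurable_fst].
  - apply: measurable_funM; apply: measurableT_comp => //.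
have intf : (mu \x mu)%E.-integrable setT (EFin \o f).
  apply/integrable12ltyP; first exact/measurable_EFinP.
  pose B := \int[mu]_y `|b y|.
  have EB : (\int[mu]_y (`|b y|)%:E = B%:E)%E.
    by rewrite fineK//; apply: integrable_fin_num => //; apply: (@L1_abs R setT).
  apply: (@le_lt_trans _ _ (\int[mu]_x (`|a x| * B)%:E)%E); last first.
    have := @L1_abs R setT measurableT _ ia.
    move=> /(@L1Z R setT measurableT B) /integrable_lty h.
    apply: le_lt_trans (h measurableT); rewrite le_eqVlt; apply/orP; left; apply/eqP.
    by apply: eq_integral => x _; rewrite /= mulrC.
  apply: ge0_le_integral => //=.
  - by move=> x _; apply: integral_ge0.
  - apply: (measurable_fun_fubini_tonelli_F (fun z => `|(f z)%:E|)%E) => //.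
    by apply: measurableT_comp => //; exact/measurable_EFinP.
  - by apply/measurable_EFinP; apply: measurable_funM => //; apply: measurableT_comp.
  move=> x _; rewrite EFinM -EB -ge0_integralZl//; last first.
    by apply/measurable_EFinP; apply: measurableT_comp.
  apply: ge0_le_integral => //=.
  - apply/measurable_EFinP; apply: measurableT_comp => //.
    by apply: measurableT_comp mf (pair1_measurable x).
  - by apply/measurable_EFinP; apply: measurable_funM => //; apply: measurableT_comp.
  - move=> y _; rewrite -EFinM lee_fin /f /=; case: ifP => _; first by rewrite normrM.
    by rewrite normr0 mulr_ge0.
pose V x := \int[mu]_(t in `[0, x]) v t; pose U x := \int[mu]_(t in `[0, x]) u t.
have IZ (D : set (measurableTypeR R)) (g : R -> R) (r : R) : measurable D -> L1 D g ->
    (\int[mu]_x (r * (g \_ D) x)%:E = (r * \int[mu]_(x in D) g x)%:E)%E.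
  move=> mD hg; under eq_integral do rewrite EFinM.
  rewrite (integralZl (mu := mu) measurableT (f := EFin \o (g \_ D))); last exact: L1_restrict.
  rewrite -restrict_EFin -integral_mkcond EFinM fineK//.
  exact: integrable_fin_num.
have E1 x : (\int[mu]_y (f (x, y))%:E = (a x * V x)%:E)%E.
  rewrite /a patchE; case: ifPn => [/set_mem /= |xX].
    rewrite in_itv/= => /andP[x0 xX].
    rewrite -IZ//; last exact: L1_segmentS hv.
    apply: eq_integral => y _; rewrite /f /= /a /b !patchE !mem_setE !in_itv/= x0 xX/=.
    case: (leP y x) => yx; last by rewrite andbF mulr0.
    by rewrite (le_trans yx xX) !andbT.
  rewrite mul0r integral0_eq// => y _; rewrite /f /=; case: ifP => // _.
  by rewrite /a patchE (negbTE xX) mul0r.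
(* Only the triangle [y <= x] is integrated, in both orders. With [x] first the slice at [y] is
   [[y, X]]; writing its integral as [U X - U y] produces the product of the full integrals and the
   contribution of the other triangle. *)
have E2 y : (\int[mu]_x (f (x, y))%:E = (b y * (U X - U y))%:E)%E.
  rewrite /b patchE; case: ifPn => [/set_mem /= |yX].
    rewrite in_itv/= => /andP[y0 yX].
    have -> : U X - U y = \int[mu]_(x in `[y, X]) u x.
      by rewrite /U (integral_cat y0 yX hu) addrC addKr.
    rewrite -IZ//; last exact: L1_segmentS hu.
    apply: eq_integral => x _; rewrite /f /= /a /b !patchE !mem_setE !in_itv/= y0 yX/=.
    case: (leP y x) => yx /=; last by rewrite mulr0.
    by rewrite (le_trans y0 yx) /= mulrC.
  rewrite mul0r integral0_eq// => x _; rewrite /f /=; case: ifP => // _.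
  by rewrite /b patchE (negbTE yX) mulr0.
have := Fubini intf; rewrite /=.
under eq_integral do rewrite E1.
under [X in _ = X -> _]eq_integral do rewrite E2.
move=> /(congr1 fine).
rewrite -/(Rintegral mu setT (fun x => a x * V x)).
rewrite -/(Rintegral mu setT (fun x => b x * (U X - U x))).
have R1 : (fun x => a x * V x) = (fun x => u x * V x) \_ `[0, X].
  by apply/funext => x; rewrite /a !patchE; case: ifP => // _; rewrite mul0r.
have R2 : (fun x => b x * (U X - U x)) = (fun x => v x * (U X - U x)) \_ `[0, X].
  by apply/funext => x; rewrite /b !patchE; case: ifP => // _; rewrite mul0r.
rewrite R1 R2 -!Rintegral_mkcond -/(U X) -/(V X) => ->.
have iv : L1 `[0, X] (fun x => v x * U x).
  apply: (@L1_ext _ _ _ (fun x => U x * v x)) => //; first by move=> x _; rewrite mulrC.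
  apply: (@L1_bounded_mul _ _ _ _ _ (\int[mu]_(t in `[0, X]) `|u t|)) => //.
  - exact: primitive_measurable.
  - by move=> x /= ?; apply: primitive_le.
rewrite -RintegralD//; last first.
  apply: (@L1_ext _ _ _ (fun x => U X * v x - v x * U x)) => //.
    by move=> x _; rewrite mulrBr mulrC.
  by apply: L1B => //; apply: L1Z.
rewrite -RintegralZl//.
by apply: eq_Rintegral => x _; rewrite mulrBr subrK mulrC.
Qed.

End ProductRule.

(** * Linear differential systems with integrable coefficients *)

Section Gronwall.
Variable R : realType.
Local Notation mu := (@lebesgue_measure R).

(** Plays the role of letting [n] tend to infinity: by the Archimedean property [d / 2 ^+ n] falls
    below any gap [a - b > 0]. *)
Lemma le_add_div_expn (a b d : R) : (forall n, a <= b + d / 2 ^+ n) -> a <= b.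
Proof.
move=> h; rewrite leNgt; apply/negP => ba.
have e0 : 0 < a - b by rewrite subr_gt0.
pose n := Num.bound (`|d| / (a - b)).
have n1 : `|d| / (a - b) < n%:R by apply: archi_boundP; rewrite divr_ge0// ltW.
have n2 : n%:R < 2 ^+ n :> R by rewrite -natrX ltr_nat ltn_expl.
have : d / 2 ^+ n < a - b.
  rewrite ltr_pdivrMr ?exprn_gt0//; apply: (le_lt_trans (ler_norm _)).
  rewrite mulrC -ltr_pdivrMr//; exact: lt_trans n1 n2.
by rewrite ltNge lerBlDl h.
Qed.

Lemma integral_expR (k x : R) : 0 < k -> 0 <= x ->
  \int[mu]_(t in `[0, x]) expR (k * t) = (expR (k * x) - 1) / k.
Proof.
move=> k0 x0.
have dF (t : R) : is_derive t 1 (fun t => k^-1 * expR (k * t)) (expR (k * t)).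
  have h : is_derive t 1 (fun t => k * t) k.
    by apply: is_derive_eq; rewrite /GRing.scale/= mulr1.
  have h2 := is_derive1_comp (is_derive_expR (k * t)) h.
  suff -> : expR (k * t) = k^-1 * (expR (k * t) * k) by exact: (is_deriveZ k^-1 h2).
  by rewrite mulrCA mulVf ?mulr1// gt_eqF.
rewrite (integral_derive x0 dF).
  by rewrite mulr0 expR0 mulr1 mulrBl mul1r mulrC.
move=> t; apply: (@continuous_comp _ _ _ (fun t => k * t) expR).
  exact: mulrl_continuous.
exact: continuous_expR.
Qed.

Lemma L1_expR (k X : R) : L1 `[0, X] (fun t => expR (k * t)).
Proof.
apply: continuous_compact_integrable; first exact: segment_compact.
apply: continuous_subspaceT => t; apply: (@continuous_comp _ _ _ (fun t => k * t) expR).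
  exact: mulrl_continuous.
exact: continuous_expR.
Qed.

(** The exponential rate is twice the constant [k] of the integral inequality, so that each
    integration gains a factor 1/2. Both the Gronwall and the Picard iterations live on this
    factor. *)
Lemma integral_expR_le (k x : R) : 0 < k -> 0 <= x ->
  k * \int[mu]_(t in `[0, x]) expR (2 * k * t) <= (expR (2 * k * x) - 1) / 2.
Proof.
move=> k0 x0; rewrite integral_expR ?mulr_gt0//.
by rewrite le_eqVlt; apply/orP; left; apply/eqP; field; rewrite gt_eqF.
Qed.

(* Iterating the bound [h <= S e^(2kx)] gives [h <= (c + S/2) e^(2kx)], hence
   the bound with the fixed point [S = 2c]. *)
Lemma gronwall (X k c : R) (h : R -> R) : 0 < k -> 0 <= c -> L1 `[0, X] h ->
  (forall x, 0 <= x <= X -> 0 <= h x) ->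
  (forall x, 0 <= x <= X -> h x <= c + k * \int[mu]_(t in `[0, x]) h t) ->
  forall x, 0 <= x <= X -> h x <= 2 * c * expR (2 * k * x).
Proof.
move=> k0 c0 hL h0 hle.
(* The hypothesis on [h] itself, with the integral extended to [[0, X]], shows [h <= S]; this starts
   the iteration. *)
pose S := c + k * \int[mu]_(t in `[0, X]) h t.
have S0 : 0 <= S.
  rewrite addr_ge0//; apply: mulr_ge0; first exact: ltW.
  apply: Rintegral_ge0 => x /=.
  by rewrite in_itv/=; exact: h0.
have e1 x : 0 <= x -> 1 <= expR (2 * k * x).
  by move=> x0; rewrite -expR0 ler_expR mulr_ge0// mulr_ge0// ltW.
have step n : forall x, 0 <= x <= X -> h x <= (2 * c + S / 2 ^+ n) * expR (2 * k * x).
  elim: n => [x xX|n IH x xX].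
    have /andP[x0 x1] := xX.
    apply: (@le_trans _ _ S).
      apply: (le_trans (hle _ xX)); rewrite lerD2l ler_pM2l//.
      by apply: Rintegral_subset => //; exact: subset_segment.
    rewrite expr0 divr1; have := e1 x x0; move: (expR _) => e e1x.
    by move: S0 c0 e1x; clear; nra.
  have /andP[x0 x1] := xX.
  apply: (le_trans (hle _ xX)).
  set s := 2 * c + S / 2 ^+ n in IH.
  have s0 : 0 <= s by rewrite addr_ge0// ?mulr_ge0// invr_ge0 exprn_ge0.
  have : k * \int[mu]_(t in `[0, x]) h t <= s * ((expR (2 * k * x) - 1) / 2).
    apply: (@le_trans _ _ (k * \int[mu]_(t in `[0, x]) (s * expR (2 * k * t)))).
      rewrite ler_pM2l//; apply: le_Rintegral => //.
      - by apply: L1_segmentS hL.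
      - by apply: L1Z => //; exact: L1_expR.
      - move=> t /=; rewrite in_itv/= => /andP[t0 tx]; apply: IH.
        by rewrite t0 (le_trans tx).
    rewrite RintegralZl//; last exact: L1_expR.
    by rewrite mulrCA ler_wpM2l// integral_expR_le.
  move=> /(lerD (lexx c)) /le_trans; apply.
  have -> : 2 * c + S / 2 ^+ n.+1 = c + s / 2.
    rewrite /s exprS; field; exact: expf_neq0.
  have := e1 x x0; move: (expR _) => e e1x.
  have := mulr_ge0 c0 (_ : 0 <= e - 1); rewrite subr_ge0 => /(_ e1x).
  move=> ce; rewrite -subr_ge0.
  suff -> : (c + s / 2) * e - (c + s * ((e - 1) / 2)) = c * (e - 1) + s / 2.
    by rewrite addr_ge0// divr_ge0.
  by field.
move=> x xX; apply: (@le_add_div_expn _ _ (S * expR (2 * k * x))) => n.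
by apply: (le_trans (step n x xX)); rewrite mulrDl [S / _ * _]mulrAC.
Qed.

End Gronwall.

Section LinearSystem.
Variable R : realType.
Local Notation mu := (@lebesgue_measure R).
Variables (J : finType) (A : J -> J -> R -> R) (M : R) (F : J -> R -> R) (a : J -> R).
Hypothesis mA : forall j k, measurable_fun setT (A j k).
Hypothesis AM : forall j k x, `|A j k x| <= M.
Hypothesis LF : forall j X, L1 `[0, X] (F j).

Let G (Y : J -> R -> R) j x := \sum_k A j k x * Y k x + F j x.

(** Picard iteration for the integrated system, since the coefficients are only measurable and the
    forcing only locally integrable. The iterates do not depend on an end point [X], hence one
    solution serves every segment. *)
Fixpoint picard n : J -> R -> R :=
  if n is m.+1 then fun j x => a j + \int[mu]_(t in `[0, x]) G (picard m) j t
  else fun _ _ => 0.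

Let M0 (j : J) : 0 <= M.
Proof. exact: le_trans (normr_ge0 _) (AM j j 0). Qed.

Let LG Y X : (forall j, L1 `[0, X] (Y j)) -> forall j, L1 `[0, X] (G Y j).
Proof.
move=> hY j; apply: L1D => //; apply: L1_sum => // k.
apply: (@L1_bounded_mul _ _ _ _ _ M) => //.
by apply: measurable_funTS; apply: mA.
Qed.

Lemma L1_add_primitive (c X : R) f : L1 `[0, X] f ->
  L1 `[0, X] (fun x => c + \int[mu]_(t in `[0, x]) f t).
Proof.
move=> hf; apply: L1D => //; first by apply: L1_cst => //; exact: segment_finite.
apply: (@L1_finite_bounded _ _ _ _ (\int[mu]_(t in `[0, X]) `|f t|)) => //.
- exact: segment_finite.
- exact: primitive_measurable.
- by move=> x /= xX; exact: primitive_le.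
Qed.

Lemma L1_picard n j X : L1 `[0, X] (picard n j).
Proof.
elim: n j => [|n IH] j; first by apply: L1_cst => //; exact: segment_finite.
by apply: L1_add_primitive; exact: LG.
Qed.

(** A bound for the row sums of [A], increased by 1 so that it is positive even when [J] is empty or
    [M = 0]. *)
Let k := M * #|J|%:R + 1.
Let c X := \sum_j (`|a j| + \int[mu]_(t in `[0, X]) `|F j t|).

Let k0 : 0 < k.
Proof.
rewrite /k; have [J0|] := eqVneq #|J| 0%N; first by rewrite J0 mulr0 add0r.
rewrite -lt0n => /card_gt0P[j _].
by rewrite ltr_wpDl// mulr_ge0// (M0 j).
Qed.

Let c0 X : 0 <= c X.
Proof.
by apply: sumr_ge0 => j _; rewrite addr_ge0//; apply: Rintegral_ge0.
Qed.

Let e X := expR (2 * k * X).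

Let e0 X : 0 <= e X. Proof. exact: expR_ge0. Qed.

(** In the sup norm weighted by [expR (2 * k * x)] the iteration contracts by 1/2, and [c X] bounds
    the first iterate. *)
Lemma picard_step n j X x : 0 <= x <= X ->
  `|picard n.+1 j x - picard n j x| <= c X / 2 ^+ n * e x.
Proof.
move=> xX; have /andP[x0 x1] := xX.
elim: n j x xX x0 x1 => [|n IH] j x xX x0 x1.
  rewrite /= subr0 expr0 divr1.
  have -> : \int[mu]_(t in `[0, x]) G (fun _ _ => 0) j t = \int[mu]_(t in `[0, x]) F j t.
    apply: eq_Rintegral => t _; rewrite /G big1 ?add0r// => i _.
    by rewrite mulr0.
  apply: (@le_trans _ _ (c X)); last first.
    rewrite ler_peMr// /e -expR0 ler_expR mulr_ge0// mulr_ge0// ltW//.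
  apply: (@le_trans _ _ (`|a j| + \int[mu]_(t in `[0, X]) `|F j t|)).
    by rewrite (le_trans (ler_normD _ _))// lerD2l; apply: primitive_le.
  rewrite /c (bigD1 j)//= lerDl sumr_ge0// => i _.
  by rewrite addr_ge0//; apply: Rintegral_ge0.
have picardS m : picard m.+1 j x = a j + \int[mu]_(t in `[0, x]) G (picard m) j t by [].
rewrite (picardS n.+1) (picardS n) opprD addrACA subrr add0r.
have LP m i := L1_picard m i x.
rewrite -RintegralB//; [|exact: LG|exact: LG].
set s := c X / 2 ^+ n in IH *.
have s0 : 0 <= s by rewrite mulr_ge0// invr_ge0 exprn_ge0.
apply: (@le_trans _ _ (\int[mu]_(t in `[0, x]) (M * #|J|%:R * s * e t))).
  apply: integral_abs_le => //.
  - by apply: L1B => //; exact: LG.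
  - by apply: L1Z => //; exact: L1_expR.
  move=> t /=; rewrite in_itv/= => /andP[t0 tx].
  have tX := le_trans tx x1.
  rewrite /G opprD addrACA subrr addr0 -sumrB.
  apply: (le_trans (ler_norm_sum _ _ _)).
  have -> : M * #|J|%:R * s * e t = \sum_(i : J) M * (s * e t).
    by rewrite sumr_const -mulr_natr; ring.
  apply: ler_sum => i _.
  rewrite -mulrBr normrM ler_pM// IH// ?t0//.
rewrite RintegralZl//; last exact: L1_expR.
have -> : c X / 2 ^+ n.+1 = s / 2.
  by rewrite /s exprS; field; exact: expf_neq0.
set I := \int[mu]_(t in _) _.
have -> : M * #|J|%:R * s * I = s * (M * #|J|%:R * I) by ring.
rewrite -[leRHS]mulrA {}/I.
apply: ler_wpM2l => //.
apply: (@le_trans _ _ (k * \int[mu]_(t in `[0, x]) e t)).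
  apply: ler_wpM2r; last by rewrite /k lerDl.
  by apply: Rintegral_ge0 => t _; exact: expR_ge0.
apply: (le_trans (integral_expR_le k0 x0)).
by rewrite mulrC ler_wpM2l ?invr_ge0// lerBlDr lerDl.
Qed.

Lemma picard_bound n j X x : 0 <= x <= X ->
  `|picard n j x| <= 2 * c X * e X.
Proof.
move=> xX; have /andP[x0 x1] := xX.
(* [2 - 2 / 2 ^+ n] is the partial sum of the geometric series of the step bounds. *)
suff h : `|picard n j x| <= c X * (2 - 2 / 2 ^+ n) * e x.
  apply: (le_trans h); rewrite [2 * c X]mulrC ler_pM//.
  - rewrite mulr_ge0// subr_ge0 -[leRHS]mulr1 ler_pM2l// invf_le1 ?exprn_gt0// exprn_ege1// ler1n//.
  - by rewrite ler_wpM2l// gerBl divr_ge0// exprn_ge0.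
  - by rewrite ler_expR ler_pM2l// mulr_gt0.
elim: n => [|n IH]; first by rewrite normr0 expr0 divr1 subrr mulr0 mul0r.
rewrite -[picard n.+1 j x](subrK (picard n j x)).
apply: (le_trans (ler_normD _ _)).
apply: (le_trans (lerD (picard_step n j xX) IH)).
rewrite -mulrDl ler_wpM2r ?e0// -mulrDr ler_wpM2l//.
by rewrite le_eqVlt; apply/orP; left; apply/eqP; rewrite exprS; field; exact: expf_neq0.
Qed.

Lemma picard_cvg j x : 0 <= x -> cvgn (fun n => picard n j x).
Proof.
move=> x0; set u := fun n => _.
have -> : u = series (telescope u).
  by rewrite telescopeK; apply/funext => n /=; rewrite subr0.
apply: normed_cvg.
apply: (@series_le_cvg _ _ (geometric (c x * e x) 2^-1)).
- by move=> n; exact: normr_ge0.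
- by move=> n /=; rewrite mulr_ge0 ?exprn_ge0 ?invr_ge0// mulr_ge0 ?e0.
- move=> n; rewrite /telescope /geometric/= /u.
  apply: (le_trans (@picard_step n j x x _)); first by rewrite x0 lexx.
  by rewrite exprVn mulrAC.
apply: is_cvg_geometric_series; by rewrite ger0_norm ?invr_ge0// invf_lt1// ltr1n.
Qed.

(** The steps are dominated by a geometric series, so the iterates converge pointwise; their bound,
    uniform in [n], lets dominated convergence carry the integral equation to the limit. *)
Lemma linear_system_solution : exists Y : J -> R -> R,
  (forall j X, L1 `[0, X] (Y j)) /\
  forall j x, 0 <= x ->
    Y j x = a j + \int[mu]_(t in `[0, x]) (\sum_k A j k t * Y k t + F j t).
Proof.
pose Y j x := limn (fun n => picard n j x).
have cvgY j x : 0 <= x -> picard n j x @[n --> \oo] --> Y j x.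
  by move=> x0; exact: picard_cvg.
have YB j X x : 0 <= x <= X -> `|Y j x| <= 2 * c X * e X.
  move=> xX; have /andP[x0 _] := xX.
  have h : `|picard n j x| @[n --> \oo] --> `|Y j x| by apply: cvg_norm; exact: cvgY.
  rewrite -(cvg_lim _ h)//; apply: limr_le; first exact: cvgP h.
  by apply: nearW => n; exact: picard_bound.
have mY j X : measurable_fun (`[0, X] : set (measurableTypeR R)) (Y j).
  apply: (@measurable_fun_cvg _ _ _ _ (fun n => picard n j)).
    by move=> n; apply: L1_measurable; exact: L1_picard.
  by move=> x /=; rewrite in_itv/= => /andP[x0 _]; exact: cvgY.
have LY j X : L1 `[0, X] (Y j).
  apply: (@L1_finite_bounded _ _ _ _ (2 * c X * e X)) => //.
    exact: segment_finite.
  by move=> x /=; rewrite in_itv/= => xX; exact: YB.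
exists Y; split => // j x x0.
have h1 : (fun n => picard n.+1 j x) @ \oo --> Y j x.
  by rewrite (cvg_shiftS (fun n => picard n j x)); exact: cvgY.
have h2 : (fun n => picard n.+1 j x) @ \oo --> a j + \int[mu]_(t in `[0, x]) G Y j t.
  apply: cvgD; first exact: cvg_cst.
  apply: fine_cvg; rewrite fineK; last first.
    by apply: integrable_fin_num => //; apply: LG.
  pose D : set (measurableTypeR R) := `[0, x]%classic.
  pose g t := \sum_(i : J) M * (2 * c x * e x) + `|F j t|.
  have mD : measurable D by exact: measurable_itv.
  have Lg : L1 D g.
    apply: L1D => //; last by apply: L1_abs => //; exact: LF.
    by apply: L1_cst => //; exact: segment_finite.
  have mGp n : measurable_fun D (fun t => (G (picard n) j t)%:E).
    by apply/measurable_EFinP; apply: L1_measurable; apply: LG => i; exact: L1_picard.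
  have mGY : measurable_fun D (fun t => (G Y j t)%:E).
    by apply/measurable_EFinP; apply: L1_measurable; apply: LG => i.
  have cG : {ae mu, forall t, D t -> (G (picard n) j t)%:E @[n --> \oo] --> (G Y j t)%:E}.
    apply: aeW => t; rewrite /D/= in_itv/= => /andP[t0 tx].
    apply: cvg_EFin; first by apply: nearW.
    apply: cvgD; last exact: cvg_cst.
    apply: cvg_big => [|i _]; first exact: add_continuous.
    by apply: cvgM; [exact: cvg_cst|exact: cvgY].
  have bG : {ae mu, forall t n, D t -> (`|(G (picard n) j t)%:E| <= (EFin \o g) t)%E}.
    apply: aeW => t n; rewrite /D/= in_itv/= => tx.
    rewrite lee_fin (le_trans (ler_normD _ _))// lerD2r (le_trans (ler_norm_sum _ _ _))//.
    by apply: ler_sum => i _; rewrite normrM ler_pM// picard_bound.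
  by have [] := dominated_convergence mD mGp mGY cG Lg bG.
exact: (cvg_unique _ h1 h2).
Qed.

End LinearSystem.

(** * Trace estimates *)

Section Trace.
Variable R : realType.
Local Notation mu := (@lebesgue_measure R).
Implicit Types (a x X : R) (u v w : R -> R).

Lemma primitive_shift x X f g : 0 <= x -> L1 `[0, X] g ->
  (forall y, 0 <= y <= X -> f y = f 0 + \int[mu]_(t in `[0, y]) g t) ->
  forall y, x <= y <= X -> f y = f x + \int[mu]_(t in `[x, y]) g t.
Proof.
move=> x0 hg h y /andP[xy yX].
rewrite (h y) ?(le_trans x0 xy)// (h x) ?x0 ?(le_trans xy yX)//.
by rewrite (integral_cat x0 xy (L1_segmentS (lexx 0) yX hg)) addrA.
Qed.

Lemma integral_shift_pow x a n : 0 <= a ->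
  \int[mu]_(y in `[x, x + a]) (y - x) ^+ n = a ^+ n.+1 / n.+1%:R.
Proof.
move=> a0.
have xa : x <= x + a by rewrite lerDl.
have dF (t : R) : is_derive t 1 (fun y => n.+1%:R^-1 * (y - x) ^+ n.+1) ((t - x) ^+ n).
  have h : is_derive t 1 (fun y => y - x) 1 by apply: is_derive_eq; rewrite subr0.
  have E : (fun y => y - x) ^+ n.+1 = (fun y => (y - x) ^+ n.+1).
    apply/funext => y; elim: n.+1 => [|m IH]; first by rewrite !expr0.
    by rewrite [in RHS]exprS -IH exprS.
  have h2 := is_deriveX n.+1 h; rewrite E in h2.
  suff -> : (t - x) ^+ n = n.+1%:R^-1 * ((n.+1%:R * (t - x) ^+ n) * 1).
    exact: (is_deriveZ n.+1%:R^-1 h2).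
  by rewrite mulr1 mulKf// pnatr_eq0.
rewrite (integral_derive xa dF).
  by rewrite subrr expr0n/= mulr0 subr0 addrAC subrr add0r mulrC.
move=> t; apply: (@continuous_comp _ _ _ (fun y => y - x) (fun y => y ^+ n)).
  by apply: continuousB; [exact: cvg_id|exact: cst_continuous].
exact: exprn_continuous.
Qed.

Lemma L1_shift_pow x a n : L1 `[x, x + a] (fun y => (y - x) ^+ n).
Proof.
apply: continuous_compact_integrable; first exact: segment_compact.
apply: continuous_subspaceT => t; apply: (@continuous_comp _ _ _ (fun y => y - x) (fun y => y ^+ n)).
  by apply: continuousB; [exact: cvg_id|exact: cst_continuous].
exact: exprn_continuous.
Qed.

(* By Taylor's formula [u] is, up to [a^2 * int |w|], the affine function
   [u x + (y - x) v x], whose coefficients are controlled by its L^1 norm. *)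
Lemma trace_L1 a x u v w : 0 < a -> L1 `[x, x + a] u -> L1 `[x, x + a] w ->
  (forall y, x <= y <= x + a -> u y = u x + \int[mu]_(t in `[x, y]) v t) ->
  (forall y, x <= y <= x + a -> v y = v x + \int[mu]_(t in `[x, y]) w t) ->
  let S := \int[mu]_(t in `[x, x + a]) `|u t| +
           a ^+ 2 * \int[mu]_(t in `[x, x + a]) `|w t| in
  `|u x| <= 4 / a * S /\ `|v x| <= 6 / a ^+ 2 * S.
Proof.
move=> a0 hu hw uE vE S.
have xa : x <= x + a by rewrite lerDl ltW.
set W := \int[mu]_(t in _) `|w t| in S *.
have W0 : 0 <= W by apply: Rintegral_ge0.
pose g y := u x + v x * (y - x).
have Lsub y : x <= y <= x + a -> L1 `[x, y] w.
  by move=> /andP[xy ya]; apply: L1_segmentS hw.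
have ug y : x <= y <= x + a -> `|u y - g y| <= a * W.
  move=> /[dup] xya /andP[xy ya]; rewrite uE// /g opprD addrACA subrr add0r.
  have Lc : L1 `[x, y] (fun=> v x) by apply: L1_cst => //; exact: segment_finite.
  have Lv : L1 `[x, y] v.
    apply: (@L1_ext _ _ _ (fun t => v x + \int[mu]_(s in `[x, t]) w s)) => //.
      move=> t /=; rewrite in_itv/= => /andP[xt ty]; rewrite -vE// xt.
      exact: le_trans ty ya.
    apply: L1D => //; apply: (@L1_finite_bounded _ _ _ _ (\int[mu]_(t in `[x, y]) `|w t|)) => //.
    - exact: segment_finite.
    - by apply: primitive_measurable; exact: Lsub.
    - by move=> t /= ty; apply: primitive_le => //; exact: Lsub.
  rewrite -(integral_cst_segment (v x) xy) -RintegralB//.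
  apply: (@le_trans _ _ (\int[mu]_(t in `[x, y]) W)).
    apply: integral_abs_le => //; first exact: L1B.
    - by apply: L1_cst => //; exact: segment_finite.
    - move=> t /=; rewrite in_itv/= => /andP[xt ty].
      have ta := le_trans ty ya.
      rewrite vE ?xt// addrAC subrr add0r; apply: primitive_le => //.
      by rewrite in_itv/= xt ta.
  rewrite integral_cst_segment// mulrC ler_wpM2r//.
  by rewrite lerBlDl.
have Lg : L1 `[x, x + a] g.
  apply: L1D => //; first by apply: L1_cst => //; exact: segment_finite.
  by apply: L1Z => //; exact: (@L1_shift_pow x a 1).
have gS : \int[mu]_(y in `[x, x + a]) `|g y| <= S.
  apply: (@le_trans _ _ (\int[mu]_(y in `[x, x + a]) (`|u y| + a * W))).
    apply: le_Rintegral => //.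
    - by apply: L1_abs.
    - apply: L1D => //; first by apply: L1_abs.
      by apply: L1_cst => //; exact: segment_finite.
    - move=> y /=; rewrite in_itv/= => xy; have := ug y xy.
      have := ler_normB (u y) (u y - g y).
      by rewrite opprB addrC subrK => h1 h2; apply: (le_trans h1); rewrite lerD2l.
  rewrite RintegralD//; [|by apply: L1_abs|by apply: L1_cst => //; exact: segment_finite].
  rewrite integral_cst_segment// /S lerD2l addrAC subrr add0r.
  by rewrite mulrAC expr2.
have S0 : 0 <= S by apply: le_trans gS; apply: Rintegral_ge0.
have L0 r : L1 `[x, x + a] (fun=> r) by apply: L1_cst => //; exact: segment_finite.
have Ls := @L1_shift_pow x a.
(* Testing the affine function [g] against the distance to the midpoint [x + a / 2] kills its value
   and isolates its slope: the integral of [(y - x) * (y - x - a / 2)] is [a ^+ 3 / 12]. *)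
have m1 : v x * a ^+ 3 / 12 = \int[mu]_(y in `[x, x + a]) (g y * (y - x - a / 2)).
  transitivity (\int[mu]_(y in `[x, x + a]) (- u x * a / 2 +
     ((u x - v x * a / 2) * (y - x) ^+ 1 + v x * (y - x) ^+ 2))).
    rewrite RintegralD//; [|exact: L0|by apply: L1D => //; apply: L1Z].
    rewrite integral_cst_segment// RintegralD//; [|exact: L1Z|exact: L1Z].
    rewrite RintegralZl; [|by []|exact: Ls]; rewrite RintegralZl; [|by []|exact: Ls].
    by rewrite !integral_shift_pow ?ltW//; field.
  by apply: eq_Rintegral => y _; rewrite /g; field.
(* With the slope under control, the value at [x] is the mean of [g] minus its linear part. *)
have m0 : u x * a = \int[mu]_(y in `[x, x + a]) (g y - v x * (y - x) ^+ 1).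
  transitivity (\int[mu]_(y in `[x, x + a]) (u x)).
    by rewrite integral_cst_segment// addrAC subrr add0r.
  by apply: eq_Rintegral => y _; rewrite /g; ring.
have hv : `|v x| * a ^+ 3 / 12 <= a / 2 * S.
  have a3 : 0 <= a ^+ 3 / 12 by rewrite divr_ge0// exprn_ge0// ltW.
  have a2 : 0 <= a / 2 by rewrite divr_ge0// ltW.
  rewrite -mulrA -[a ^+ 3 / 12]ger0_norm// -normrM mulrA m1.
  apply: (@le_trans _ _ (\int[mu]_(y in `[x, x + a]) (a / 2 * `|g y|))).
    apply: integral_abs_le => //.
    - apply: (@L1_ext _ _ _ (fun y => (y - x - a / 2) * g y)) => //; first by move=> y _; rewrite mulrC.
      apply: (@L1_bounded_mul _ _ _ _ _ (a / 2)) => //.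
        by apply: L1_measurable; apply: L1B => //; exact: (Ls 1%N).
      move=> y /=; rewrite in_itv/= ler_norml => /andP[xy ya].
      by apply/andP; split; lra.
    - by apply: L1Z => //; apply: L1_abs.
    - move=> y /=; rewrite in_itv/= normrM mulrC => /andP[xy ya].
      apply: ler_wpM2r => //; rewrite ler_norml.
      by apply/andP; split; lra.
  by rewrite RintegralZl//; [exact: ler_wpM2l|apply: L1_abs].
have hv2 : `|v x| <= 6 / a ^+ 2 * S.
  have := ler_wpM2l (_ : 0 <= 12 / a ^+ 3) hv.
  have -> : 12 / a ^+ 3 * (`|v x| * a ^+ 3 / 12) = `|v x|.
    by field; rewrite gt_eqF.
  have -> : 12 / a ^+ 3 * (a / 2 * S) = 6 / a ^+ 2 * S.
    by field; rewrite gt_eqF.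
  by apply; rewrite divr_ge0// exprn_ge0// ltW.
split => //.
have hu2 : `|u x| * a <= S + `|v x| * (a ^+ 2 / 2).
  rewrite -[a in leLHS](gtr0_norm a0) -normrM m0.
  rewrite RintegralB//; last by apply: L1Z.
  apply: (le_trans (ler_normB _ _)); apply: lerD.
    by apply: le_trans gS; apply: le_normr_Rintegral.
  rewrite RintegralZl; [|by []|exact: Ls]; rewrite (integral_shift_pow x 1 (ltW a0)) normrM ler_wpM2l//.
  by rewrite ger0_norm// divr_ge0// exprn_ge0// ltW.
have h3 : `|u x| * a <= 4 * S.
  apply: (le_trans hu2); apply: (@le_trans _ _ (S + (6 / a ^+ 2 * S) * (a ^+ 2 / 2))).
    by rewrite lerD2l ler_wpM2r// divr_ge0// exprn_ge0// ltW.
  by rewrite le_eqVlt; apply/orP; left; apply/eqP; field; rewrite gt_eqF.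
by rewrite mulrAC ler_pdivlMr.
Qed.

(** The constant depends on the window length [a] but not on the position [x]. This uniformity makes
    boundary terms far out on a half-line small, as they are bounded by the mass of a window moving
    to infinity. *)
Lemma trace_L2 a : 0 < a -> exists2 C, 0 <= C & forall x u v w,
  L2 `[x, x + a] u -> L2 `[x, x + a] w ->
  (forall y, x <= y <= x + a -> u y = u x + \int[mu]_(t in `[x, y]) v t) ->
  (forall y, x <= y <= x + a -> v y = v x + \int[mu]_(t in `[x, y]) w t) ->
  u x ^+ 2 + v x ^+ 2 <= C * (\int[mu]_(t in `[x, x + a]) u t ^+ 2 +
                             \int[mu]_(t in `[x, x + a]) w t ^+ 2).
Proof.
move=> a0; have a0' := ltW a0.
(* [K] collects the squares of the two constants of [trace_L1]. The factor [2 * a + 2 * a ^+ 5]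
   comes from [(U + a ^+ 2 * W) ^+ 2 <= 2 * U ^+ 2 + 2 * a ^+ 4 * W ^+ 2], followed by
   Cauchy-Schwarz on a window of length [a]. *)
pose K := (4 / a) ^+ 2 + (6 / a ^+ 2) ^+ 2.
pose C := K * (2 * a + 2 * a ^+ 5).
have K0 : 0 <= K by rewrite addr_ge0// sqr_ge0.
exists C; first by rewrite mulr_ge0// addr_ge0// mulr_ge0// exprn_ge0.
move=> x u v w hu hw uE vE.
have xa : x < x + a by rewrite ltrDl.
have fin := segment_finite x (x + a).
have Lu := L2_L1 (measurable_itv _) fin hu; have Lw := L2_L1 (measurable_itv _) fin hw.
have [] := trace_L1 a0 Lu Lw uE vE.
have := integral_abs_sqr xa hu; have := integral_abs_sqr xa hw.
rewrite [x + a - x]addrAC subrr add0r.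
have : 0 <= \int[mu]_(t in `[x, x + a]) `|u t| by apply: Rintegral_ge0.
have : 0 <= \int[mu]_(t in `[x, x + a]) `|w t| by apply: Rintegral_ge0.
have : 0 <= \int[mu]_(t in `[x, x + a]) u t ^+ 2 by apply: Rintegral_ge0 => t _; exact: sqr_ge0.
have : 0 <= \int[mu]_(t in `[x, x + a]) w t ^+ 2 by apply: Rintegral_ge0 => t _; exact: sqr_ge0.
move: (\int[mu]_(t in _) `|u t|) (\int[mu]_(t in _) `|w t|).
move: (\int[mu]_(t in _) u t ^+ 2) (\int[mu]_(t in _) w t ^+ 2) => U2 W2 U W.
move=> W20 U20 W0 U0 hW hU ux vx.
set S := U + a ^+ 2 * W in ux vx.
have S0 : 0 <= S by rewrite addr_ge0// mulr_ge0// exprn_ge0.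
have hS : S ^+ 2 <= (2 * a + 2 * a ^+ 5) * (U2 + W2).
  apply: (@le_trans _ _ (2 * (a * U2) + 2 * a ^+ 4 * (a * W2))).
    apply: (@le_trans _ _ (2 * U ^+ 2 + 2 * a ^+ 4 * W ^+ 2)); last first.
      by apply: lerD; apply: ler_wpM2l => //; rewrite mulr_ge0// exprn_ge0.
    rewrite -subr_ge0 (_ : _ - _ = (U - a ^+ 2 * W) ^+ 2) ?sqr_ge0//.
    by rewrite /S; ring.
  rewrite -subr_ge0 (_ : _ - _ = 2 * a * W2 + 2 * a ^+ 5 * U2).
    by rewrite addr_ge0// mulr_ge0// mulr_ge0// exprn_ge0.
  by ring.
rewrite -(real_normK (num_real (u x))) -(real_normK (num_real (v x))).
apply: (@le_trans _ _ (K * S ^+ 2)); last by rewrite /C -mulrA ler_wpM2l.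
rewrite /K mulrDl -!exprMn; apply: lerD.
  by rewrite lerXn2r// nnegrE mulr_ge0// divr_ge0.
by rewrite lerXn2r// nnegrE mulr_ge0// divr_ge0// exprn_ge0.
Qed.

End Trace.

(** * Absolutely continuous functions and integrals over half-lines *)

Section Primitives.
Variable R : realType.
Local Notation mu := (@lebesgue_measure R).
Implicit Types (x X : R) (f g u v : R -> R).

Lemma primitive_bounded X f g : L1 `[0, X] g ->
  (forall y, 0 <= y <= X -> f y = f 0 + \int[mu]_(t in `[0, y]) g t) ->
  forall y, 0 <= y <= X -> `|f y| <= `|f 0| + \int[mu]_(t in `[0, X]) `|g t|.
Proof.
move=> hg fE y yX; rewrite fE// (le_trans (ler_normD _ _))// lerD2l.
exact: primitive_le.
Qed.

Lemma primitive_fun_measurable X f g : L1 `[0, X] g ->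
  (forall y, 0 <= y <= X -> f y = f 0 + \int[mu]_(t in `[0, y]) g t) ->
  measurable_fun (`[0, X] : set (measurableTypeR R)) f.
Proof.
move=> hg fE.
have m : measurable_fun (`[0, X] : set (measurableTypeR R))
    (fun y => f 0 + \int[mu]_(t in `[0, y]) g t).
  by apply: measurable_funD; [exact: measurable_cst|exact: primitive_measurable].
apply: eq_measurable_fun m => y /set_mem /=; rewrite in_itv/= => yX.
by rewrite -fE.
Qed.

Lemma primitive_L2 X f g : L1 `[0, X] g ->
  (forall y, 0 <= y <= X -> f y = f 0 + \int[mu]_(t in `[0, y]) g t) ->
  L2 `[0, X] f.
Proof.
move=> hg fE.
apply: (@L2_finite_bounded _ _ _ _ (`|f 0| + \int[mu]_(t in `[0, X]) `|g t|)) => //.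
- exact: segment_finite.
- exact: primitive_fun_measurable fE.
- by move=> y /=; rewrite in_itv/=; exact: primitive_bounded.
Qed.

(** Integration by parts for absolutely continuous functions reduces to [integral_product_rule]
    after subtracting the initial values; no pointwise derivative is involved. *)
Lemma integration_by_parts_primitive X u v u' v' : 0 <= X ->
  L1 `[0, X] u' -> L1 `[0, X] v' ->
  (forall y, 0 <= y <= X -> u y = u 0 + \int[mu]_(t in `[0, y]) u' t) ->
  (forall y, 0 <= y <= X -> v y = v 0 + \int[mu]_(t in `[0, y]) v' t) ->
  L1 `[0, X] (fun x => u' x * v x) /\ L1 `[0, X] (fun x => u x * v' x) /\
  u X * v X - u 0 * v 0 = \int[mu]_(x in `[0, X]) (u' x * v x + u x * v' x).
Proof.
move=> X0 hu hv uE vE.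
have i1 (f f' g : R -> R) : L1 `[0, X] f' -> L1 `[0, X] g ->
    (forall y, 0 <= y <= X -> f y = f 0 + \int[mu]_(t in `[0, y]) f' t) ->
    L1 `[0, X] (fun x => f x * g x).
  move=> hf hg fE.
  apply: (@L1_bounded_mul _ _ _ _ _ (`|f 0| + \int[mu]_(t in `[0, X]) `|f' t|)) => //.
    exact: primitive_fun_measurable fE.
  by move=> y /=; rewrite in_itv/=; exact: primitive_bounded.
have Lvu : L1 `[0, X] (fun x => u' x * v x).
  by apply: (L1_ext _ _ (i1 _ _ _ hv hu vE)) => // x _; rewrite mulrC.
have Luv := i1 _ _ _ hu hv uE.
do 2 split => //.
have XX : 0 <= X <= X by rewrite X0 lexx.
have := integral_product_rule hu hv.
have -> : \int[mu]_(x in `[0, X]) (u' x * \int[mu]_(t in `[0, x]) v' t) =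
    \int[mu]_(x in `[0, X]) (u' x * v x) - v 0 * \int[mu]_(x in `[0, X]) u' x.
  rewrite -RintegralZl// -RintegralB//; last exact: L1Z.
  apply: eq_Rintegral => x /set_mem /=; rewrite in_itv/= => xX.
  by rewrite (vE x xX); ring.
have -> : \int[mu]_(x in `[0, X]) (v' x * \int[mu]_(t in `[0, x]) u' t) =
    \int[mu]_(x in `[0, X]) (u x * v' x) - u 0 * \int[mu]_(x in `[0, X]) v' x.
  rewrite -RintegralZl// -RintegralB//; last exact: L1Z.
  apply: eq_Rintegral => x /set_mem /=; rewrite in_itv/= => xX.
  by rewrite (uE x xX); ring.
rewrite RintegralD// (uE X XX) (vE X XX).
move: (\int[mu]_(x in _) u' x) (\int[mu]_(x in _) v' x) => U V h.
have -> : (u 0 + U) * (v 0 + V) - u 0 * v 0 = U * V + u 0 * V + v 0 * U by ring.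
by rewrite h; ring.
Qed.

End Primitives.

Section HalfLine.
Variable R : realType.
Local Notation mu := (@lebesgue_measure R).
Implicit Types (h : R -> R).

Lemma cvg_integral_halfline h : L1 `[0, +oo[ h ->
  (\int[mu]_(x in `[0, n%:R]) h x) @[n --> \oo] --> \int[mu]_(x in `[0, +oo[) h x.
Proof.
move=> hL; pose D : set (measurableTypeR R) := `[0, +oo[%classic.
have mD : measurable D by exact: measurable_itv.
have sub (n : nat) : `[0, n%:R] `<=` D.
  by move=> x; rewrite /D/= !in_itv/= => /andP[->].
have E (n : nat) : \int[mu]_(x in `[0, n%:R]) h x = \int[mu]_(x in D) (h \_ `[0, n%:R]) x.
  by rewrite -Rintegral_mkcondr; congr Rintegral; rewrite setIidr.
under eq_fun do rewrite E.
apply: fine_cvg; rewrite fineK; last exact: integrable_fin_num.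
have mh := L1_measurable hL.
have m1 n : measurable_fun D (fun x => ((h \_ `[0, n%:R]) x)%:E).
  apply/measurable_EFinP; apply: (measurable_restrict h _ mD).1 => //.
  by apply: (measurable_funS mD _ mh); exact: subIsetl.
have m2 : measurable_fun D (fun x => (h x)%:E) by apply/measurable_EFinP.
have c : {ae mu, forall x, D x -> ((h \_ `[0, n%:R]) x)%:E @[n --> \oo] --> (h x)%:E}.
  apply: aeW => x; rewrite /D/= in_itv/= andbT => x0.
  apply: cvg_near_cst; near=> n.
  rewrite patchE mem_set//= in_itv/= x0/=.
  by near: n; exact: nbhs_infty_ger.
have b : {ae mu, forall x n, D x -> (`|((h \_ `[0, n%:R]) x)%:E| <= (EFin \o (fun x => `|h x|)%R) x)%E}.
  apply: aeW => x n _; rewrite /= lee_fin patchE; case: ifP => // _.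
  by rewrite normr0.
by have [] := dominated_convergence mD m1 m2 c (L1_abs mD hL) b.
Unshelve. all: by end_near. Qed.

(** Monotone convergence along the cut-offs to [[0, n]] turns uniform bounds on segments into
    integrability on the half-line. *)
Lemma L1_halfline_bounded h (M : R) : measurable_fun (`[0, +oo[ : set (measurableTypeR R)) h ->
  (forall x, 0 <= x -> 0 <= h x) ->
  (forall X, L1 `[0, X] h) -> (forall n : nat, \int[mu]_(x in `[0, n%:R]) h x <= M) ->
  L1 `[0, +oo[ h.
Proof.
move=> mh h0 hL hM; apply/integrableP; split; first exact/measurable_EFinP.
apply: (@le_lt_trans _ _ M%:E); last exact: ltry.
pose D : set (measurableTypeR R) := `[0, +oo[%classic.
have mD : measurable D by exact: measurable_itv.
have sub (n : nat) : `[0, n%:R] `<=` D.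
  by move=> x; rewrite /D/= !in_itv/= => /andP[->].
pose hn n x := ((h \_ `[0, n%:R]) x)%:E.
have m1 n : measurable_fun D (hn n).
  apply/measurable_EFinP; apply: (measurable_restrict h _ mD).1 => //.
  by apply: (measurable_funS mD _ mh); exact: subIsetl.
have hn0 n x : D x -> (0 <= hn n x)%E.
  rewrite /hn lee_fin patchE /D/= in_itv/= andbT => x0; case: ifP => // _.
  exact: h0.
have nd x : D x -> nondecreasing_seq (hn ^~ x).
  rewrite /D/= in_itv/= andbT => x0 n m nm; rewrite /hn lee_fin !patchE.
  case: ifPn => [/set_mem/=|_].
    rewrite in_itv/= => /andP[_ xn]; rewrite mem_set//= in_itv/= x0/=.
    by rewrite (le_trans xn)// ler_nat.
  by case: ifP => // _; exact: h0.
have := cvg_monotone_convergence (mu := mu) mD m1 hn0 nd.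
have Eh : (\int[mu]_(x in D) limn (hn^~ x) = \int[mu]_(x in D) `|(EFin \o h) x|)%E.
  apply: eq_integral => x /set_mem; rewrite /D/= in_itv/= andbT => x0.
  rewrite ger0_norm ?h0//; apply: cvg_lim => //.
  apply: cvg_near_cst; near=> n.
  rewrite /hn patchE mem_set//= in_itv/= x0/=.
  by near: n; exact: nbhs_infty_ger.
move=> cv; apply: (@le_trans _ _ (limn (fun n => \int[mu]_(x in D) hn n x))%E).
  rewrite (cvg_lim _ cv)// le_eqVlt; apply/orP; left; apply/eqP; exact: esym Eh.
apply: lime_le; first exact: cvgP cv.
apply: nearW => n.
have -> : (\int[mu]_(x in D) hn n x = (\int[mu]_(x in `[0%R, n%:R]) h x)%:E)%E.
  rewrite /Rintegral fineK; last by apply: integrable_fin_num => //; exact: hL.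
  rewrite -[in RHS](setIidr (sub n)) integral_mkcondr.
  by apply: eq_integral => x _; rewrite /hn restrict_EFin.
by rewrite lee_fin.
Unshelve. all: by end_near. Qed.

End HalfLine.

(** * The differential equation on an edge *)

Section ComplexParts.
Variable R : realType.
Implicit Types (x y : R[i]).

Lemma ReD x y : Re (x + y) = Re x + Re y. Proof. by case: x; case: y. Qed.
Lemma ImD x y : Im (x + y) = Im x + Im y. Proof. by case: x; case: y. Qed.
Lemma ReN x : Re (- x) = - Re x. Proof. by case: x. Qed.
Lemma ImN x : Im (- x) = - Im x. Proof. by case: x. Qed.
Lemma ReB x y : Re (x - y) = Re x - Re y. Proof. by rewrite ReD ReN. Qed.
Lemma ImB x y : Im (x - y) = Im x - Im y. Proof. by rewrite ImD ImN. Qed.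
Lemma ReM x y : Re (x * y) = Re x * Re y - Im x * Im y.
Proof. by case: x; case: y. Qed.
Lemma ImM x y : Im (x * y) = Re x * Im y + Im x * Re y.
Proof. by case: x => a b; case: y => c d; rewrite /= addrC. Qed.

Lemma eq_ReIm x y : Re x = Re y -> Im x = Im y -> x = y.
Proof. by case: x; case: y => a b c d /= -> ->. Qed.

Lemma sqmod_ge0 x : 0 <= sqmod x.
Proof. by rewrite addr_ge0// sqr_ge0. Qed.

Lemma sqmod0 : sqmod (0 : R[i]) = 0.
Proof. by rewrite /sqmod /= expr0n addr0. Qed.

Lemma sqmod_eq0 x : (sqmod x == 0) = (x == 0).
Proof.
rewrite paddr_eq0 ?sqr_ge0// !sqrf_eq0; case: x => a b.
by rewrite eq_complex.
Qed.

Lemma sqmodM x y : sqmod (x * y) = sqmod x * sqmod y.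
Proof. by rewrite /sqmod ReM ImM; ring. Qed.

Lemma sqmodN x : sqmod (- x) = sqmod x.
Proof. by rewrite /sqmod ReN ImN !sqrrN. Qed.

Lemma sqmodD_le x y : sqmod (x + y) <= 2 * sqmod x + 2 * sqmod y.
Proof.
rewrite /sqmod ReD ImD -subr_ge0 (_ : _ - _ = (Re x - Re y) ^+ 2 + (Im x - Im y) ^+ 2).
  by rewrite addr_ge0// sqr_ge0.
by ring.
Qed.

(* The imaginary part of [x^* y]. *)
Definition wronskian x y := Re x * Im y - Im x * Re y.

(** Young's inequality: each of the two differences is [(2 * t)^-1] times a sum of two squares. The
    free weight [t] is tuned later so that one of the two terms can be absorbed. *)
Lemma wronskian_le x y (t : R) : 0 < t ->
  `|wronskian x y| <= t / 2 * sqmod x + (2 * t)^-1 * sqmod y.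
Proof.
move=> t0; have t2 : 0 < (2 * t)^-1 by rewrite invr_gt0 mulr_gt0.
rewrite ler_norml; apply/andP; split; rewrite -subr_ge0.
  rewrite (_ : _ - _ = (2 * t)^-1 * ((t * Re x + Im y) ^+ 2 + (t * Im x - Re y) ^+ 2)).
    by apply: mulr_ge0; [exact: ltW|rewrite addr_ge0// sqr_ge0].
  by rewrite /wronskian /sqmod; field; rewrite gt_eqF.
rewrite (_ : _ - _ = (2 * t)^-1 * ((t * Re x - Im y) ^+ 2 + (t * Im x + Re y) ^+ 2)).
  by apply: mulr_ge0; [exact: ltW|rewrite addr_ge0// sqr_ge0].
by rewrite /wronskian /sqmod; field; rewrite gt_eqF.
Qed.

End ComplexParts.

Section Edges.
Variable R : realType.
Local Notation mu := (@lebesgue_measure R).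
Implicit Types (l : \bar R) (X : R) (B : R -> R) (z : R[i]) (f u : R -> R[i]).

Lemma interval_of_fin X : interval_of X%:E = `[0, X]%classic.
Proof. by apply/seteqP; split => x /=; rewrite /interval_of/= in_itv/= lee_fin => /andP. Qed.

Lemma interval_of_pinfty : interval_of (+oo : \bar R) = `[0, +oo[%classic.
Proof.
apply/seteqP; split => x; rewrite /interval_of/= in_itv/= andbT leey; first by case.
by split.
Qed.

Lemma interval_of_ninfty : interval_of (-oo : \bar R) = set0.
Proof. by apply/seteqP; split => x //=; rewrite /interval_of/= => -[]. Qed.

Lemma measurable_interval l : measurable (interval_of l : set (measurableTypeR R)).
Proof.
case: l => [r| |]; last by rewrite interval_of_ninfty; exact: measurable0.
  by rewrite interval_of_fin; exact: measurable_itv.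
by rewrite interval_of_pinfty; exact: measurable_itv.
Qed.

Lemma sub_interval X l : (X%:E <= l)%E -> `[0, X] `<=` interval_of l.
Proof.
move=> Xl x /=; rewrite in_itv/= => /andP[x0 xX]; split => //.
by rewrite (le_trans _ Xl)// lee_fin.
Qed.

Lemma measurable_sqmod (D : set (measurableTypeR R)) f :
  measurable_fun D (fun x => Re (f x)) -> measurable_fun D (fun x => Im (f x)) ->
  measurable_fun D (fun x => sqmod (f x)).
Proof. by move=> h1 h2; apply: measurable_funD; exact: measurable_funX. Qed.

Lemma inL2P l f : inL2 l f <->
  L2 (interval_of l) (fun x => Re (f x)) /\ L2 (interval_of l) (fun x => Im (f x)).
Proof.
have mI := measurable_interval l.
split=> [[m1 m2 h]|[[m1 h1] [m2 h2]]].
  have ms := measurable_sqmod m1 m2.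
  have hs : L1 (interval_of l) (fun x => sqmod (f x)).
    apply/integrableP; split; first exact/measurable_EFinP.
    apply: le_lt_trans h; rewrite le_eqVlt; apply/orP; left; apply/eqP.
    by apply: eq_integral => x _ /=; rewrite ger0_norm// sqmod_ge0.
  split; split => //; apply: (L1_le mI _ _ hs).
  - exact: measurable_funX.
  - by move=> x _; rewrite ger0_norm ?sqr_ge0// lerDl sqr_ge0.
  - exact: measurable_funX.
  - by move=> x _; rewrite ger0_norm ?sqr_ge0// lerDr sqr_ge0.
split => //.
exact: (integrable_lty mI (L1D mI h1 h2)).
Qed.

Lemma inL2_sqmod l f : inL2 l f -> L1 (interval_of l) (fun x => sqmod (f x)).
Proof. by move=> /inL2P[[_ h1] [_ h2]]; apply: L1D => //; exact: measurable_interval. Qed.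

Lemma inL2_ext l f g : (forall x, interval_of l x -> f x = g x) -> inL2 l f -> inL2 l g.
Proof.
move=> fg /inL2P[h1 h2]; have mI := measurable_interval l.
by apply/inL2P; split; [apply: (L2_ext mI _ h1)|apply: (L2_ext mI _ h2)] => x /fg ->.
Qed.

Lemma inL2_restrict X l f : (X%:E <= l)%E -> inL2 l f -> inL2 X%:E f.
Proof.
move=> Xl /inL2P[h1 h2]; apply/inL2P; have := sub_interval Xl.
have mI := measurable_interval l; have mX := measurable_interval X%:E.
rewrite -interval_of_fin => s.
by split; [exact: (L2S mX mI s h1)|exact: (L2S mX mI s h2)].
Qed.

Lemma inL2_lin l f g (s : R[i]) : inL2 l f -> inL2 l g -> inL2 l (fun x => f x + s * g x).
Proof.
have mI := measurable_interval l.
move=> /inL2P[f1 f2] /inL2P[g1 g2]; apply/inL2P; split.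
  apply: (@L2_ext _ _ mI (fun x => Re (f x) + (Re s * Re (g x) - Im s * Im (g x)))).
    by move=> x _; rewrite ReD ReM.
  by apply: L2D => //; apply: L2B => //; exact: L2Z.
apply: (@L2_ext _ _ mI (fun x => Im (f x) + (Re s * Im (g x) + Im s * Re (g x)))).
  by move=> x _; rewrite ImD ImM.
by apply: L2D => //; apply: L2D => //; exact: L2Z.
Qed.

Lemma inL2_0 l : inL2 l (fun=> 0).
Proof.
have mI := measurable_interval l.
apply/inL2P; split; split => //; apply: (@L1_ext _ _ mI (fun=> 0)) => //=;
  by [move=> x _; rewrite expr0n|exact: integrable0].
Qed.

Definition potential l B := measurable_fun (interval_of l : set (measurableTypeR R)) B /\
  exists M, forall x, interval_of l x -> `|B x| <= M.

Lemma potential_restrict X l B : (X%:E <= l)%E -> potential l B -> potential X%:E B.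
Proof.
move=> Xl [mB [M BM]]; have s := sub_interval Xl; rewrite -interval_of_fin in s.
split; first exact: (measurable_funS (measurable_interval l) s mB).
by exists M => x /s; exact: BM.
Qed.

Lemma inL2_potential l B z f : potential l B -> inL2 l f ->
  inL2 l (fun x => ((B x)%:C - z) * f x).
Proof.
move=> [mB [M BM]] hf; have mI := measurable_interval l.
have hB : inL2 l (fun x => (B x)%:C * f x).
  move/inL2P: (hf) => [h1 h2]; apply/inL2P; split.
    apply: (@L2_ext _ _ mI (fun x => B x * Re (f x))); last exact: L2_bounded_mul mB BM h1.
    by move=> x _; rewrite ReM/= mul0r subr0.
  apply: (@L2_ext _ _ mI (fun x => B x * Im (f x))); last exact: L2_bounded_mul mB BM h2.
  by move=> x _; rewrite ImM/= mul0r addr0.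
by apply: inL2_ext (inL2_lin (- z) hB hf) => x _; rewrite mulrBl mulNr.
Qed.

(* [u] is an H^2 solution of [- u'' + (B - z) u = f] on the edge, [u1 = u']. *)
Definition edge_solution l B z f u u1 :=
  [/\ inL2 l u, inL2 l u1, primitive_of l u1 u &
      primitive_of l (fun x => ((B x)%:C - z) * u x - f x) u1].

Lemma rhs_inL2 l B z f u u1 : potential l B -> inL2 l f -> edge_solution l B z f u u1 ->
  inL2 l (fun x => ((B x)%:C - z) * u x - f x).
Proof.
move=> pB hf [hu _ _ _].
by apply: inL2_ext (inL2_lin (-1) (inL2_potential z pB hu) hf) => x _; rewrite mulN1r.
Qed.

Lemma primitive_of_Re l g f X : (X%:E <= l)%E -> primitive_of l g f ->
  forall y, 0 <= y <= X -> Re (f y) = Re (f 0) + \int[mu]_(t in `[0, y]) Re (g t).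
Proof.
move=> Xl h y /andP[y0 yX]; rewrite h ?ReD//; split => //.
by rewrite (le_trans _ Xl)// lee_fin.
Qed.

Lemma primitive_of_Im l g f X : (X%:E <= l)%E -> primitive_of l g f ->
  forall y, 0 <= y <= X -> Im (f y) = Im (f 0) + \int[mu]_(t in `[0, y]) Im (g t).
Proof.
move=> Xl h y /andP[y0 yX]; rewrite h ?ImD//; split => //.
by rewrite (le_trans _ Xl)// lee_fin.
Qed.

Lemma inL2_L1 X l f : (X%:E <= l)%E -> inL2 l f ->
  L1 `[0, X] (fun x => Re (f x)) /\ L1 `[0, X] (fun x => Im (f x)).
Proof.
move=> Xl /(inL2_restrict Xl)/inL2P; rewrite interval_of_fin => -[h1 h2].
by split; apply: L2_L1 => //; exact: segment_finite.
Qed.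

Lemma primitive_of_lin l g f g' f' (s : R[i]) : inL2 l g -> inL2 l g' ->
  primitive_of l g f -> primitive_of l g' f' ->
  primitive_of l (fun x => g x + s * g' x) (fun x => f x + s * f' x).
Proof.
move=> hg hg' h h' x Ix; rewrite (h x Ix) (h' x Ix).
have xl : (x%:E <= l)%E by case: Ix.
have [r1 i1] := inL2_L1 xl hg; have [r2 i2] := inL2_L1 xl hg'.
suff -> : cintegral `[0, x] (fun x => g x + s * g' x) =
    cintegral `[0, x] g + s * cintegral `[0, x] g' by ring.
apply: eq_ReIm.
  rewrite ReD ReM /cintegral /=.
  rewrite -!RintegralZl// -RintegralB//; [|by apply: L1Z|by apply: L1Z].
  rewrite -RintegralD//; last by apply: L1B => //; exact: L1Z.
  by apply: eq_Rintegral => t _; rewrite ReD ReM.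
rewrite ImD ImM /cintegral /=.
rewrite -!RintegralZl// -RintegralD//; [|by apply: L1Z|by apply: L1Z].
rewrite -RintegralD//; last by apply: L1D => //; exact: L1Z.
by apply: eq_Rintegral => t _; rewrite ImD ImM.
Qed.

Lemma primitive_of_ext l g g' f : (forall x, interval_of l x -> g x = g' x) ->
  primitive_of l g f -> primitive_of l g' f.
Proof.
move=> gg' h x [x0 xl]; rewrite h//; congr (_ + _).
by congr (_ +i* _); apply: eq_Rintegral => t /set_mem/(sub_interval xl)/gg' ->.
Qed.

Lemma edge_solution_lin l B z f u u1 g v v1 (s : R[i]) : potential l B ->
  inL2 l f -> inL2 l g ->
  edge_solution l B z f u u1 -> edge_solution l B z g v v1 ->
  edge_solution l B z (fun x => f x + s * g x) (fun x => u x + s * v x)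
    (fun x => u1 x + s * v1 x).
Proof.
move=> pB hf hg hu hv; have wu := rhs_inL2 pB hf hu; have wv := rhs_inL2 pB hg hv.
case: hu hv => [u0 u1' pu pu1] [v0 v1' pv pv1]; split.
- exact: inL2_lin.
- exact: inL2_lin.
- exact: primitive_of_lin.
- apply: primitive_of_ext (primitive_of_lin s wu wv pu1 pv1) => x _.
  by ring.
Qed.

Lemma edge_solution_restrict X l B z f u u1 : (X%:E <= l)%E ->
  edge_solution l B z f u u1 -> edge_solution X%:E B z f u u1.
Proof.
move=> Xl [h1 h2 h3 h4]; have s := sub_interval Xl; rewrite -interval_of_fin in s.
split; [exact: inL2_restrict h1|exact: inL2_restrict h2| |] => x /s; [exact: h3|exact: h4].
Qed.

End Edges.

Section EdgeEquation.
Variable R : realType.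
Local Notation mu := (@lebesgue_measure R).
Implicit Types (l : \bar R) (X : R) (B : R -> R) (z : R[i]) (f u : R -> R[i]).

Lemma L1_segment_patch (D : set (measurableTypeR R)) (g : R -> R) X : measurable D ->
  L2 D g -> L1 `[0, X] (g \_ D).
Proof.
move=> mD hg; pose E : set (measurableTypeR R) := `[0, X]%classic.
have mE : measurable E by exact: measurable_itv.
have mED : measurable (E `&` D) by exact: measurableI.
have h : L1 (E `&` D) g.
  apply: L2_L1 => //; last exact: L2S hg.
  apply: le_lt_trans (segment_finite 0 X).
  by apply: le_measure => //; rewrite ?inE.
have := (integrable_restrict mu mD mE (EFin \o g)).1 h.
by apply: eq_integrable => // x _; rewrite restrict_EFin.
Qed.

(** The complex second order equation becomes a real system of size 4: the first boolean separates
    [u] from [u'], the second the real from the imaginary part. [B] and [f] are extended by 0, as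
    the system needs coefficients on the whole line. On a half-line this gives local square
    integrability only. *)
Lemma edge_ivp l B z f (a0 a1 : R[i]) : potential l B -> inL2 l f ->
  exists u u1, [/\ u 0 = a0, u1 0 = a1 &
    forall X, (X%:E <= l)%E -> edge_solution X%:E B z f u u1].
Proof.
move=> [mB [M BM]] /inL2P[f1 f2].
have mI := measurable_interval l.
pose I : set (measurableTypeR R) := interval_of l.
pose b := B \_ I.
pose A (j k : bool * bool) (t : R) : R :=
  match j, k with
  | (false, c), (true, c') => (c == c')%:R
  | (true, false), (false, false) => b t - Re z
  | (true, false), (false, true) => Im z
  | (true, true), (false, false) => - Im z
  | (true, true), (false, true) => b t - Re z
  | _, _ => 0
  end.
pose F (j : bool * bool) : R -> R :=
  match j with
  | (true, false) => fun t => - ((fun x => Re (f x)) \_ I) t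
  | (true, true) => fun t => - ((fun x => Im (f x)) \_ I) t
  | _ => fun=> 0
  end.
pose a (j : bool * bool) : R :=
  match j with (false, false) => Re a0 | (false, true) => Im a0
             | (true, false) => Re a1 | (true, true) => Im a1 end.
have mb : measurable_fun setT b.
  by apply: (measurable_restrict B mI _).1 => //; rewrite setTI.
have bM x : `|b x| <= `|M|.
  rewrite /b patchE; case: ifPn => [/set_mem Ix|_]; last by rewrite normr0.
  by rewrite (le_trans (BM x Ix))// ler_norm.
have mA j k : measurable_fun setT (A j k).
  by move: j k => [[] []] [[] []]; rewrite /A; try exact: measurable_cst;
    apply: measurable_funB => //; exact: measurable_cst.
pose K := `|M| + `|Re z| + `|Im z| + 1.
have AK j k x : `|A j k x| <= K.
  have h0 : 0 <= K by rewrite !addr_ge0.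
  have h1 : (1 : R) <= K by rewrite lerDr !addr_ge0.
  have h2 : `|Im z| <= K by rewrite /K; have := normr_ge0 M; have := normr_ge0 (Re z); lra.
  have h3 : `|b x - Re z| <= K.
    rewrite (le_trans (ler_normB _ _))//; have := bM x; have := normr_ge0 (Im z).
    by rewrite /K; lra.
  by move: j k => [[] []] [[] []]; rewrite /A /= ?normr0 ?normr1 ?normrN.
have LF j X : L1 `[0, X] (F j).
  have L0 : L1 `[0, X] (fun=> (0 : R)) by apply: L1_cst => //; exact: segment_finite.
  by move: j => [[] []] //; apply: L1N => //; exact: L1_segment_patch.
have [Y [LY YE]] := linear_system_solution a mA AK LF.
pose u x := Y (false, false) x +i* Y (false, true) x.
pose u1 x := Y (true, false) x +i* Y (true, true) x.
have sum4 (g : bool * bool -> R) :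
    \sum_k g k = g (true, true) + g (true, false) + (g (false, true) + g (false, false)).
  rewrite (eq_bigr (fun p => g (p.1, p.2))); last by case.
  by rewrite -(pair_bigA _ (fun i j => g (i, j))) /= !big_bool.
have Y0 j : Y j 0 = a j by rewrite YE// set_itv1 Rintegral_set1 addr0.
exists u, u1; split; first by apply: eq_ReIm; rewrite /= Y0.
  by apply: eq_ReIm; rewrite /= Y0.
move=> X Xl.
have Y2 j : L2 `[0, X] (Y j).
  apply: (@primitive_L2 _ _ _ (fun t => \sum_k A j k t * Y k t + F j t)).
    apply: L1D => //; apply: L1_sum => // k; apply: (@L1_bounded_mul _ _ _ _ _ K) => //.
    by apply: measurable_funTS; apply: mA.
  by move=> y /andP[y0 yX]; rewrite Y0 YE.
split.
- apply/inL2P; rewrite interval_of_fin.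
  by split; [exact: (Y2 (false, false))|exact: (Y2 (false, true))].
- apply/inL2P; rewrite interval_of_fin.
  by split; [exact: (Y2 (true, false))|exact: (Y2 (true, true))].
- move=> x; rewrite interval_of_fin/= in_itv/= => /andP[x0 xX].
  apply: eq_ReIm; rewrite /= Y0 YE//; congr (_ + _); apply: eq_Rintegral => t _;
    by rewrite sum4 /=; ring.
- move=> x; rewrite interval_of_fin/= in_itv/= => /andP[x0 xX].
  have It t : t \in `[0, x]%classic -> t \in I.
    move=> /set_mem/=; rewrite in_itv/= => /andP[t0 tx]; apply/mem_set; split => //.
    by rewrite (le_trans _ Xl)// lee_fin (le_trans tx).
  apply: eq_ReIm; rewrite /= Y0 YE//; congr (_ + _); apply: eq_Rintegral => t /It tI.
    by rewrite sum4 /= /b !patchE tI ReB ReM ReB ImB /=; ring.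
  by rewrite sum4 /= /b !patchE tI ImB ImM ReB ImB /=; ring.
Qed.

Lemma rhs_sqmod_le (b M : R) (z w g : R[i]) : `|b| <= M ->
  sqmod ((b%:C - z) * w - g) <= (4 * M ^+ 2 + 4 * sqmod z) * sqmod w + 2 * sqmod g.
Proof.
move=> bM; apply: (le_trans (sqmodD_le _ _)); rewrite sqmodN lerD2r sqmodM mulrA.
apply: ler_wpM2r; first exact: sqmod_ge0.
have : sqmod (b%:C - z) <= 2 * M ^+ 2 + 2 * sqmod z.
  apply: (le_trans (sqmodD_le _ _)); rewrite sqmodN lerD2r ler_pM2l//.
  rewrite /sqmod/= expr0n addr0 -(real_normK (num_real b)).
  by rewrite lerXn2r// nnegrE (le_trans _ bM).
by lra.
Qed.

(** The second derivative in [trace_L2] is replaced by its value from the equation. The constant is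
    chosen before the edge, the potential, the solution and the point; only the bound [M] of the
    potential enters. *)
Lemma edge_trace (a M : R) z : 0 < a -> exists2 C, 0 <= C & forall l B f u u1 x,
  0 <= x -> ((x + a)%:E <= l)%E -> potential l B ->
  (forall y, interval_of l y -> `|B y| <= M) -> inL2 l f ->
  edge_solution l B z f u u1 ->
  sqmod (u x) + sqmod (u1 x) <=
    C * (\int[mu]_(t in `[x, x + a]) sqmod (u t) + \int[mu]_(t in `[x, x + a]) sqmod (f t)).
Proof.
move=> a0; have [C C0 hC] := trace_L2 a0.
pose K := 4 * M ^+ 2 + 4 * sqmod z.
have K0 : 0 <= K by rewrite addr_ge0// mulr_ge0// ?sqr_ge0// sqmod_ge0.
(* [w] costs [K] times [u] plus twice [f], and [K + 3] dominates both resulting coefficients [1 + K]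
   and 2. *)
exists (C * (K + 3)); first by rewrite mulr_ge0// addr_ge0.
move=> l B f u u1 x x0 xl pB BM hf sol.
set w := fun x => ((B x)%:C - z) * u x - f x.
have hw : inL2 l w := rhs_inL2 pB hf sol.
have [hu hu1 pu pu1] := sol.
have mI := measurable_interval l.
pose D : set (measurableTypeR R) := `[x, x + a]%classic.
have mD : measurable D by exact: measurable_itv.
have DI : D `<=` interval_of l.
  move=> t tD; apply: (sub_interval xl); move: tD.
  by rewrite /D/= !in_itv/= => /andP[xt ->]; rewrite (le_trans x0 xt).
have res (g : R -> R[i]) : inL2 l g ->
   [/\ L2 D (fun t => Re (g t)), L2 D (fun t => Im (g t)) & L1 D (fun t => sqmod (g t))].
  move=> hg; have /inL2P[h1 h2] := hg; split; [exact: (L2S mD mI DI h1)|exact: (L2S mD mI DI h2)|].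
  exact: (L1S mD mI DI (inL2_sqmod hg)).
have [ru iu su] := res _ hu; have [rw iw sw] := res _ hw; have [_ _ sf] := res _ hf.
have [ru1 iu1] := inL2_L1 xl hu1.
have [rw1 iw1] := inL2_L1 xl hw.
have := hC x _ _ _ ru rw (primitive_shift x0 ru1 (primitive_of_Re xl pu))
   (primitive_shift x0 rw1 (primitive_of_Re xl pu1)).
have := hC x _ _ _ iu iw (primitive_shift x0 iu1 (primitive_of_Im xl pu))
   (primitive_shift x0 iw1 (primitive_of_Im xl pu1)).
have E (g : R -> R[i]) : inL2 l g -> \int[mu]_(t in D) sqmod (g t) =
    \int[mu]_(t in D) Re (g t) ^+ 2 + \int[mu]_(t in D) Im (g t) ^+ 2.
  by move=> /res[[_ h1] [_ h2] _]; rewrite -RintegralD.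
have hw2 : \int[mu]_(t in D) sqmod (w t) <=
    K * \int[mu]_(t in D) sqmod (u t) + 2 * \int[mu]_(t in D) sqmod (f t).
  rewrite -!RintegralZl// -RintegralD//; [|exact: L1Z|exact: L1Z].
  apply: le_Rintegral => //; first by apply: L1D => //; exact: L1Z.
  by move=> t /DI/BM bM; exact: rhs_sqmod_le.
move=> h1 h2.
apply: (@le_trans _ _ (C * (\int[mu]_(t in D) sqmod (u t) + \int[mu]_(t in D) sqmod (w t)))).
  rewrite (E _ hu) (E _ hw); move: h1 h2; rewrite -/D /sqmod.
  move: (\int[mu]_(t in D) Re (u t) ^+ 2) (\int[mu]_(t in D) Im (u t) ^+ 2).
  move: (\int[mu]_(t in D) Re (w t) ^+ 2) (\int[mu]_(t in D) Im (w t) ^+ 2).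
  by move=> a1 a2 a3 a4 h1 h2; lra.
rewrite -mulrA; apply: ler_wpM2l => //.
have U0 : 0 <= \int[mu]_(t in D) sqmod (u t) by apply: Rintegral_ge0 => t _; exact: sqmod_ge0.
have F0 : 0 <= \int[mu]_(t in D) sqmod (f t) by apply: Rintegral_ge0 => t _; exact: sqmod_ge0.
have := mulr_ge0 K0 F0.
move: hw2 U0 F0; move: (\int[mu]_(t in _) sqmod (w t)) (\int[mu]_(t in _) sqmod (u t)) (\int[mu]_(t in _) sqmod (f t)).
by clearbody K; move=> W U G b1 b2 b3 b4; lra.
Qed.

Lemma wronskian_L1 l f g : inL2 l f -> inL2 l g ->
  L1 (interval_of l) (fun x => wronskian (f x) (g x)).
Proof.
move=> /inL2P[f1 f2] /inL2P[g1 g2]; have mI := measurable_interval l.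
by apply: L1B => //; exact: L2_mul.
Qed.

(** As [B] is real, it drops out of the imaginary part of the product of the conjugate of [u] with
    its second derivative, and only [Im z] survives. The products [Im u1 * Re u] and [Re u1 * Im u]
    are integrated by parts separately; their terms without second derivative cancel. *)
Lemma green_segment X l B z f u u1 : 0 <= X -> (X%:E <= l)%E -> potential l B ->
  inL2 l f -> edge_solution l B z f u u1 ->
  Im z * \int[mu]_(x in `[0, X]) sqmod (u x) =
  wronskian (u 0) (u1 0) - wronskian (u X) (u1 X)
  - \int[mu]_(x in `[0, X]) wronskian (u x) (f x).
Proof.
move=> X0 Xl pB hf sol.
set w := fun x => ((B x)%:C - z) * u x - f x.
have hw : inL2 l w := rhs_inL2 pB hf sol.
have [hu hu1 pu pu1] := sol.
have [ru1 iu1] := inL2_L1 Xl hu1.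
have [rw iw] := inL2_L1 Xl hw.
have [h1 [h2 E1]] := integration_by_parts_primitive X0 iw ru1
  (primitive_of_Im Xl pu1) (primitive_of_Re Xl pu).
have [h3 [h4 E2]] := integration_by_parts_primitive X0 rw iu1
  (primitive_of_Re Xl pu1) (primitive_of_Im Xl pu).
have LX (g : R -> R[i]) : inL2 l g -> inL2 X%:E g by exact: inL2_restrict.
have Ls : L1 `[0, X] (fun x => sqmod (u x)).
  by rewrite -interval_of_fin; apply: inL2_sqmod; exact: LX.
have Lw : L1 `[0, X] (fun x => wronskian (u x) (f x)).
  by rewrite -interval_of_fin; apply: wronskian_L1; exact: LX.
have : \int[mu]_(x in `[0, X]) (- (Im z * sqmod (u x) + wronskian (u x) (f x))) =
  (Im (u1 X) * Re (u X) - Im (u1 0) * Re (u 0)) - (Re (u1 X) * Im (u X) - Re (u1 0) * Im (u 0)).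
  rewrite E1 E2 -RintegralB//; [|by apply: L1D|by apply: L1D].
  apply: eq_Rintegral => t _.
  rewrite ImB ImM ReB ImB ReB ReM ReB ImB/= /sqmod /wronskian.
  by ring.
under eq_Rintegral do rewrite -mulN1r.
rewrite RintegralZl//; last by apply: L1D => //; apply: L1Z.
rewrite RintegralD//; last by apply: L1Z.
rewrite RintegralZl//.
move: (\int[mu]_(x in `[0, X]) sqmod (u x)) (\int[mu]_(x in `[0, X]) wronskian (u x) (f x)) => S T.
by rewrite /wronskian => h; lra.
Qed.

End EdgeEquation.

(** * Dependence of a solution on its initial data and source *)

Section Stability.
Variable R : realType.
Local Notation mu := (@lebesgue_measure R).
Implicit Types (l : \bar R) (X : R) (B : R -> R) (z : R[i]) (f u : R -> R[i]).

(** Equivalent to the modulus, and made of real absolute values: it is subadditive and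
    submultiplicative and fits integrals taken on real and imaginary parts, so Gronwall's inequality
    applies without square roots. *)
Definition norm1 (w : R[i]) : R := `|Re w| + `|Im w|.

Lemma norm1_ge0 w : 0 <= norm1 w. Proof. by rewrite addr_ge0. Qed.

Lemma norm1_0 : norm1 0 = 0. Proof. by rewrite /norm1 /= normr0 addr0. Qed.

Lemma norm1_eq0 w : norm1 w = 0 -> w = 0.
Proof.
move=> /eqP; rewrite paddr_eq0// !normr_eq0 => /andP[/eqP r /eqP i].
exact: eq_ReIm.
Qed.

Lemma norm1D (v w : R[i]) : norm1 (v + w) <= norm1 v + norm1 w.
Proof. by rewrite /norm1 ReD ImD addrACA lerD// ler_normD. Qed.

Lemma norm1N (w : R[i]) : norm1 (- w) = norm1 w.
Proof. by rewrite /norm1 ReN ImN !normrN. Qed.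

Lemma norm1M (v w : R[i]) : norm1 (v * w) <= norm1 v * norm1 w.
Proof.
rewrite /norm1 ReM ImM.
have h1 := ler_normB (Re v * Re w) (Im v * Im w).
have h2 := ler_normD (Re v * Im w) (Im v * Re w).
by apply: (le_trans (lerD h1 h2)); rewrite !normrM le_eqVlt; apply/orP; left; apply/eqP; ring.
Qed.

Lemma norm1_sum (J : Type) (s : seq J) (F : J -> R[i]) :
  norm1 (\sum_(j <- s) F j) <= \sum_(j <- s) norm1 (F j).
Proof.
elim: s => [|j s IH]; first by rewrite !big_nil norm1_0.
by rewrite !big_cons (le_trans (norm1D _ _))// lerD2l.
Qed.

Lemma sqmod_norm1 w : sqmod w <= norm1 w ^+ 2.
Proof.
rewrite /sqmod /norm1 -(real_normK (num_real (Re w))) -(real_normK (num_real (Im w))).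
have := normr_ge0 (Re w); have := normr_ge0 (Im w).
by move: `|Re w| `|Im w| => a b a0 b0; have := mulr_ge0 a0 b0; nra.
Qed.

Lemma norm1_sqmod w : norm1 w ^+ 2 <= 2 * sqmod w.
Proof.
rewrite /sqmod /norm1 -(real_normK (num_real (Re w))) -(real_normK (num_real (Im w))).
move: `|Re w| `|Im w| => a b.
by have := sqr_ge0 (a - b); nra.
Qed.

Lemma norm1_L1 X f : inL2 X%:E f -> L1 `[0, X] (fun x => norm1 (f x)).
Proof. by move=> hf; have [h1 h2] := inL2_L1 (lexx _) hf; apply: L1D => //; exact: L1_abs. Qed.

(** Gronwall's inequality for [norm1 u + norm1 u1]. The source enters through its L^1 norm, the
    quantity in which the rescaled source on the inner graph is small. *)
Lemma edge_stability X (M : R) z : exists2 C, 0 <= C & forall B f u u1,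
  potential X%:E B -> (forall x, 0 <= x <= X -> `|B x| <= M) -> inL2 X%:E f ->
  edge_solution X%:E B z f u u1 ->
  forall x, 0 <= x <= X -> norm1 (u x) + norm1 (u1 x) <=
    C * (norm1 (u 0) + norm1 (u1 0) + \int[mu]_(t in `[0, X]) norm1 (f t)).
Proof.
(* The 1 accounts for [u' = u1], the rest for the coefficient [B - z] in the equation for [u1]. *)
pose k := 1 + `|M| + norm1 z.
have k0 : 0 < k by rewrite !ltr_wpDr// norm1_ge0.
exists (2 * expR (2 * k * X)); first by rewrite mulr_ge0// expR_ge0.
move=> B f u u1 pB BM hf sol x xX.
have /andP[x0 x1] := xX; have X0 := le_trans x0 x1.
set w := fun x => ((B x)%:C - z) * u x - f x.
have hw : inL2 X%:E w := rhs_inL2 pB hf sol.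
have [hu hu1 pu pu1] := sol.
have nu := norm1_L1 hu; have nu1 := norm1_L1 hu1; have nf := norm1_L1 hf; have nw := norm1_L1 hw.
pose If := \int[mu]_(t in `[0, X]) norm1 (f t).
have If0 : 0 <= If by apply: Rintegral_ge0 => t _; exact: norm1_ge0.
pose c := norm1 (u 0) + norm1 (u1 0) + If.
have c0 : 0 <= c by rewrite !addr_ge0 ?norm1_ge0.
pose h t := norm1 (u t) + norm1 (u1 t).
have Lh : L1 `[0, X] h by apply: L1D.
have prim (g v : R -> R[i]) y : inL2 X%:E g -> primitive_of X%:E g v -> 0 <= y <= X ->
    norm1 (v y) <= norm1 (v 0) + \int[mu]_(t in `[0, y]) norm1 (g t).
  move=> hg pv yX; have /andP[y0 y1] := yX.
  have yl : (y%:E <= X%:E)%E by rewrite lee_fin.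
  have [rg ig] := inL2_L1 yl hg.
  rewrite /norm1 (primitive_of_Re (lexx _) pv yX) (primitive_of_Im (lexx _) pv yX).
  rewrite RintegralD//; [|exact: L1_abs rg|exact: L1_abs ig].
  rewrite addrACA; apply: lerD; apply: (le_trans (ler_normD _ _)); rewrite lerD2l;
    exact: le_normr_Rintegral.
apply: (@le_trans _ _ (2 * c * expR (2 * k * x))); last first.
  rewrite -/If -/c mulrAC; apply: ler_wpM2r => //; apply: ler_wpM2l => //.
  by rewrite ler_expR ler_pM2l// mulr_gt0.
apply: (gronwall k0 c0 Lh) => // [y _|y yX]; first by rewrite addr_ge0 ?norm1_ge0.
have /andP[y0 y1] := yX.
have Ly g : L1 `[0, X] g -> L1 `[0, y] g by apply: L1_segmentS.
have := lerD (prim _ _ _ hu1 pu yX) (prim _ _ _ hw pu1 yX).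
move=> /le_trans; apply; rewrite addrACA /c -[leRHS]addrA lerD2l.
apply: (@le_trans _ _ (\int[mu]_(t in `[0, y]) norm1 (f t) + k * \int[mu]_(t in `[0, y]) h t)); last first.
  rewrite lerD2r; apply: Rintegral_subset => //; first exact: subset_segment.
  by move=> t _; exact: norm1_ge0.
rewrite -RintegralZl//; last exact: Ly.
rewrite -!RintegralD//; [|exact: Ly|by apply: L1Z => //; exact: Ly|exact: Ly|exact: Ly].
apply: le_Rintegral => //.
- by apply: L1D => //; exact: Ly.
- by apply: L1D => //; [exact: Ly|apply: L1Z => //; exact: Ly].
move=> t /=; rewrite in_itv/= => /andP[t0 ty].
have bM : `|B t| <= `|M| by rewrite (le_trans (BM t _)) ?ler_norm// t0 (le_trans ty).
have wt : norm1 (w t) <= (`|M| + norm1 z) * norm1 (u t) + norm1 (f t).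
  rewrite /w (le_trans (norm1D _ _))// norm1N lerD2r (le_trans (norm1M _ _))//.
  apply: ler_wpM2r; first exact: norm1_ge0.
  by rewrite (le_trans (norm1D _ _))// norm1N lerD2r /norm1/= normr0 addr0.
have a1 := norm1_ge0 (u t); have a2 := norm1_ge0 (u1 t).
have a3 : 0 <= (`|M| + norm1 z) * norm1 (u1 t) by rewrite mulr_ge0 ?addr_ge0 ?norm1_ge0.
rewrite /h /k; move: wt a3; set m := `|M| + norm1 z.
have -> : 1 + `|M| + norm1 z = 1 + m by rewrite /m -addrA.
move: a1 a2; move: (norm1 (w t)) (norm1 (f t)) (norm1 (u t)) (norm1 (u1 t)) => a b d e.
by clearbody m; move=> d0 e0 h1 h2; lra.
Qed.

End Stability.

(** * Square integrable solutions on half-lines *)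

Section HalfLineSolutions.
Variable R : realType.
Local Notation mu := (@lebesgue_measure R).
Implicit Types (X : R) (B : R -> R) (z : R[i]) (f u : R -> R[i]).

Lemma measurable_halfline (g : R -> R) :
  (forall X, measurable_fun (`[0, X] : set (measurableTypeR R)) g) ->
  measurable_fun (`[0, +oo[ : set (measurableTypeR R)) g.
Proof.
move=> mg; pose D : set (measurableTypeR R) := `[0, +oo[%classic.
have mD : measurable D by exact: measurable_itv.
apply: (@measurable_fun_cvg _ _ _ _ (fun n => g \_ `[0, n%:R])).
  move=> n; apply: (measurable_restrict g _ mD).1 => //.
  have mE : measurable (`[0, n%:R]%classic : set (measurableTypeR R)) by exact: measurable_itv.
  by apply: (measurable_funS mE _ (mg n%:R)); exact: subIsetr.
move=> x; rewrite /D/= in_itv/= andbT => x0.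
apply: cvg_near_cst; near=> n.
rewrite patchE mem_set//= in_itv/= x0/=.
by near: n; exact: nbhs_infty_ger.
Unshelve. all: by end_near. Qed.

Lemma L2_halfline (g : R -> R) (M : R) : (forall X, L2 `[0, X] g) ->
  (forall n : nat, \int[mu]_(x in `[0, n%:R]) g x ^+ 2 <= M) -> L2 `[0, +oo[ g.
Proof.
move=> hg gM; have mg : measurable_fun (`[0, +oo[ : set (measurableTypeR R)) g.
  by apply: measurable_halfline => X; case: (hg X).
split => //; apply: (@L1_halfline_bounded _ _ M) => //.
- exact: measurable_funX.
- by move=> x _; exact: sqr_ge0.
- by move=> X; case: (hg X).
Qed.

(** The bound on segments makes [u] square integrable, hence also its second derivative by the
    equation. For [u1] one integrates [u1 ^+ 2] by parts; the boundary terms stay bounded since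
    [edge_trace] is uniform in the position. *)
Lemma edge_solution_halfline B z f u u1 (M : R) : potential +oo%E B -> inL2 +oo%E f ->
  (forall X, edge_solution X%:E B z f u u1) ->
  (forall n : nat, \int[mu]_(x in `[0, n%:R]) sqmod (u x) <= M) ->
  edge_solution +oo%E B z f u u1.
Proof.
move=> pB hf sol uM; have [_ [BM hBM]] := pB.
have pBX X : potential X%:E B by apply: potential_restrict pB; exact: leey.
have hfX X : inL2 X%:E f by apply: inL2_restrict hf; exact: leey.
have Lloc g X : inL2 X%:E g -> L2 `[0, X] (fun x => Re (g x)) /\ L2 `[0, X] (fun x => Im (g x)).
  by move=> /inL2P; rewrite interval_of_fin.
have hu : inL2 +oo%E u.
  apply/inL2P; rewrite interval_of_pinfty; split; apply: (@L2_halfline _ M).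
  - by move=> X; have [h _ _ _] := sol X; have [] := Lloc _ _ h.
  - move=> n; apply: le_trans (uM n); have [h _ _ _] := sol n%:R.
    have [[_ h1] _] := Lloc _ _ h; have := inL2_sqmod h; rewrite interval_of_fin => h3.
    by apply: le_Rintegral => // x _; rewrite lerDl sqr_ge0.
  - by move=> X; have [h _ _ _] := sol X; have [] := Lloc _ _ h.
  - move=> n; apply: le_trans (uM n); have [h _ _ _] := sol n%:R.
    have [_ [_ h1]] := Lloc _ _ h; have := inL2_sqmod h; rewrite interval_of_fin => h3.
    by apply: le_Rintegral => // x _; rewrite lerDr sqr_ge0.
set w := fun x => ((B x)%:C - z) * u x - f x.
have hw : inL2 +oo%E w.
  by apply: inL2_ext (inL2_lin (-1) (inL2_potential z pB hu) hf) => x _; rewrite mulN1r.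
pose D : set (measurableTypeR R) := `[0, +oo[%classic.
have mD : measurable D by exact: measurable_itv.
have LD g : inL2 +oo%E g -> [/\ L2 D (fun x => Re (g x)), L2 D (fun x => Im (g x)) &
    L1 D (fun x => sqmod (g x))].
  move=> hg; have := inL2_sqmod hg; move/inL2P: hg; rewrite interval_of_pinfty.
  by case.
have [ur ui us] := LD _ hu; have [wr wi ws] := LD _ hw; have [_ _ fs] := LD _ hf.
have [C C0 trace] := @edge_trace R 1 BM z ltr01.
pose K := C * (\int[mu]_(x in D) sqmod (u x) + \int[mu]_(x in D) sqmod (f x)).
have uK x : 0 <= x -> sqmod (u x) + sqmod (u1 x) <= K.
  move=> x0.
  have bX y : interval_of (x + 1)%:E y -> `|B y| <= BM.
    by move=> [y0 _]; apply: hBM; split; rewrite ?leey.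
  have := trace _ B f u u1 x x0 (lexx _) (pBX _) bX (hfX _) (sol _).
  move=> /le_trans; apply; apply: ler_wpM2l => //.
  have sD : `[x, x + 1] `<=` D.
    by move=> y; rewrite /D/= !in_itv/= => /andP[xy _]; rewrite (le_trans x0 xy).
  by apply: lerD; apply: Rintegral_subset => // y _; exact: sqmod_ge0.
(* Applied to the real and to the imaginary part: the integral of [g1 ^+ 2] over [[0, n]] is
   [g * g1] at the ends minus the integral of [g * g2], and each piece is bounded independently of
   [n]. *)
have part (g g1 g2 : R -> R) : L2 D g -> L2 D g2 -> (forall X, L2 `[0, X] g1) ->
    (forall X y, 0 <= y <= X -> g y = g 0 + \int[mu]_(t in `[0, y]) g1 t) ->
    (forall X y, 0 <= y <= X -> g1 y = g1 0 + \int[mu]_(t in `[0, y]) g2 t) ->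
    (forall x, 0 <= x -> g x ^+ 2 + g1 x ^+ 2 <= K) -> L2 D g1.
  move=> hg hg2 hg1 gE g1E gK.
  apply: (@L2_halfline _ (2 * K + (\int[mu]_(x in D) g x ^+ 2 + \int[mu]_(x in D) g2 x ^+ 2))) => //.
  move=> n; have n0 : (0 : R) <= n%:R by [].
  have sD : `[0, n%:R] `<=` D by move=> y; rewrite /D/= !in_itv/= => /andP[->].
  have L2n : L2 `[0, n%:R] g2 by apply: L2S hg2.
  have Lg2 : L1 `[0, n%:R] g2 by apply: L2_L1 => //; exact: segment_finite.
  have Lg1 : L1 `[0, n%:R] g1 by apply: L2_L1 => //; exact: segment_finite.
  have [i1 [i2 E]] := integration_by_parts_primitive n0 Lg1 Lg2 (gE n%:R) (g1E n%:R).
  have Lgn : L2 `[0, n%:R] g by apply: L2S hg.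
  have bnd x : 0 <= x -> `|g x * g1 x| <= K.
    by move=> x0; apply: le_trans (gK x x0); exact: sqr_le_mul.
  have -> : \int[mu]_(x in `[0, n%:R]) g1 x ^+ 2 =
      g n%:R * g1 n%:R - g 0 * g1 0 - \int[mu]_(x in `[0, n%:R]) (g x * g2 x).
    rewrite E RintegralD// addrK; apply: eq_Rintegral => x _; exact: expr2.
  apply: lerD.
    apply: (le_trans (ler_norm _)); apply: (le_trans (ler_normB _ _)).
    by have := bnd n%:R n0; have := bnd 0 (lexx 0); lra.
  apply: (le_trans (ler_norm _)); rewrite normrN.
  apply: (@le_trans _ _ (\int[mu]_(x in `[0, n%:R]) (g x ^+ 2 + g2 x ^+ 2))).
    apply: integral_abs_le => //; first by apply: L1D => //; [exact: Lgn.2|exact: L2n.2].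
    by move=> x _; exact: sqr_le_mul.
  rewrite RintegralD//; [|exact: Lgn.2|exact: L2n.2].
  apply: lerD; apply: Rintegral_subset => //; by [move=> x _; exact: sqr_ge0|exact: hg.2|exact: hg2.2].
have hu1 : inL2 +oo%E u1.
  apply/inL2P; rewrite interval_of_pinfty; split.
  - apply: (part (fun x => Re (u x)) _ (fun x => Re (w x))) => //.
    + by move=> X; have [_ h _ _] := sol X; have [] := Lloc _ _ h.
    + by move=> X; have [_ _ h _] := sol X; exact: (primitive_of_Re (lexx _) h).
    + by move=> X; have [_ _ _ h] := sol X; exact: (primitive_of_Re (lexx _) h).
    + move=> x x0; apply: le_trans (uK x x0); rewrite /sqmod.
      by apply: lerD; rewrite lerDl sqr_ge0.
  - apply: (part (fun x => Im (u x)) _ (fun x => Im (w x))) => //.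
    + by move=> X; have [_ h _ _] := sol X; have [] := Lloc _ _ h.
    + by move=> X; have [_ _ h _] := sol X; exact: (primitive_of_Im (lexx _) h).
    + by move=> X; have [_ _ _ h] := sol X; exact: (primitive_of_Im (lexx _) h).
    + move=> x x0; apply: le_trans (uK x x0); rewrite /sqmod.
      by apply: lerD; rewrite lerDr sqr_ge0.
split => // x [x0 _].
- by have [_ _ h _] := sol x; apply: h; split.
- by have [_ _ _ h] := sol x; apply: h; split.
Qed.

End HalfLineSolutions.

Section HalfLineExistence.
Variable R : realType.
Local Notation mu := (@lebesgue_measure R).
Implicit Types (X : R) (B : R -> R) (z : R[i]) (f u : R -> R[i]).

Lemma complex_bolzano_weierstrass (s : nat -> R[i]) (M : R) :
  (forall n, sqmod (s n) <= M) ->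
  exists s0, forall (m : nat) (e : R), 0 < e -> exists2 n : nat, (m <= n)%N & sqmod (s0 - s n) <= e.
Proof.
move=> sM.
have bnd (g : R[i] -> R) (v : nat -> nat) : (forall w, g w ^+ 2 <= sqmod w) ->
    bounded_fun (fun n => g (s (v n))).
  move=> gs; exists (1 + M); split; first exact: num_real.
  move=> x Mx n _ /=; apply: le_trans (ltW Mx).
  have := le_trans (gs (s (v n))) (sM (v n)); rewrite -(real_normK (num_real _)).
  by have := normr_ge0 (g (s (v n))); move: `|g _| => y y0 yM; nra.
have [|v1 iv1 c1] := @bolzano_weierstrass R (fun n => Re (s n)).
  by apply: (bnd (@complex.Re R) id) => w; rewrite lerDl sqr_ge0.
have [|v2 iv2 c2] := @bolzano_weierstrass R (fun n => Im (s (v1 n))).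
  by apply: (bnd (@complex.Im R) v1) => w; rewrite lerDr sqr_ge0.
have inc (v : nat -> nat) : increasing_seq v -> forall n, (n <= v n)%N.
  move=> iv; elim=> // n IH; apply: (leq_ltn_trans IH).
  have h : (v n.+1 <= v n)%N = (n.+1 <= n)%N := iv n.+1 n.
  by rewrite ltnNge h ltnn.
exists (limn ((fun n => Re (s n)) \o v1) +i* limn ((fun n => Im (s (v1 n))) \o v2)) => m e e0.
have c1' : Re (s (v1 (v2 n))) @[n --> \oo] --> limn ((fun n => Re (s n)) \o v1).
  apply: (@cvg_comp _ _ _ v2 ((fun n => Re (s n)) \o v1) \oo \oo) => //.
  by move=> A [N0 _ N0A]; exists N0 => // n /= Nn; apply: N0A; exact: leq_trans Nn (inc _ iv2 n).
(* Since [d <= 1], one has [d ^+ 2 <= d <= e / 2], so each of the two squares is at most [e / 2]. *)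
pose d := Num.min 1 (e / 2).
have d0 : 0 < d by rewrite lt_min ltr01 divr_gt0.
have /cvgrPdist_le /(_ d d0) h1 := c1'.
have /cvgrPdist_le /(_ d d0) h2 := c2.
near \oo => n.
exists (v1 (v2 n)).
  apply: leq_trans (inc _ iv1 _); apply: leq_trans (inc _ iv2 _).
  by near: n; exact: nbhs_infty_ge.
rewrite /sqmod ReB ImB /=.
have a1 : `|limn ((fun n => Re (s n)) \o v1) - Re (s (v1 (v2 n)))| <= d.
  by near: n; exact: h1.
have a2 : `|limn ((fun n => Im (s (v1 n))) \o v2) - Im (s (v1 (v2 n)))| <= d.
  by near: n; exact: h2.
have d1 : d <= 1 by rewrite ge_min lexx.
have d2 : d <= e / 2 by rewrite ge_min lexx orbT.
have sq (x : R) : `|x| <= d -> x ^+ 2 <= e / 2.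
  move=> xd; rewrite -(real_normK (num_real x)); apply: le_trans d2.
  by have := normr_ge0 x; move: xd; move: `|x| => y yd y0; nra.
by have := lerD (sq _ a1) (sq _ a2); lra.
Unshelve. all: by end_near. Qed.

(** The trace estimate over the whole edge converts a vanishing L^2 norm into vanishing initial
    data. *)
Lemma edge_solution_zero X (M : R) B z u u1 : 0 < X -> potential X%:E B ->
  (forall x, interval_of X%:E x -> `|B x| <= M) ->
  edge_solution X%:E B z (fun=> 0) u u1 ->
  \int[mu]_(x in `[0, X]) sqmod (u x) = 0 -> u 0 = 0 /\ u1 0 = 0.
Proof.
move=> X0 pB BM sol u0.
have [C C0 trace] := @edge_trace R X M z X0.
have XX : ((0 + X)%:E <= X%:E)%E by rewrite add0r.
have := trace _ _ _ _ _ 0 (lexx 0) XX pB BM (inL2_0 _) sol.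
rewrite add0r u0 add0r.
under eq_Rintegral do rewrite sqmod0.
rewrite (integral_cst_segment 0 (ltW X0)) mul0r mulr0 => h.
have := sqmod_ge0 (u 0); have := sqmod_ge0 (u1 0) => h1 h2.
by split; apply/eqP; rewrite -sqmod_eq0; apply/eqP; lra.
Qed.

(* Solve the Dirichlet problem on [0, n]; Green's formula and the trace estimate
   bound the slopes at 0, and a cluster point of them gives a square integrable
   solution. *)
Lemma halfline_solution B z f (a : R[i]) : Im z != 0 -> potential +oo%E B -> inL2 +oo%E f ->
  exists u u1, edge_solution +oo%E B z f u u1 /\ u 0 = a.
Proof.
move=> z0 pB hf; have [_ [M BM]] := pB.
have [Y [Y1 [Y0 Y10 solY]]] := edge_ivp z a 0 pB hf.
have [T [T1 [T0 T10 solT]]] := edge_ivp z 0 1 pB (inL2_0 _).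
have {}solY X := solY X (leey _); have {}solT X := solT X (leey _).
have pBX X : potential X%:E B by apply: potential_restrict pB; exact: leey.
have BMX X y : interval_of X%:E y -> `|B y| <= M.
  by move=> [y0 _]; apply: BM; split; rewrite ?leey.
have hfX X : inL2 X%:E f by apply: inL2_restrict hf; exact: leey.
(* A zero of [T] at [X] would make [T] a Dirichlet eigenfunction on [[0, X]] with the nonreal
   eigenvalue [z], which Green's formula excludes. *)
have Tn (X : R) : 0 < X -> T X != 0.
  move=> X0; apply/negP => /eqP TX.
  have := green_segment (ltW X0) (lexx _) (pBX X) (inL2_0 _) (solT X).
  rewrite T0 TX /wronskian /= !mul0r !subrr add0r.
  under [X in _ = - X]eq_Rintegral do rewrite /= !mulr0 subrr.
  rewrite (integral_cst_segment 0 (ltW X0)) mul0r oppr0 => /eqP.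
  rewrite mulf_eq0 (negbTE z0)/= => /eqP h.
  have [_] := edge_solution_zero X0 (pBX X) (@BMX X) (solT X) h.
  by rewrite T10 => /eqP; rewrite oner_eq0.
(* The slope for which [U (s n)] vanishes at [n + 1]; the shift keeps the segment at least as long
   as the unit window of the trace estimate. *)
pose s (n : nat) := - Y n.+1%:R / T n.+1%:R.
pose U (w : R[i]) x := Y x + w * T x; pose U1 w x := Y1 x + w * T1 x.
have solU w X : edge_solution X%:E B z f (U w) (U1 w).
  have := edge_solution_lin w (pBX X) (hfX X) (inL2_0 _) (solY X) (solT X).
  move=> [h1 h2 h3 h4]; split => //.
  by apply: primitive_of_ext h4 => x _; rewrite mulr0 addr0.
have U0 w : U w 0 = a by rewrite /U T0 Y0 mulr0 addr0.
have U10 w : U1 w 0 = w by rewrite /U1 T10 Y10 mulr1 add0r.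
pose D : set (measurableTypeR R) := `[0, +oo[%classic.
have mD : measurable D by exact: measurable_itv.
have Lf : L1 D (fun x => sqmod (f x)) by have := inL2_sqmod hf; rewrite interval_of_pinfty.
pose F := \int[mu]_(x in D) sqmod (f x).
have sD (X : R) : `[0, X] `<=` D by move=> y; rewrite /D/= !in_itv/= => /andP[->].
have Fle (X : R) : \int[mu]_(x in `[0, X]) sqmod (f x) <= F.
  by apply: Rintegral_subset => // x _; exact: sqmod_ge0.
have F0 : 0 <= F by apply: le_trans (Fle 0); apply: Rintegral_ge0 => x _; exact: sqmod_ge0.
have LsU w X : L1 `[0, X] (fun x => sqmod (U w x)).
  by have [h _ _ _] := solU w X; have := inL2_sqmod h; rewrite interval_of_fin.
have [C C0 trace] := @edge_trace R 1 M z ltr01.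
have sle w (X : R) : 1 <= X -> sqmod w <= C * (\int[mu]_(x in `[0, X]) sqmod (U w x) + F).
  move=> X1.
  have X1' : ((0 + 1)%:E <= X%:E)%E by rewrite add0r lee_fin.
  have := trace _ _ _ _ _ 0 (lexx 0) X1' (pBX X) (@BMX X) (hfX X) (solU w X).
  rewrite U10 add0r => h; apply: le_trans (le_trans h _).
    by rewrite lerDr sqmod_ge0.
  apply: ler_wpM2l => //; apply: lerD; last exact: Fle.
  apply: Rintegral_subset => //; first exact: subset_segment.
  by move=> y _; exact: sqmod_ge0.
pose y := `|Im z|; have y0 : 0 < y by rewrite normr_gt0.
(* With this weight [t / 2 * C <= y / 4]. Together with the other [y / 4] coming from the source,
   half of [y * J] is absorbed. *)
pose t := y / (2 * (C + 1)).
have C1 : 0 < C + 1 by rewrite ltr_wpDl.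
have t0 : 0 < t by rewrite divr_gt0// mulr_gt0.
pose K := y^-1 * F + t / 2 * (C * F) + (2 * t)^-1 * sqmod a.
have I (n : nat) : y / 2 * \int[mu]_(x in `[0, n.+1%:R]) sqmod (U (s n) x) <= K.
  set X := n.+1%:R : R; have X0 : 0 < X by rewrite ltr0n.
  have X1 : 1 <= X by rewrite ler1n.
  have Un : U (s n) X = 0 by rewrite /U /s divfK ?subrr ?Tn.
  have := green_segment (ltW X0) (lexx _) (pBX X) (hfX X) (solU (s n) X).
  rewrite U0 U10 Un {2}/wronskian /= !mul0r subrr subr0.
  set J := \int[mu]_(x in _) sqmod _; set W := \int[mu]_(x in _) wronskian _ _.
  have J0 : 0 <= J by apply: Rintegral_ge0 => x _; exact: sqmod_ge0.
  have LfX : L1 `[0, X] (fun x => sqmod (f x)) by exact: (L1S (measurable_itv _) mD (@sD X) Lf).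
  have LU := LsU (s n) X.
  have hW : `|W| <= y / 4 * J + y^-1 * F.
    apply: (@le_trans _ _ (\int[mu]_(x in `[0, X]) (y / 4 * sqmod (U (s n) x) + y^-1 * sqmod (f x)))).
      apply: integral_abs_le => //.
      - have [h _ _ _] := solU (s n) X; have := wronskian_L1 h (hfX X).
        by rewrite interval_of_fin.
      - by apply: L1D => //; exact: L1Z.
      - move=> x _; have := @wronskian_le R (U (s n) x) (f x) (y / 2).
        have -> : y / 2 / 2 = y / 4 by field.
        have -> : 2 * (y / 2) = y by field.
        by apply; rewrite divr_gt0.
    rewrite RintegralD//; [|exact: L1Z|exact: L1Z].
    rewrite RintegralZl// RintegralZl//; apply: lerD; first exact: lexx.
    by apply: ler_wpM2l; [rewrite invr_ge0 ltW|exact: Fle].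
  have hw : `|wronskian a (s n)| <= (2 * t)^-1 * sqmod a + t / 2 * (C * (J + F)).
    have -> : wronskian a (s n) = - wronskian (s n) a by rewrite /wronskian; ring.
    rewrite normrN; apply: (le_trans (wronskian_le _ _ t0)); rewrite addrC lerD2l.
    by apply: ler_wpM2l; [rewrite divr_ge0// ltW|exact: sle].
  move=> /(congr1 Num.norm); rewrite normrM (ger0_norm J0) -/y => E.
  have : y * J <= (2 * t)^-1 * sqmod a + t / 2 * (C * (J + F)) + (y / 4 * J + y^-1 * F).
    by rewrite E (le_trans (ler_normB _ _))// lerD.
  have : t / 2 * (C * J) <= y / 4 * J.
    rewrite mulrA; apply: ler_wpM2r => //; rewrite /t.
    rewrite (_ : _ * C = y / 4 * (C / (C + 1))); last by field; rewrite gt_eqF.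
    rewrite -[leRHS]mulr1 ler_wpM2l// ?divr_ge0 ?(ltW y0)//.
    by rewrite ler_pdivrMr// mul1r lerDl.
  rewrite (mulrDr C) (mulrDr (t / 2)) (_ : y / 4 * J = y * J / 4); last by ring.
  rewrite (_ : y / 2 * J = y * J / 2) /K; last by ring.
  move: (y * J) (t / 2 * (C * J)) (t / 2 * (C * F)) ((2 * t)^-1 * sqmod a) (y^-1 * F).
  by move=> j p q r v; clear; lra.
pose K' := 2 / y * K.
have I' n : \int[mu]_(x in `[0, n.+1%:R]) sqmod (U (s n) x) <= K'.
  have y2 : 0 <= 2 / y by rewrite divr_ge0// ltW.
  have := ler_wpM2l y2 (I n); rewrite mulrA (_ : 2 / y * (y / 2) = 1) ?mul1r//.
  by field; rewrite gt_eqF.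
have sM n : sqmod (s n) <= C * (K' + F).
  apply: (le_trans (sle (s n) n.+1%:R _)); first by rewrite ler1n.
  by apply: ler_wpM2l => //; rewrite lerD2r.
have [s0 hs0] := complex_bolzano_weierstrass sM.
have fin (m : nat) : \int[mu]_(x in `[0, m%:R]) sqmod (U s0 x) <= 2 * K' + 1.
  have LT : L1 `[0, m%:R] (fun x => sqmod (T x)).
    by have [h _ _ _] := solT m%:R; have := inL2_sqmod h; rewrite interval_of_fin.
  pose G := \int[mu]_(x in `[0, m%:R]) sqmod (T x).
  have G0 : 0 <= G by apply: Rintegral_ge0 => x _; exact: sqmod_ge0.
  (* A slope error of this size contributes at most 1 to the integral over [[0, m]], which explains
     the bound [2 * K' + 1], uniform in [m]. Taking [n >= m] lets [I'] control [U (s n)] there. *)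
  have e0 : 0 < (2 * (G + 1))^-1 by rewrite invr_gt0 mulr_gt0// ltr_wpDl.
  have [n mn hn] := hs0 m _ e0.
  have LU : L1 `[0, m%:R] (fun x => sqmod (U (s n) x)) by exact: LsU.
  have LU0 : L1 `[0, m%:R] (fun x => sqmod (U s0 x)) by exact: LsU.
  apply: (@le_trans _ _ (\int[mu]_(x in `[0, m%:R])
      (2 * sqmod (U (s n) x) + 2 * sqmod (s0 - s n) * sqmod (T x)))).
    apply: le_Rintegral => //; first by apply: L1D => //; exact: L1Z.
    move=> x _; have -> : U s0 x = U (s n) x + (s0 - s n) * T x by rewrite /U; ring.
    by apply: (le_trans (sqmodD_le _ _)); rewrite sqmodM mulrA.
  rewrite RintegralD//; [|exact: L1Z|exact: L1Z].
  rewrite !RintegralZl//; apply: lerD.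
    rewrite ler_pM2l//; apply: le_trans (I' n); apply: Rintegral_subset => //.
      by apply: subset_segment => //; rewrite ler_nat ltnW.
    by move=> x _; exact: sqmod_ge0.
  rewrite -/G; apply: (@le_trans _ _ (2 * (2 * (G + 1))^-1 * G)).
    by apply: ler_wpM2r => //; rewrite ler_pM2l.
  rewrite (_ : _ * G = G / (G + 1)); last by field; rewrite gt_eqF// ltr_wpDl.
  by rewrite ler_pdivrMr ?ltr_wpDl// mul1r lerDl.
exists (U s0), (U1 s0); split => //.
exact: edge_solution_halfline pB hf (solU s0) fin.
Qed.

End HalfLineExistence.

(** * Boundary value problems on a graph *)

Section EdgeEnds.
Variable R : realType.
Local Notation mu := (@lebesgue_measure R).
Implicit Types (l : \bar R) (X : R) (B : R -> R) (z : R[i]) (f u : R -> R[i]).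

(* Boundary values and outgoing derivatives, with the convention that a half-line
   has a second, fictitious end at which both vanish. *)
Definition end_value l u (b : bool) : R[i] :=
  if b then (if l is r%:E then u r else 0) else u 0.
Definition end_derivative l (u1 : R -> R[i]) (b : bool) : R[i] :=
  if b then (if l is r%:E then - u1 r else 0) else u1 0.

Lemma wronskianN (x y : R[i]) : wronskian x (- y) = - wronskian x y.
Proof. by rewrite /wronskian ReN ImN; ring. Qed.

(** On a half-line the boundary term at [n] is bounded, by the uniform trace estimate, by the mass
    of [u] and [f] on [[n, n + 1]]. This is an increment of a convergent sequence, so it tends to 0
    and the fictitious end contributes nothing. *)
Lemma green l B z f u u1 : (0 < l)%E -> potential l B -> inL2 l f ->
  edge_solution l B z f u u1 ->
  Im z * \int[mu]_(x in interval_of l) sqmod (u x) =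
  \sum_(b : bool) wronskian (end_value l u b) (end_derivative l u1 b) -
  \int[mu]_(x in interval_of l) wronskian (u x) (f x).
Proof.
case: l => [X| |]//; rewrite ?lte_fin => l0 pB hf sol; rewrite big_bool/=.
  rewrite interval_of_fin (green_segment (ltW l0) (lexx _) pB hf sol) wronskianN.
  by ring.
have w00 : wronskian (0 : R[i]) 0 = 0 by rewrite /wronskian /= !mul0r subrr.
rewrite w00 add0r interval_of_pinfty; have [_ [M BM]] := pB.
have [hu _ _ _] := sol.
have Lu := inL2_sqmod hu; have Lf := inL2_sqmod hf; have Lw := wronskian_L1 hu hf.
rewrite interval_of_pinfty in Lu Lf Lw.
have cu := cvg_integral_halfline Lu; have cf := cvg_integral_halfline Lf.
have cw := cvg_integral_halfline Lw.
have [C C0 trace] := @edge_trace R 1 M z ltr01.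
pose P (n : nat) := \int[mu]_(x in `[0, n%:R]) sqmod (u x) +
                    \int[mu]_(x in `[0, n%:R]) sqmod (f x).
have cP : (P n.+1 - P n) @[n --> \oo] --> (0 : R).
  have h : P n @[n --> \oo] --> \int[mu]_(x in `[0, +oo[) sqmod (u x) + \int[mu]_(x in `[0, +oo[) sqmod (f x).
    exact: cvgD.
  rewrite -[X in _ --> X](subrr (\int[mu]_(x in `[0, +oo[) sqmod (u x) + \int[mu]_(x in `[0, +oo[) sqmod (f x))).
  by apply: cvgB => //; rewrite (cvg_shiftS P).
have bnd n : `|wronskian (u n%:R) (u1 n%:R)| <= C * (P n.+1 - P n).
  have n0 : (0 : R) <= n%:R by [].
  have n1 : n%:R <= n%:R + 1 :> R by rewrite lerDl.
  have := trace _ _ _ _ _ n%:R n0 (leey _) pB BM hf sol.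
  have -> : \int[mu]_(t in `[n%:R, n%:R + 1]) sqmod (u t) + \int[mu]_(t in `[n%:R, n%:R + 1]) sqmod (f t)
      = P n.+1 - P n.
    have cat (g : R -> R) : L1 `[0, +oo[ g -> \int[mu]_(t in `[n%:R, n%:R + 1]) g t =
        \int[mu]_(x in `[0, n.+1%:R]) g x - \int[mu]_(x in `[0, n%:R]) g x.
      move=> hg; rewrite -natr1 (integral_cat n0 n1); first by rewrite addrAC subrr add0r.
      apply: (@L1S _ _ `[0, +oo[%classic) => // x /=.
      by rewrite !in_itv/= => /andP[->].
    by rewrite (cat _ Lu) (cat _ Lf) /P; ring.
  apply: le_trans.
  have := @wronskian_le R (u n%:R) (u1 n%:R) 1 ltr01; rewrite mulr1.
  by have := sqmod_ge0 (u n%:R); have := sqmod_ge0 (u1 n%:R); lra.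
have c0 : wronskian (u n%:R) (u1 n%:R) @[n --> \oo] --> (0 : R).
  apply/norm_cvg0P; apply: (@squeeze_cvgr _ _ _ _ (fun=> 0) (fun n => C * (P n.+1 - P n))).
  - by apply: nearW => n; rewrite normr_ge0 bnd.
  - exact: cvg_cst.
  - by rewrite -[X in _ --> X](mulr0 C); apply: cvgM => //; exact: cvg_cst.
have E n : Im z * \int[mu]_(x in `[0, n%:R]) sqmod (u x) =
    wronskian (u 0) (u1 0) - wronskian (u n%:R) (u1 n%:R) -
    \int[mu]_(x in `[0, n%:R]) wronskian (u x) (f x).
  by rewrite (green_segment _ (leey _) pB hf sol).
have h1 : Im z * \int[mu]_(x in `[0, n%:R]) sqmod (u x) @[n --> \oo] -->
    Im z * \int[mu]_(x in `[0, +oo[) sqmod (u x).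
  by apply: cvgM => //; exact: cvg_cst.
have h2 : Im z * \int[mu]_(x in `[0, n%:R]) sqmod (u x) @[n --> \oo] -->
    wronskian (u 0) (u1 0) - 0 - \int[mu]_(x in `[0, +oo[) wronskian (u x) (f x).
  rewrite (eq_cvg _ _ E); apply: cvgB => //; apply: cvgB => //; exact: cvg_cst.
by rewrite (cvg_unique _ h1 h2)// subr0.
Qed.

Lemma edge_solution_0 l B z : edge_solution l B z (fun=> 0) (fun=> 0) (fun=> 0).
Proof.
have h (g : R -> R[i]) : (forall x, g x = 0) -> primitive_of l g (fun=> 0).
  move=> g0 x _; rewrite add0r /cintegral.
  under eq_Rintegral do rewrite g0/=.
  under [X in _ +i* X]eq_Rintegral do rewrite g0/=.
  by rewrite Rintegral_cst// mul0r.
split; [exact: inL2_0|exact: inL2_0|exact: h|apply: h => x].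
by rewrite mulr0 subrr.
Qed.

Lemma edge_particular l B z f : (0 < l)%E -> (l = +oo%E -> Im z != 0) -> potential l B ->
  inL2 l f -> exists u u1, edge_solution l B z f u u1.
Proof.
case: l => [X| |]// _ hz pB hf.
  have [u [u1 [_ _ h]]] := edge_ivp z 0 0 pB hf.
  by exists u, u1; apply: h.
have [u [u1 [h _]]] := halfline_solution 0 (hz erefl) pB hf.
by exists u, u1.
Qed.

(** Two coefficients per edge in all cases. On a half-line the second basis function is 0 and its
    coefficient is a dummy attached to the fictitious end; hence the second normalization is
    restricted to finite edges. *)
Lemma edge_basis l B z : (0 < l)%E -> (l = +oo%E -> Im z != 0) -> potential l B ->
  exists chi chi1 : bool -> R -> R[i],
    (forall b, edge_solution l B z (fun=> 0) (chi b) (chi1 b)) /\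
    forall a : bool -> R[i], \sum_b a b * chi b 0 = a false /\
      (l != +oo%E -> \sum_b a b * chi1 b 0 = a true).
Proof.
case: l => [X| |]// _ hz pB.
  have [u [u1 [u0 u10 h]]] := edge_ivp z 1 0 pB (inL2_0 _).
  have [v [v1 [v0 v10 h']]] := edge_ivp z 0 1 pB (inL2_0 _).
  exists (fun b => if b then v else u), (fun b => if b then v1 else u1).
  split=> [[]|a]; [exact: h'|exact: h|].
  by rewrite !big_bool/= u0 u10 v0 v10 !mulr0 !mulr1 add0r addr0.
have [u [u1 [h u0]]] := halfline_solution 1 (hz erefl) pB (inL2_0 _).
exists (fun b => if b then fun=> 0 else u), (fun b => if b then fun=> 0 else u1).
split=> [[]|a]; [exact: edge_solution_0|exact: h|].
by rewrite !big_bool/= u0 mulr1 mulr0 add0r.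
Qed.

End EdgeEnds.

(** Injectivity of a square matrix gives its inverse, here as explicit coefficients [t'], so that
    existence and quantitative bounds can both be read off. *)
Lemma injective_square_system (K : fieldType) (J : finType) (t : J -> J -> K) :
  (forall a : J -> K, (forall h, \sum_k a k * t k h = 0) -> forall h, a h = 0) ->
  exists t' : J -> J -> K, forall a r : J -> K,
    (forall h, \sum_k a k * t k h = r h) <-> (forall h, a h = \sum_k r k * t' k h).
Proof.
move=> inj; pose M : 'M[K]_#|J| := \matrix_(i, j) t (enum_val i) (enum_val j).
pose row (a : J -> K) : 'rV[K]_#|J| := \row_i a (enum_val i).
have sumE (a : J -> K) (s : J -> J -> K) (h : J) :
    \sum_k a k * s k h = (row a *m \matrix_(i, j) s (enum_val i) (enum_val j)) 0 (enum_rank h).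
  rewrite mxE (reindex_onto enum_val enum_rank)/=; last by move=> k _; rewrite enum_rankK.
  apply: eq_big => [k|k _]; first by rewrite enum_valK eqxx.
  by rewrite !mxE enum_rankK.
have Mu : M \in unitmx.
  rewrite -row_free_unit -kermx_eq0; apply/rowV0P => v /sub_kermxP vM.
  pose a k := v 0 (enum_rank k).
  have va : v = row a by apply/rowP => i; rewrite !mxE /a enum_valK.
  suff a0 : forall h, a h = 0 by rewrite va; apply/rowP => i; rewrite !mxE a0.
  by apply: inj => h; rewrite (sumE a t) -/M -va vM mxE.
exists (fun k h => invmx M (enum_rank k) (enum_rank h)) => a r.
have tE : \matrix_(i, j) invmx M (enum_rank (enum_val i)) (enum_rank (enum_val j)) = invmx M.
  by apply/matrixP => i j; rewrite mxE !enum_valK.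
have E1 : (forall h, \sum_k a k * t k h = r h) <-> row a *m M = row r.
  split=> [aE|aE k]; last by rewrite (sumE a t) -/M aE mxE enum_rankK.
  by apply/rowP => i; rewrite [RHS]mxE -aE (sumE a t) -/M enum_valK.
have E2 : (forall h, a h = \sum_k r k * invmx M (enum_rank k) (enum_rank h)) <->
    row a = row r *m invmx M.
  split=> [aE|/rowP aE k].
    by apply/rowP => i; rewrite [LHS]mxE aE (sumE r (fun k h => invmx M (enum_rank k) (enum_rank h))) tE enum_valK.
  by rewrite (sumE r (fun k h => invmx M (enum_rank k) (enum_rank h))) tE -aE mxE enum_rankK.
split=> [/E1 aE|/E2 aE]; first by apply/E2; rewrite -aE mulmxK.
by apply/E1; rewrite aE mulmxKV.
Qed.

Section GraphOperators.
Variables (R : realType) (I : finType) (l : I -> \bar R) (B : I -> R -> R) (z : R[i]).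
Local Notation mu := (@lebesgue_measure R).
Hypothesis l0 : forall i, (0 < l i)%E.
Hypothesis pB : forall i, potential (l i) (B i).
Implicit Types (f psi : gfun R I).

Definition graph_value psi (h : I * bool) := end_value (l h.1) (psi h.1) h.2.
Definition graph_derivative psi1 (h : I * bool) := end_derivative (l h.1) (psi1 h.1) h.2.

Definition graph_solution f psi psi1 :=
  forall i, edge_solution (l i) (B i) z (f i) (psi i) (psi1 i).

Definition sqnorm psi := \sum_i \int[mu]_(x in interval_of (l i)) sqmod (psi i x).

Lemma sqnorm_ge0 psi : 0 <= sqnorm psi.
Proof. by apply: sumr_ge0 => i _; apply: Rintegral_ge0 => x _; exact: sqmod_ge0. Qed.

Lemma sqnorm_edge psi i : \int[mu]_(x in interval_of (l i)) sqmod (psi i x) <= sqnorm psi.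
Proof.
rewrite /sqnorm (bigD1 i)//= lerDl; apply: sumr_ge0 => j _.
by apply: Rintegral_ge0 => x _; exact: sqmod_ge0.
Qed.

Lemma L2norm_le psi f (M : R) : 0 <= M -> sqnorm psi <= M ^+ 2 * sqnorm f ->
  L2norm l psi <= M * L2norm l f.
Proof.
move=> M0 h; rewrite /L2norm -[X in _ <= X * _](ger0_norm M0) -sqrtr_sqr -sqrtrM ?sqr_ge0//.
exact: ler_wsqrtr.
Qed.

Lemma edge_solution_ext_rhs i (f g u u1 : R -> R[i]) : (forall x, interval_of (l i) x -> f x = g x) ->
  edge_solution (l i) (B i) z f u u1 -> edge_solution (l i) (B i) z g u u1.
Proof.
move=> fg [h1 h2 h3 h4]; split => //; apply: primitive_of_ext h4 => x Ix.
by rewrite fg.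
Qed.

Lemma graph_solution_lin f psi psi1 g phi phi1 (s : R[i]) : gL2 l f -> gL2 l g ->
  graph_solution f psi psi1 -> graph_solution g phi phi1 ->
  graph_solution (fun i x => f i x + s * g i x) (fun i x => psi i x + s * phi i x)
    (fun i x => psi1 i x + s * phi1 i x).
Proof. by move=> hf hg h h' i; apply: edge_solution_lin. Qed.

Lemma ge0_finite_length (k : \bar R) : (0 < k)%E -> exists2 X : R, 0 < X & (X%:E <= k)%E.
Proof.
case: k => [r| |]//; first by rewrite lte_fin => r0; exists r.
by move=> _; exists 1; rewrite ?leey.
Qed.

Lemma edge_solution_eq0 i u u1 : edge_solution (l i) (B i) z (fun=> 0) u u1 ->
  u 0 = 0 -> u1 0 = 0 -> forall x, interval_of (l i) x -> u x = 0 /\ u1 x = 0.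
Proof.
move=> sol u0 u10 x [x0 xl]; have [_ [M BM]] := pB i.
have [C C0] := @edge_stability R x M z.
have bM y : 0 <= y <= x -> `|B i y| <= M.
  by move=> /andP[y0 yx]; apply: BM; split => //; rewrite (le_trans _ xl)// lee_fin.
have xx : 0 <= x <= x by rewrite x0 lexx.
move=> /(_ _ _ _ _ (potential_restrict xl (pB i)) bM (inL2_0 _) (edge_solution_restrict xl sol) x xx).
rewrite u0 u10; under eq_Rintegral do rewrite norm1_0.
rewrite (integral_cst_segment _ x0) mul0r norm1_0 !addr0 mulr0 => h.
have := norm1_ge0 (u x); have := norm1_ge0 (u1 x) => h1 h2.
by split; apply: norm1_eq0; lra.
Qed.

Lemma end_value_lin (k : \bar R) (u v : R -> R[i]) s b :
  end_value k (fun x => u x + s * v x) b = end_value k u b + s * end_value k v b.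
Proof. by case: b => //=; case: k => // *; rewrite mulr0 addr0. Qed.

Lemma end_derivative_lin (k : \bar R) (u v : R -> R[i]) s b :
  end_derivative k (fun x => u x + s * v x) b = end_derivative k u b + s * end_derivative k v b.
Proof.
by case: b => //=; case: k => [r| |]; rewrite ?mulr0 ?addr0// opprD mulrN.
Qed.

(** * General linear boundary conditions, one equation for each edge end *)

Section BoundaryCondition.
Local Notation ends := (I * bool)%type.
Variable L : (ends -> R[i]) -> (ends -> R[i]) -> ends -> R[i].
Hypothesis L_lin : forall s x y x' y' h,
  L (fun k => x k + s * x' k) (fun k => y k + s * y' k) h = L x y h + s * L x' y' h.
(** By convention the value at a fictitious end is 0, so its equation is a tautology; it keeps the
    number of equations equal to the number of ends. *)
Hypothesis L_fictitious : forall i x y, l i = +oo%E -> L x y (i, true) = x (i, true).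

Definition residual psi psi1 := L (graph_value psi) (graph_derivative psi1).

Lemma residual_lin psi psi1 phi phi1 s h :
  residual (fun i x => psi i x + s * phi i x) (fun i x => psi1 i x + s * phi1 i x) h =
  residual psi psi1 h + s * residual phi phi1 h.
Proof.
rewrite /residual -L_lin; congr (L _ _ h); apply/funext => k.
  exact: end_value_lin.
exact: end_derivative_lin.
Qed.

Lemma residual0 h : residual (fun _ _ => 0) (fun _ _ => 0) h = 0.
Proof.
have := residual_lin (fun _ _ => 0) (fun _ _ => 0) (fun _ _ => 0) (fun _ _ => 0) (-1) h.
have -> : (fun (i : I) (x : R) => 0 + -1 * 0 : R[i]) = (fun _ _ => 0).
  by apply/funext => i; apply/funext => x; rewrite mulr0 addr0.
by rewrite mulN1r subrr.
Qed.

Hypothesis unique : forall psi psi1, graph_solution (fun _ _ => 0) psi psi1 ->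
  (forall h, residual psi psi1 h = 0) -> forall i, psi i 0 = 0 /\ psi1 i 0 = 0.

Hypothesis halfline_z : forall i, l i = +oo%E -> Im z != 0.

Lemma graph_basis : exists (chi chi1 : ends -> gfun R I) (t' : ends -> ends -> R[i]),
  let psi a := fun i x => \sum_h a h * chi h i x in
  let psi1 a := fun i x => \sum_h a h * chi1 h i x in
  [/\ forall a, graph_solution (fun _ _ => 0) (psi a) (psi1 a),
      forall a i, l i != +oo%E -> psi a i 0 = a (i, false) /\ psi1 a i 0 = a (i, true),
      forall r h, l h.1 != +oo%E \/ h.2 = false ->
        let a := fun h => \sum_k r k * t' k h in residual (psi a) (psi1 a) h = r h &
      (forall i, l i != +oo%E) ->
        forall a h, a h = \sum_k residual (psi a) (psi1 a) k * t' k h].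
Proof.
have [X hX] := choice (fun i => edge_basis (l0 i) (@halfline_z i) (pB i)).
have [X1 hb] := choice hX.
pose chi (h : ends) : gfun R I := fun i x => if i == h.1 then X h.1 h.2 x else 0.
pose chi1 (h : ends) : gfun R I := fun i x => if i == h.1 then X1 h.1 h.2 x else 0.
pose psi (a : ends -> R[i]) : gfun R I := fun i x => \sum_h a h * chi h i x.
pose psi1 (a : ends -> R[i]) : gfun R I := fun i x => \sum_h a h * chi1 h i x.
have solchi h : graph_solution (fun _ _ => 0) (chi h) (chi1 h).
  move=> i; rewrite /chi /chi1; case: eqP => [->|_]; last exact: edge_solution_0.
  exact: (hb h.1).1.
have sumP (P : gfun R I -> gfun R I -> Prop) (a : ends -> R[i]) :
    P (fun _ _ => 0) (fun _ _ => 0) ->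
    (forall u u1 h, P u u1 -> P (fun i x => u i x + a h * chi h i x)
                               (fun i x => u1 i x + a h * chi1 h i x)) ->
    P (psi a) (psi1 a).
  move=> P0 PS; rewrite /psi /psi1; elim: (index_enum _) => [|h s IH].
    rewrite (_ : (fun _ _ => _) = (fun _ _ => 0)); last first.
      by apply/funext => i; apply/funext => x; rewrite big_nil.
    rewrite (_ : (fun _ _ => \sum_(h <- [::]) _) = (fun _ _ => 0))//.
    by apply/funext => i; apply/funext => x; rewrite big_nil.
  have E (c : ends -> gfun R I) : (fun i x => \sum_(k <- h :: s) a k * c k i x) =
      (fun i x => \sum_(k <- s) a k * c k i x + a h * c h i x).
    by apply/funext => i; apply/funext => x; rewrite big_cons addrC.
  by rewrite !E; exact: PS.
have solpsi a : graph_solution (fun _ _ => 0) (psi a) (psi1 a).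
  apply: sumP => [i|u u1 h hu]; first exact: edge_solution_0.
  have z0 : gL2 l (fun (_ : I) (_ : R) => 0 : R[i]) by move=> i; exact: inL2_0.
  move=> i; apply: edge_solution_ext_rhs (graph_solution_lin (a h) z0 z0 hu (solchi h) i) => x _.
  by rewrite mulr0 addr0.
have psiE (a : ends -> R[i]) i x : psi a i x = \sum_b a (i, b) * X i b x /\
    psi1 a i x = \sum_b a (i, b) * X1 i b x.
  have E (Y : I -> bool -> R -> R[i]) :
     \sum_(h : ends) a h * (if i == h.1 then Y h.1 h.2 x else 0) = \sum_b a (i, b) * Y i b x.
    rewrite (eq_bigr (fun p => a (p.1, p.2) * (if i == p.1 then Y p.1 p.2 x else 0))); last by case.
    rewrite -(pair_bigA _ (fun j b => a (j, b) * (if i == j then Y j b x else 0)))/=.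
    rewrite (bigD1 i)//= eqxx [X in _ + X]big1 ?addr0// => j ji.
    by rewrite big1// => b _; rewrite eq_sym (negbTE ji) mulr0.
  by split; exact: E.
have psi0 (a : ends -> R[i]) i : psi a i 0 = a (i, false).
  by rewrite (psiE _ _ _).1; have [] := (hb i).2 (fun b => a (i, b)).
have psi10 (a : ends -> R[i]) i : l i != +oo%E -> psi1 a i 0 = a (i, true).
  by move=> li; rewrite (psiE _ _ _).2; have [_] := (hb i).2 (fun b => a (i, b)); apply.
pose fict (h : ends) := (l h.1 == +oo%E) && h.2.
(* At a fictitious end every residual is 0, so the column would vanish. Adding a diagonal 1 there
   imposes that the dummy coefficient is 0 and makes the system injective. *)
pose t (k h : ends) := residual (chi k) (chi1 k) h + (fict h && (k == h))%:R.
have res a h : residual (psi a) (psi1 a) h = \sum_k a k * residual (chi k) (chi1 k) h.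
  rewrite /psi /psi1; elim: (index_enum _) => [|k s IH].
    have E (c : ends -> gfun R I) :
        (fun i x => \sum_(j <- [::]) a j * c j i x) = (fun _ _ => 0).
      by apply/funext => i; apply/funext => x; rewrite big_nil.
    by rewrite !E big_nil residual0.
  have E (c : ends -> gfun R I) : (fun i x => \sum_(j <- k :: s) a j * c j i x) =
      (fun i x => \sum_(j <- s) a j * c j i x + a k * c k i x).
    by apply/funext => i; apply/funext => x; rewrite big_cons addrC.
  by rewrite !E residual_lin IH big_cons addrC.
have tE a h : \sum_k a k * t k h = residual (psi a) (psi1 a) h + (if fict h then a h else 0).
  rewrite res (eq_bigr (fun k => a k * residual (chi k) (chi1 k) h +
      (if k == h then (if fict h then a h else 0) else 0))); last first.
    move=> k _; rewrite /t mulrDr; congr (_ + _).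
    by case: eqP => [->|_]; case: (fict h); rewrite ?mulr1 ?mulr0.
  by rewrite big_split/= -big_mkcond/= big_pred1_eq.
have fict_res h psi' psi1' : fict h -> residual psi' psi1' h = 0.
  case: h => i b /andP[/= /eqP li bT]; rewrite bT /residual L_fictitious//.
  by rewrite /graph_value/= li.
have [a hk|t' ht'] := @injective_square_system _ _ t.
  have hf h : fict h -> a h = 0.
    by move=> fh; have := hk h; rewrite tE fict_res// fh add0r.
  have hr h : residual (psi a) (psi1 a) h = 0.
    have := hk h; rewrite tE; case: ifP => [/hf->|_]; by rewrite addr0.
  have un := unique (solpsi a) hr.
  move=> [i []]; last by rewrite -psi0; have [] := un i.
  have [li|li] := eqVneq (l i) +oo%E; first by apply: hf; rewrite /fict/= li eqxx.
  by rewrite -psi10//; have [] := un i.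
exists chi, chi1, t'; split.
- exact: solpsi.
- by move=> a i li; split; [exact: psi0|exact: psi10].
- move=> r h hh a; have /ht' := fun h => erefl (a h); move=> /(_ h).
  rewrite tE (_ : fict h = false) ?addr0//.
  by rewrite /fict; case: hh => [/negbTE->|->]; rewrite ?andbF.
- move=> lf a h; apply: (ht' a _).1 => k; rewrite tE (_ : fict k = false) ?addr0//.
  by rewrite /fict (negbTE (lf _)).
Qed.

(** Particular solutions are chosen edge by edge, then corrected by the homogeneous solution with
    the opposite residual. *)
Lemma graph_solution_exists f : gL2 l f ->
  exists psi psi1, graph_solution f psi psi1 /\ forall h, residual psi psi1 h = 0.
Proof.
move=> hf; have [chi [chi1 [t' [sol _ surj _]]]] := graph_basis.
have [u hu] := choice (fun i => edge_particular (l0 i) (@halfline_z i) (pB i) (hf i)).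
have [u1 hu1] := choice hu.
pose r h := residual u u1 h.
pose a h := \sum_k (- r k) * t' k h.
pose psi : gfun R I := fun i x => \sum_h a h * chi h i x.
pose psi1 : gfun R I := fun i x => \sum_h a h * chi1 h i x.
have z0 : gL2 l (fun (_ : I) (_ : R) => 0 : R[i]) by move=> i; exact: inL2_0.
exists (fun i x => u i x + 1 * psi i x), (fun i x => u1 i x + 1 * psi1 i x); split.
  move=> i; apply: edge_solution_ext_rhs (graph_solution_lin 1 hf z0 hu1 (sol a) i) => x _.
  by rewrite mulr0 addr0.
move=> h; have [fh|fh] := boolP ((l h.1 == +oo%E) && h.2); last first.
  rewrite residual_lin surj; first by rewrite mul1r subrr.
  by move: fh; rewrite negb_and => /orP[->|/negbTE->]; [left|right].
case: h fh => i b /andP[/= /eqP li ->]; rewrite /residual L_fictitious//.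
by rewrite /graph_value/= li.
Qed.

Lemma L_sum (J : Type) (s : seq J) (a : J -> R[i]) (X Y : J -> ends -> R[i]) h :
  L (fun k => \sum_(j <- s) a j * X j k) (fun k => \sum_(j <- s) a j * Y j k) h =
  \sum_(j <- s) a j * L (X j) (Y j) h.
Proof.
elim: s => [|j s IH].
  have E (c : J -> ends -> R[i]) : (fun k => \sum_(m <- [::]) a m * c m k) = (fun=> 0).
    by apply/funext => k; rewrite big_nil.
  rewrite !E big_nil; have := L_lin (-1) (fun=> 0) (fun=> 0) (fun=> 0) (fun=> 0) h.
  have -> : (fun _ : ends => 0 + -1 * 0 : R[i]) = (fun=> 0).
    by apply/funext => k; rewrite mulr0 addr0.
  by rewrite mulN1r subrr.
have E (c : J -> ends -> R[i]) : (fun k => \sum_(m <- j :: s) a m * c m k) =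
    (fun k => \sum_(m <- s) a m * c m k + a j * c j k).
  by apply/funext => k; rewrite big_cons addrC.
by rewrite !E L_lin IH big_cons addrC.
Qed.

Lemma L_bounded : exists2 C, 0 <= C & forall x y h,
  norm1 (L x y h) <= C * \sum_k (norm1 (x k) + norm1 (y k)).
Proof.
pose d (k j : ends) : R[i] := (j == k)%:R.
pose N k h := norm1 (L (d k) (fun=> 0) h) + norm1 (L (fun=> 0) (d k) h).
have N0 k h : 0 <= N k h by rewrite addr_ge0 ?norm1_ge0.
exists (\sum_k \sum_h N k h) => [|x y h].
  by apply: sumr_ge0 => k _; apply: sumr_ge0 => h _.
have dE (a : ends -> R[i]) : a = (fun k => \sum_j a j * d j k).
  apply/funext => k; rewrite (bigD1 k)//= /d eqxx mulr1 big1 ?addr0// => j jk.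
  by rewrite eq_sym (negbTE jk) mulr0.
have zE (a : ends -> R[i]) : (fun=> 0) = (fun k : ends => \sum_j a j * (fun _ _ => 0 : R[i]) j k).
  by apply/funext => k; rewrite big1// => j _; rewrite mulr0.
have -> : L x y h = L x (fun=> 0) h + 1 * L (fun=> 0) y h.
  rewrite -L_lin; congr (L _ _ h); apply/funext => k; rewrite mul1r ?mulr0 ?addr0 ?add0r//.
have Nle k : N k h <= \sum_k \sum_h N k h.
  rewrite (bigD1 k)//= (bigD1 h)//= -addrA lerDl addr_ge0//; apply: sumr_ge0 => j _//.
  by apply: sumr_ge0.
rewrite mul1r big_split/= mulrDr (le_trans (norm1D _ _))//; apply: lerD.
- rewrite {1}[x]dE {1}[fun=> 0](zE x) L_sum (le_trans (norm1_sum _ _))// mulr_sumr.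
  apply: ler_sum => k _; rewrite (le_trans (norm1M _ _))// mulrC ler_wpM2r ?norm1_ge0//.
  by apply: le_trans (Nle k); rewrite lerDl norm1_ge0.
- rewrite {1}[y]dE {1}[fun=> 0](zE y) L_sum (le_trans (norm1_sum _ _))// mulr_sumr.
  apply: ler_sum => k _; rewrite (le_trans (norm1M _ _))// mulrC ler_wpM2r ?norm1_ge0//.
  by apply: le_trans (Nle k); rewrite lerDr norm1_ge0.
Qed.

(** Remove from [psi] the homogeneous solution [v] with the same initial data. The remainder has
    zero data, so it is bounded by the source alone, and so is its contribution to the residual.
    Thus the residual of [v] is controlled, [t'] bounds the common initial data, and edge stability
    bounds [psi]. *)
Lemma graph_stability : (forall i, l i != +oo%E) ->
  exists2 C, 0 <= C & forall f psi psi1, gL2 l f -> graph_solution f psi psi1 ->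
    forall i x, interval_of (l i) x -> norm1 (psi i x) <=
      C * (\sum_i \int[mu]_(t in interval_of (l i)) norm1 (f i t) +
           \sum_h norm1 (residual psi psi1 h)).
Proof.
move=> lf; have [chi [chi1 [t' [sol init _ inv]]]] := graph_basis.
have {}inv := inv lf.
pose T := \sum_k \sum_h norm1 (t' k h).
have T0 : 0 <= T by apply: sumr_ge0 => k _; apply: sumr_ge0 => h _; exact: norm1_ge0.
have tT k h : norm1 (t' k h) <= T.
  rewrite /T (bigD1 k)//= (bigD1 h)//= -addrA lerDl addr_ge0//; apply: sumr_ge0 => j _.
    exact: norm1_ge0.
  by apply: sumr_ge0 => m _; exact: norm1_ge0.
have stab i : exists C, 0 <= C /\ forall f u u1 : R -> R[i], inL2 (l i) f ->
    edge_solution (l i) (B i) z f u u1 ->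
    forall x, interval_of (l i) x -> norm1 (u x) + norm1 (u1 x) <=
      C * (norm1 (u 0) + norm1 (u1 0) + \int[mu]_(t in interval_of (l i)) norm1 (f t)).
  move: (lf i) (l0 i) (pB i); case: (l i) => [r| |]// _ r0 pBi; have [_ [M BM]] := pBi.
  have [C C0 hC] := @edge_stability R r M z; exists C; split => // f u u1 hf hu x.
  rewrite interval_of_fin/= in_itv/= => xr; apply: (hC _ _ _ _ pBi) => // y yr.
  by apply: BM; rewrite interval_of_fin/= in_itv.
have [C hC] := choice stab.
pose Cs := \sum_i C i.
have CCs i : C i <= Cs.
  by rewrite /Cs (bigD1 i)//= lerDl; apply: sumr_ge0 => j _; have [] := hC j.
have Cs0 : 0 <= Cs by apply: sumr_ge0 => j _; have [] := hC j.
have [CL CL0 hL] := L_bounded.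
pose K := \sum_(k : ends) (1 : R).
have K0 : 0 <= K by exact: sumr_ge0.
have sumK (c : R) : \sum_(k : ends) c = K * c.
  by rewrite mulr_suml; apply: eq_bigr => k _; rewrite mul1r.
exists (Cs * (2 * T * (1 + 2 * K ^+ 2 * CL * Cs) + 1)).
  by rewrite mulr_ge0// addr_ge0// mulr_ge0// ?mulr_ge0// addr_ge0// !mulr_ge0// sqr_ge0.
move=> f psi psi1 hf hpsi i x Ix.
set F := \sum_i _; set S := \sum_h norm1 _.
have fi0 j : 0 <= \int[mu]_(t in interval_of (l j)) norm1 (f j t).
  by apply: Rintegral_ge0 => t _; exact: norm1_ge0.
have F0 : 0 <= F by apply: sumr_ge0.
have fF j : \int[mu]_(t in interval_of (l j)) norm1 (f j t) <= F.
  by rewrite /F (bigD1 j)//= lerDl; apply: sumr_ge0.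
have S0 : 0 <= S by apply: sumr_ge0 => h _; exact: norm1_ge0.
(* On a finite edge the coefficients at the two ends are [psi i 0] and [psi1 i 0]: both equations'
   unknowns sit at [x = 0], also for the end at [len]. *)
pose a (h : ends) : R[i] := if h.2 then psi1 h.1 0 else psi h.1 0.
pose v : gfun R I := fun i x => \sum_h a h * chi h i x.
pose v1 : gfun R I := fun i x => \sum_h a h * chi1 h i x.
have z0 : gL2 l (fun (_ : I) (_ : R) => 0 : R[i]) by move=> j; exact: inL2_0.
pose d : gfun R I := fun i x => psi i x + (-1) * v i x.
pose d1 : gfun R I := fun i x => psi1 i x + (-1) * v1 i x.
have sold : graph_solution f d d1.
  move=> j; apply: edge_solution_ext_rhs (graph_solution_lin (-1) hf z0 hpsi (sol a) j) => y _.
  by rewrite mulr0 addr0.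
have d0 j : d j 0 = 0 /\ d1 j 0 = 0.
  by have [e1 e2] := init a j (lf j); rewrite /d /d1 /v /v1 e1 e2 /a/= !mulN1r !subrr.
have dle j y : interval_of (l j) y -> norm1 (d j y) + norm1 (d1 j y) <= Cs * F.
  move=> Iy; apply: (le_trans ((hC j).2 _ _ _ (hf j) (sold j) y Iy)).
  have [-> ->] := d0 j; rewrite norm1_0 !add0r.
  by apply: ler_pM => //; have [] := hC j.
have endle (k : ends) : norm1 (graph_value d k) + norm1 (graph_derivative d1 k) <= 2 * (Cs * F).
  have CF0 : 0 <= Cs * F by rewrite mulr_ge0.
  have h : norm1 (graph_value d k) + norm1 (graph_derivative d1 k) <= Cs * F.
    case: k => j b; rewrite /graph_value /graph_derivative/=; case: b => /=.
      move: (@dle j) (lf j) (l0 j); case: (l j) => [r| |]// dj _.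
      rewrite lte_fin => /ltW r0; rewrite norm1N; apply: dj.
      by split; rewrite ?lexx.
    by apply: dle; split => //; exact: ltW.
  by apply: (le_trans h); rewrite ler_peMl// ler1n.
have resv h : norm1 (residual v v1 h) <= norm1 (residual psi psi1 h) + 2 * K * CL * Cs * F.
  have -> : residual v v1 h = residual psi psi1 h - residual d d1 h.
    by rewrite /d /d1 residual_lin mulN1r opprB addrC subrK.
  rewrite (le_trans (norm1D _ _))// norm1N lerD2l (le_trans (hL _ _ _))//.
  rewrite (_ : 2 * K * CL * Cs * F = CL * (K * (2 * (Cs * F)))); last by ring.
  apply: ler_wpM2l => //.
  apply: (@le_trans _ _ (\sum_(k : ends) 2 * (Cs * F))); first exact: ler_sum.
  by rewrite sumK.
have ale h : norm1 (a h) <= T * (S + 2 * K ^+ 2 * CL * Cs * F).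
  rewrite (inv a h) (le_trans (norm1_sum _ _))//.
  apply: (@le_trans _ _ (\sum_k T * (norm1 (residual psi psi1 k) + 2 * K * CL * Cs * F))).
    apply: ler_sum => k _; rewrite (le_trans (norm1M _ _))// mulrC.
    by apply: ler_pM; rewrite ?norm1_ge0.
  rewrite -mulr_sumr big_split/= sumK -/S.
  by rewrite le_eqVlt; apply/orP; left; apply/eqP; ring.
apply: (@le_trans _ _ (norm1 (psi i x) + norm1 (psi1 i x))); first by rewrite lerDl norm1_ge0.
apply: (le_trans ((hC i).2 _ _ _ (hf i) (hpsi i) x Ix)).
apply: (@le_trans _ _ (Cs * (norm1 (psi i 0) + norm1 (psi1 i 0) + F))).
  apply: ler_pM => //; [by have [] := hC i|by rewrite !addr_ge0 ?norm1_ge0|by rewrite lerD2l].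
rewrite -[leRHS]mulrA; apply: ler_wpM2l => //.
have := ale (i, false); have := ale (i, true); rewrite /a/=.
have p1 : 0 <= T * S by rewrite mulr_ge0.
have p2 : 0 <= T * (2 * K ^+ 2 * CL * Cs) * S by rewrite !mulr_ge0// sqr_ge0.
have p3 : 0 <= T * F by rewrite mulr_ge0.
set Q := 2 * K ^+ 2 * CL * Cs in p2 *; move: p1 p2 p3 S0 F0.
move: (norm1 _) (norm1 _) => n1 n2; clearbody Q S F T; clear => p1 p2 p3 S0 F0 h1 h2.
have -> : (2 * T * (1 + Q) + 1) * (F + S) =
  2 * (T * F) + 2 * (T * S) + 2 * (T * Q * S) + 2 * (T * (Q * F)) + F + S by ring.
by move: h1 h2; rewrite mulrDr; lra.
Qed.

End BoundaryCondition.
End GraphOperators.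

(** * Energy identity and resolvents *)

Section ResolventSet.
Variables (R : realType) (I : finType) (l : I -> \bar R) (B : I -> R -> R) (z : R[i]).
Local Notation mu := (@lebesgue_measure R).
Hypothesis l0 : forall i, (0 < l i)%E.
Hypothesis pB : forall i, potential (l i) (B i).
Implicit Types (f psi : gfun R I).

(* Green's formula applied to [psi] and its conjugate, imaginary part. *)
Lemma energy f psi psi1 : gL2 l f -> graph_solution l B z f psi psi1 ->
  Im z * sqnorm l psi =
  \sum_h wronskian (graph_value l psi h) (graph_derivative l psi1 h) -
  \sum_i \int[mu]_(x in interval_of (l i)) wronskian (psi i x) (f i x).
Proof.
move=> hf sol; rewrite /sqnorm mulr_sumr.
rewrite (eq_bigr (fun p => wronskian (graph_value l psi (p.1, p.2)) (graph_derivative l psi1 (p.1, p.2)))); last by case.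
rewrite -(pair_bigA _ (fun i b => wronskian (graph_value l psi (i, b)) (graph_derivative l psi1 (i, b))))/=.
rewrite -sumrB; apply: eq_bigr => i _.
exact: (green (l0 i) (pB i) (hf i) (sol i)).
Qed.

Lemma L2_sqmod f i : gL2 l f -> L1 (interval_of (l i)) (fun x => sqmod (f i x)).
Proof. by move=> hf; exact: inL2_sqmod. Qed.

(** [wronskian_le] with weight [|Im z|] absorbs half of the left-hand side, which doubles the
    boundary term. *)
Lemma energy_le f psi psi1 : Im z != 0 -> gL2 l f -> graph_solution l B z f psi psi1 ->
  `|Im z| * sqnorm l psi <=
  2 * `|\sum_h wronskian (graph_value l psi h) (graph_derivative l psi1 h)| +
  `|Im z|^-1 * sqnorm l f.
Proof.
move=> z0 hf sol; set y := `|Im z|; have y0 : 0 < y by rewrite normr_gt0.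
have hpsi : gL2 l psi by move=> i; have [] := sol i.
have := congr1 Num.norm (energy hf sol).
rewrite normrM (ger0_norm (sqnorm_ge0 _ _)) -/y => E.
set W := \sum_h _ in E *; set V := \sum_i _ in E.
have hV : `|V| <= y / 2 * sqnorm l psi + (2 * y)^-1 * sqnorm l f.
  rewrite /sqnorm !mulr_sumr -big_split/= (le_trans (ler_norm_sum _ _ _))//.
  apply: ler_sum => i _; have mI := measurable_interval (l i).
  have h1 := L2_sqmod i hpsi; have h2 := L2_sqmod i hf.
  rewrite -!RintegralZl// -RintegralD//; [|exact: L1Z|exact: L1Z].
  apply: integral_abs_le => //.
  - exact: wronskian_L1.
  - by apply: L1D => //; exact: L1Z.
  - by move=> x _; exact: wronskian_le.
have : y * sqnorm l psi <= `|W| + (y / 2 * sqnorm l psi + (2 * y)^-1 * sqnorm l f).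
  by rewrite E (le_trans (ler_normB _ _))// lerD2l.
have -> : (2 * y)^-1 * sqnorm l f = y^-1 * sqnorm l f / 2 by field; rewrite gt_eqF.
have -> : y / 2 * sqnorm l psi = y * sqnorm l psi / 2 by ring.
move: (y * sqnorm l psi) (y^-1 * sqnorm l f) `|W| => p q r; lra.
Qed.

Lemma ae_imp (P Q : R -> Prop) : {ae mu, forall x, P x} -> (forall x, P x -> Q x) ->
  {ae mu, forall x, Q x}.
Proof.
move=> [N [mN N0 sN]] PQ; exists N; split => // x /= nQ.
by apply: sN => /= p; exact: nQ (PQ _ p).
Qed.

Lemma ae_imp2 (P Q S : R -> Prop) : {ae mu, forall x, P x} -> {ae mu, forall x, Q x} ->
  (forall x, P x -> Q x -> S x) -> {ae mu, forall x, S x}.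
Proof.
move=> hP hQ PQS; have : mu.-negligible (~` P `|` ~` Q) by exact: negligibleU.
move=> [N [mN N0 sN]]; exists N; split => // x /= nS.
apply: sN; have [p|np] := pselect (P x); last by left.
by right => q; exact: nS (PQS _ p q).
Qed.

Lemma ae_eq_integral_interval (k : \bar R) (g h : R -> R) x : (x%:E <= k)%E ->
  measurable_fun (interval_of k : set (measurableTypeR R)) g ->
  measurable_fun (interval_of k : set (measurableTypeR R)) h ->
  {ae mu, forall t, interval_of k t -> g t = h t} ->
  \int[mu]_(t in `[0, x]) g t = \int[mu]_(t in `[0, x]) h t.
Proof.
move=> xk mg mh ae; congr fine.
have s := sub_interval xk; have mI := measurable_interval k.
apply: ae_eq_integral => //.
- by apply/measurable_EFinP; exact: measurable_funS mg.
- by apply/measurable_EFinP; exact: measurable_funS mh.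
- by apply: ae_imp ae _ => t gh /s /gh /= ->.
Qed.

(** The second derivative is determined up to a null set and acts through its primitive, so it may
    be replaced by the expression the equation gives. From here on no almost everywhere statement is
    left in the equation. *)
Lemma solves_graph_solution (bc : gfun R I -> gfun R I -> Prop) f psi : gL2 l f ->
  solves l (schrodinger l B bc) z f psi <->
  exists psi1, graph_solution l B z f psi psi1 /\ bc psi psi1.
Proof.
move=> hf; split=> [[g [psi1 [psi2 [h2 hbc gE]]] fE]|[psi1 [sol hbc]]].
  exists psi1; split => // i; have [p0 p1 p2 q1 q2] := h2 i; split => //.
  have hw : inL2 (l i) (fun x => ((B i x)%:C - z) * psi i x - f i x).
    by apply: inL2_ext (inL2_lin (-1) (inL2_potential z (pB i) p0) (hf i)) => x _; rewrite mulN1r.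
  have ae : {ae mu, forall t, interval_of (l i) t ->
      psi2 i t = ((B i t)%:C - z) * psi i t - f i t}.
    apply: (ae_imp2 (fE i) (gE i)) => t h h' It.
    have gt : g i t = - psi2 i t + (B i t)%:C * psi i t := h' It.
    by rewrite -(h It) gt; ring.
  move=> x Ix; rewrite (q2 x Ix); congr (_ + _).
  have [_ xl] := Ix.
  move/inL2P: hw => [[m1 _] [m2 _]]; move/inL2P: p2 => [[m3 _] [m4 _]].
  congr (_ +i* _); apply: (ae_eq_integral_interval xl) => //.
    by apply: (ae_imp ae) => t h It; rewrite h.
  by apply: (ae_imp ae) => t h It; rewrite h.
exists (fun i x => - (((B i x)%:C - z) * psi i x - f i x) + (B i x)%:C * psi i x).
  exists psi1, (fun i x => ((B i x)%:C - z) * psi i x - f i x); split => //.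
    move=> i; have [p0 p1 q1 q2] := sol i; split => //.
    exact: rhs_inL2 (pB i) (hf i) (sol i).
  by move=> i; apply: aeW => x _.
by move=> i; apply: aeW => x _; ring.
Qed.

Section SelfAdjoint.
Local Notation ends := (I * bool)%type.
Variable L : (ends -> R[i]) -> (ends -> R[i]) -> ends -> R[i].
Hypothesis L_lin : forall s x y x' y' h,
  L (fun k => x k + s * x' k) (fun k => y k + s * y' k) h = L x y h + s * L x' y' h.
Hypothesis L_fictitious : forall i x y, l i = +oo%E -> L x y (i, true) = x (i, true).
(** Symmetry of the operator, expressed on boundary data: the boundary term of the energy identity
    vanishes under the conditions. Existence then follows from uniqueness through the square
    system. *)
Hypothesis L_isotropic : forall x y, (forall h, L x y h = 0) ->
  \sum_h wronskian (x h) (y h) = 0.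
Hypothesis z0 : Im z != 0.

Lemma sqnorm_le_resolvent f psi psi1 : gL2 l f -> graph_solution l B z f psi psi1 ->
  (forall h, residual l L psi psi1 h = 0) ->
  sqnorm l psi <= (`|Im z|^-1) ^+ 2 * sqnorm l f.
Proof.
move=> hf sol /L_isotropic hL; have := energy_le z0 hf sol.
rewrite hL normr0 mulr0 add0r => h.
have y0 : 0 < `|Im z| by rewrite normr_gt0.
by rewrite expr2 -mulrA ler_pdivlMl.
Qed.

(** The energy identity forces the L^2 norm to vanish, and a trace estimate on an initial segment of
    each edge passes this on to the initial data. *)
Lemma isotropic_unique psi psi1 : graph_solution l B z (fun _ _ => 0) psi psi1 ->
  (forall h, residual l L psi psi1 h = 0) -> forall i, psi i 0 = 0 /\ psi1 i 0 = 0.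
Proof.
move=> sol hL i.
have z_ : gL2 l (fun (_ : I) (_ : R) => 0 : R[i]) by move=> j; exact: inL2_0.
have := sqnorm_le_resolvent z_ sol hL.
have -> : sqnorm l (fun (_ : I) (_ : R) => 0 : R[i]) = 0.
  rewrite /sqnorm big1// => j _; under eq_Rintegral do rewrite sqmod0.
  by rewrite Rintegral_cst ?mul0r//; exact: measurable_interval.
rewrite mulr0 => n0.
have [X X0 Xl] := ge0_finite_length (l0 i).
have [_ [M BM]] := pB i; have s := sub_interval Xl.
have sol0 := edge_solution_restrict Xl (sol i).
apply: (edge_solution_zero X0 (potential_restrict Xl (pB i)) _ sol0).
  by move=> x; rewrite interval_of_fin => /s; exact: BM.
apply/eqP; rewrite eq_le Rintegral_ge0 ?andbT; last by move=> x _; exact: sqmod_ge0.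
apply: le_trans n0; apply: le_trans (sqnorm_edge l psi i).
apply: Rintegral_subset => //; first exact: measurable_interval.
  by move=> x _; exact: sqmod_ge0.
by have [h _ _ _] := sol i; exact: inL2_sqmod.
Qed.

Variable bc : gfun R I -> gfun R I -> Prop.
Hypothesis bcP : forall psi psi1, bc psi psi1 <-> forall h, residual l L psi psi1 h = 0.

Lemma schrodinger_resolvent_set : in_resolvent_set l (schrodinger l B bc) z.
Proof.
split=> [f hf|f psi phi hf|].
- have [psi [psi1 [sol hL]]] := graph_solution_exists l0 pB L_lin L_fictitious
    isotropic_unique (fun _ _ => z0) hf.
  by exists psi; apply/solves_graph_solution => //; exists psi1; split => //; apply/bcP.
- move=> /(solves_graph_solution _ _ hf)[psi1 [sol /bcP hL]].
  move=> /(solves_graph_solution _ _ hf)[phi1 [sol' /bcP hL']] i.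
  apply: aeW => x Ix.
  have sold : graph_solution l B z (fun _ _ => 0) (fun i x => psi i x + (-1) * phi i x)
      (fun i x => psi1 i x + (-1) * phi1 i x).
    move=> j; apply: edge_solution_ext_rhs (graph_solution_lin pB (-1) hf hf sol sol' j) => y _.
    by rewrite mulN1r subrr.
  have hd h : residual l L (fun i x => psi i x + (-1) * phi i x)
      (fun i x => psi1 i x + (-1) * phi1 i x) h = 0.
    by rewrite residual_lin// hL hL' mulr0 addr0.
  have [d0 d10] := isotropic_unique sold hd i.
  have [] := edge_solution_eq0 pB (sold i) d0 d10 Ix.
  by rewrite mulN1r => /eqP; rewrite subr_eq0 => /eqP.
- exists `|Im z|^-1 => f psi hf /(solves_graph_solution _ _ hf)[psi1 [sol /bcP hL]].
  by apply: L2norm_le; [rewrite invr_ge0|exact: sqnorm_le_resolvent sol hL].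
Qed.

(** The set in which [resolvent] chooses is inhabited, so the chosen element is a genuine solution
    rather than the default 0. *)
Lemma resolvent_solution f : gL2 l f -> exists psi1,
  graph_solution l B z f (resolvent l (schrodinger l B bc) z f) psi1 /\
  bc (resolvent l (schrodinger l B bc) z f) psi1.
Proof.
move=> hf; have [ex _ _] := schrodinger_resolvent_set; have [psi hpsi] := ex f hf.
apply/(solves_graph_solution _ _ hf).
exact: (@xgetPex _ (fun _ _ => 0) [set psi | solves l (schrodinger l B bc) z f psi] (ex_intro _ psi hpsi)).
Qed.

End SelfAdjoint.
End ResolventSet.

(** * Vertex conditions as one equation for each edge end *)

Section VertexResiduals.
Variable R : realType.

Lemma Re_conj (x : R[i]) : Re (Num.conj x) = Re x. Proof. by case: x. Qed.
Lemma Im_conj (x : R[i]) : Im (Num.conj x) = - Im x. Proof. by case: x. Qed.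

Variable n : nat.
Implicit Types (P Th : 'M[R[i]]_n) (X Y : 'cV[R[i]]_n).

(* The two parts of a vertex condition lie in Ker P and Ran P, so their sum
   vanishes only if both do. *)
Definition vertex_residual P Th X Y : 'cV[R[i]]_n :=
  (1%:M - P) *m X + P *m Y - Th *m (P *m X).

Lemma vertex_residual_eq0 P Th X Y : P *m P = P -> P *m Th *m P = Th ->
  vertex_residual P Th X Y = 0 <-> vertex_condition P Th X Y.
Proof.
move=> PP PThP; split=> [r0|[h1 h2]]; last first.
  by rewrite /vertex_residual -addrA h1 h2 addr0.
have PTh : P *m Th = Th by rewrite -PThP !mulmxA PP.
have h2 : P *m Y - Th *m (P *m X) = 0.
  have := congr1 (mulmx P) r0; rewrite mulmx0 /vertex_residual mulmxBr mulmxDr.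
  by rewrite !mulmxA PTh mulmxBr mulmx1 PP subrr mul0mx add0r.
by split => //; move: r0; rewrite /vertex_residual -addrA h2 addr0.
Qed.

Lemma vertex_residual_lin P Th X Y X' Y' s :
  vertex_residual P Th (X + s *: X') (Y + s *: Y') =
  vertex_residual P Th X Y + s *: vertex_residual P Th X' Y'.
Proof.
rewrite /vertex_residual !mulmxDr -!scalemxAr scalerBr scalerDr.
by rewrite [X in X - _ = _]addrACA opprD [LHS]addrACA.
Qed.

Lemma wronskian_sum X Y :
  \sum_k wronskian (X k 0) (Y k 0) = Im (((map_mx Num.conj X)^T *m Y) 0 0).
Proof.
rewrite mxE; elim/big_ind2: _ => // [a b c d -> ->|k _]; first by rewrite ImD.
by rewrite !mxE ImM Re_conj Im_conj /wronskian mulNr.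
Qed.

(** The condition says [X = P X] and [P Y = Th X], so [X^* Y = X^* Th X], which is real because [Th]
    is self-adjoint. *)
Lemma vertex_condition_isotropic P Th X Y : is_orthoproj P -> is_selfadj_in P Th ->
  vertex_condition P Th X Y -> \sum_k wronskian (X k 0) (Y k 0) = 0.
Proof.
move=> [PP aP] [PThP aTh] [h1 h2].
have XP : P *m X = X.
  by move: h1; rewrite mulmxBl mul1mx => /eqP; rewrite subr_eq0 => /eqP.
have PY : P *m Y = Th *m X by move: h2; rewrite XP => /eqP; rewrite subr_eq0 => /eqP.
rewrite wronskian_sum.
have aXP : (map_mx Num.conj X)^T *m P = (map_mx Num.conj X)^T.
  by rewrite -{1}aP /adjoint -trmx_mul -map_mxM XP.
rewrite -aXP -mulmxA PY.
set M := _ *m _.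
have E : (map_mx Num.conj M)^T = M.
  rewrite /M map_mxM trmx_mul map_mxM trmx_mul -/(adjoint Th) aTh.
  have -> : (map_mx Num.conj (map_mx Num.conj X)^T)^T = X.
    by apply/matrixP => i j; rewrite !mxE conjCK.
  by rewrite mulmxA.
have : Num.conj (M 0 0) = M 0 0 by rewrite -{2}E !mxE.
by move=> /(congr1 (@complex.Im R)); rewrite Im_conj; lra.
Qed.

Lemma entry_lin X Y (s : R[i]) i : (X + s *: Y) i 0 = X i 0 + s * Y i 0.
Proof. by rewrite !mxE. Qed.

Lemma kirchhoffE X Y : kirchhoff X Y <-> vertex_condition (Kproj R n) 0 X Y.
Proof. by rewrite /kirchhoff /vertex_condition mul0mx subr0. Qed.

Lemma Kproj_orthoproj : is_orthoproj (Kproj R n).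
Proof.
split; apply/matrixP => i j; rewrite !mxE; last by rewrite fmorphV rmorph_nat.
rewrite (eq_bigr (fun _ => (n%:R^-1 * n%:R^-1 : R[i]))); last by move=> k _; rewrite !mxE.
rewrite sumr_const card_ord -[LHS]mulr_natl mulrA divff ?mul1r//.
by rewrite pnatr_eq0 -lt0n; case: n i j => [[]|].
Qed.

Lemma selfadj0 P : is_selfadj_in P 0.
Proof.
split; first by rewrite mulmx0 mul0mx.
by apply/matrixP => i j; rewrite !mxE rmorph0.
Qed.

End VertexResiduals.

Section VertexFamilies.
Variables (R : realType) (V E : finType) (endpt : E * bool -> V).

Lemma mem_ends (h : E * bool) : h \in ends endpt (endpt h).
Proof. by rewrite inE. Qed.

Definition end_rank (h : E * bool) : 'I_(deg endpt (endpt h)) :=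
  enum_rank_in (mem_ends h) h.

Definition at_vertex (x : E * bool -> R[i]) (v : V) : 'cV[R[i]]_(deg endpt v) :=
  \col_k x (enum_val k).

Lemma at_vertex_lin x x' (s : R[i]) v :
  at_vertex (fun k => x k + s * x' k) v = at_vertex x v + s *: at_vertex x' v.
Proof. by apply/colP => k; rewrite !mxE. Qed.

(** [end_rank] inverts [enum_val], so the vertex vectors, whose sizes vary with the vertex, amount
    to one scalar per edge end. *)
Lemma end_rank_eq0 (G : forall v, 'cV[R[i]]_(deg endpt v)) v :
  (forall h, endpt h = v -> G (endpt h) (end_rank h) 0 = 0) <-> G v = 0.
Proof.
split=> [H|G0 h hv]; last first.
  by move: (end_rank h); rewrite hv G0 => k; rewrite mxE.
apply/colP => k; rewrite mxE.
have hv : endpt (enum_val k) = v by have := enum_valP k; rewrite inE => /eqP.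
rewrite -(H _ hv) /end_rank.
move: (mem_ends (enum_val k)).
rewrite hv => m; congr (G v _ _).
by rewrite enum_valK_in.
Qed.

Lemma sum_ends (F : E * bool -> R) :
  \sum_h F h = \sum_v \sum_(k < deg endpt v) F (enum_val k).
Proof.
rewrite (partition_big endpt xpredT)//=; apply: eq_bigr => v _.
rewrite -(big_enum_val F)/=.
by apply: eq_bigl => h; rewrite inE.
Qed.

Lemma at_vertex_wronskian (x y : E * bool -> R[i]) v :
  \sum_(k < deg endpt v) wronskian (x (enum_val k)) (y (enum_val k)) =
  \sum_k wronskian (at_vertex x v k 0) (at_vertex y v k 0).
Proof. by apply: eq_bigr => k _; rewrite !mxE. Qed.

Lemma bvalsE (len : E -> R) (psi : gfun R E) v :
  bvals endpt len psi v = at_vertex (graph_value (fun e => (len e)%:E) psi) v.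
Proof. by apply/colP => k; rewrite !mxE /graph_value; case: (enum_val k) => e []. Qed.

Lemma bdersE (len : E -> R) (psi1 : gfun R E) v :
  bders endpt len psi1 v = at_vertex (graph_derivative (fun e => (len e)%:E) psi1) v.
Proof. by apply/colP => k; rewrite !mxE /graph_derivative; case: (enum_val k) => e []. Qed.

End VertexFamilies.

Lemma vertex_residual_eq0_kirchhoff (R : realType) n (X Y : 'cV[R[i]]_n) :
  vertex_residual (Kproj R n) 0 X Y = 0 <-> kirchhoff X Y.
Proof.
rewrite kirchhoffE; apply: vertex_residual_eq0; first by have [] := Kproj_orthoproj R n.
by rewrite mulmx0 mul0mx.
Qed.

Section InnerGraph.
Variables (R : realType) (V E : finType) (endpt : E * bool -> V) (len : E -> R).
Variables (N : nat) (c : 'I_N -> V).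
Variables (Pin Thin : forall v, 'M[R[i]]_(deg endpt v)).
Hypothesis HPin : forall v, v \notin codom c -> is_orthoproj (Pin v).
Hypothesis HThin : forall v, v \notin codom c -> is_selfadj_in (Pin v) (Thin v).
Local Notation ends := (E * bool)%type.

Definition inner_residual (x y : ends -> R[i]) (v : V) : 'cV[R[i]]_(deg endpt v) :=
  if v \in codom c then vertex_residual (Kproj R _) 0 (at_vertex endpt x v) (at_vertex endpt y v)
  else vertex_residual (Pin v) (Thin v) (at_vertex endpt x v) (at_vertex endpt y v).

Definition inner_bc (x y : ends -> R[i]) (h : ends) : R[i] :=
  inner_residual x y (endpt h) (end_rank endpt h) 0.

Lemma inner_bc_lin s x y x' y' h :
  inner_bc (fun k => x k + s * x' k) (fun k => y k + s * y' k) h =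
  inner_bc x y h + s * inner_bc x' y' h.
Proof.
rewrite /inner_bc; set v := endpt h.
suff -> : inner_residual (fun k => x k + s * x' k) (fun k => y k + s * y' k) v =
    inner_residual x y v + s *: inner_residual x' y' v by exact: entry_lin.
rewrite /inner_residual !at_vertex_lin.
move: (at_vertex endpt x v) (at_vertex endpt x' v) (at_vertex endpt y v) (at_vertex endpt y' v).
move=> X X' Y Y'.
case: (v \in codom c).
exact: (vertex_residual_lin (Kproj R _) 0 X Y X' Y' s).
exact: (vertex_residual_lin (Pin v) (Thin v) X Y X' Y' s).
Qed.

Lemma inner_bcP (psi psi1 : gfun R E) :
  (bc_Vin len c Pin Thin psi psi1 /\
   forall j, kirchhoff (bvals endpt len psi (c j)) (bders endpt len psi1 (c j))) <->
  forall h, residual (fun e => (len e)%:E) inner_bc psi psi1 h = 0.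
Proof.
pose G := inner_residual (graph_value (fun e => (len e)%:E) psi)
                         (graph_derivative (fun e => (len e)%:E) psi1).
have GV v : v \notin codom c ->
    G v = 0 <-> vertex_condition (Pin v) (Thin v) (bvals endpt len psi v) (bders endpt len psi1 v).
  move=> vc; rewrite bvalsE bdersE /G /inner_residual (negbTE vc).
  by apply: vertex_residual_eq0; [have [] := HPin vc|have [] := HThin vc].
have GC j : G (c j) = 0 <-> kirchhoff (bvals endpt len psi (c j)) (bders endpt len psi1 (c j)).
  by rewrite bvalsE bdersE /G /inner_residual codom_f; exact: vertex_residual_eq0_kirchhoff.
split=> [[h1 h2] h|H].
  suff G0 v : G v = 0 by have [_ g] := end_rank_eq0 G (endpt h); exact: g.
  have [/codomP[j ->]|vc] := boolP (v \in codom c); first exact/GC.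
  exact/GV/h1.
have G0 v : G v = 0 by apply/end_rank_eq0 => h _; exact: H.
by split=> [v vc|j]; [exact/GV|exact/GC].
Qed.

End InnerGraph.

Section OuterEnds.
Variables (R : realType) (N : nat) (lout : 'I_N -> \bar R).
Variables (Pout Thout : 'I_N -> 'M[R[i]]_1).
Hypothesis lout_gt0 : forall j, (0 < lout j)%E.
Hypothesis HPout : forall j, lout j \is a fin_num -> is_orthoproj (Pout j).
Hypothesis HThout : forall j, lout j \is a fin_num -> is_selfadj_in (Pout j) (Thout j).

(** The second branch is the equation at the fictitious end of a half-line. *)
Definition free_end_bc (x y : R[i]) (j : 'I_N) : R[i] :=
  if lout j \is a fin_num then
    vertex_residual (Pout j) (Thout j) (const_mx x) (const_mx y) 0 0
  else x.

Lemma const_mx_lin (x x' s : R[i]) : const_mx (x + s * x') = const_mx x + s *: const_mx x' :> 'cV_1.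
Proof. by apply/colP => k; rewrite !mxE. Qed.

Lemma free_end_bc_lin s x y x' y' j :
  free_end_bc (x + s * x') (y + s * y') j = free_end_bc x y j + s * free_end_bc x' y' j.
Proof.
rewrite /free_end_bc; case: ifP => // _.
by rewrite !const_mx_lin vertex_residual_lin entry_lin.
Qed.

Lemma free_end_bc_isotropic x y j : free_end_bc x y j = 0 -> wronskian x y = 0.
Proof.
rewrite /free_end_bc; case: ifPn => [fj r0|_ ->]; last by rewrite /wronskian /= !mul0r subrr.
have vc : vertex_condition (Pout j) (Thout j) (const_mx x) (const_mx y).
  apply/vertex_residual_eq0; [by have [] := HPout fj|by have [] := HThout fj|].
  by apply/colP => k; rewrite (ord1 k) r0 mxE.
have := vertex_condition_isotropic (HPout fj) (HThout fj) vc.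
by rewrite big_ord1 !mxE.
Qed.

Lemma free_end_bcP (psi psi1 : gfun R 'I_N) :
  bc_Vout lout Pout Thout psi psi1 <->
  forall j, free_end_bc (end_value (lout j) (psi j) true) (end_derivative (lout j) (psi1 j) true) j = 0.
Proof.
have H j : (lout j \is a fin_num -> vertex_condition (Pout j) (Thout j)
      (const_mx (psi j (fine (lout j)))) (const_mx (- psi1 j (fine (lout j))))) <->
    free_end_bc (end_value (lout j) (psi j) true) (end_derivative (lout j) (psi1 j) true) j = 0.
  rewrite /free_end_bc /end_value /end_derivative.
  move: (lout_gt0 j) (@HPout j) (@HThout j); case: (lout j) => [r| |]//= _ /(_ isT)[PP _] /(_ isT)[PT _].
  split=> [/(_ isT) /vertex_residual_eq0 -> //|r0 _]; first by rewrite mxE.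
  by apply/vertex_residual_eq0 => //; apply/colP => k; rewrite (ord1 k) r0 mxE.
by split=> [h j|h j]; [apply/H; exact: h|apply/H].
Qed.

Definition outer_bc (x y : 'I_N * bool -> R[i]) (h : 'I_N * bool) : R[i] :=
  if h.2 then free_end_bc (x h) (y h) h.1 else x h.

Lemma outer_bc_lin s x y x' y' h :
  outer_bc (fun k => x k + s * x' k) (fun k => y k + s * y' k) h =
  outer_bc x y h + s * outer_bc x' y' h.
Proof. by rewrite /outer_bc; case: ifP => // _; exact: free_end_bc_lin. Qed.

Lemma outer_bc_fictitious j x y : lout j = +oo%E -> outer_bc x y (j, true) = x (j, true).
Proof. by rewrite /outer_bc /free_end_bc/= => ->. Qed.

Lemma outer_bc_isotropic x y : (forall h, outer_bc x y h = 0) ->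
  \sum_h wronskian (x h) (y h) = 0.
Proof.
move=> H; apply: big1 => -[j []] _; first exact: free_end_bc_isotropic (H (j, true)).
by have := H (j, false); rewrite /outer_bc/= => ->; rewrite /wronskian /= !mul0r subrr.
Qed.

Lemma outer_bcP (psi psi1 : gfun R 'I_N) :
  (bc_Vout lout Pout Thout psi psi1 /\ (\col_j psi j 0) = 0 :> 'cV[R[i]]_N) <->
  forall h, residual lout outer_bc psi psi1 h = 0.
Proof.
split=> [[/free_end_bcP h1 /colP h2] [j []]|H].
- exact: h1.
- by have := h2 j; rewrite !mxE.
split; first by apply/free_end_bcP => j; exact: (H (j, true)).
by apply/colP => j; rewrite !mxE; exact: (H (j, false)).
Qed.

End OuterEnds.

(** * Boundary conditions on the full graph *)

Section FullGraph.
Variables (R : realType) (V E : finType) (endpt : E * bool -> V) (len : E -> R).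
Variables (N : nat) (c : 'I_N -> V) (lout : 'I_N -> \bar R).
Variables (Pin Thin : forall v, 'M[R[i]]_(deg endpt v)).
Variables (Pout Thout : 'I_N -> 'M[R[i]]_1) (eps : R).
Hypothesis c_inj : injective c.
Hypothesis HPin : forall v, v \notin codom c -> is_orthoproj (Pin v).
Hypothesis HThin : forall v, v \notin codom c -> is_selfadj_in (Pin v) (Thin v).
Hypothesis lout_gt0 : forall j, (0 < lout j)%E.
Hypothesis HPout : forall j, lout j \is a fin_num -> is_orthoproj (Pout j).
Hypothesis HThout : forall j, lout j \is a fin_num -> is_selfadj_in (Pout j) (Thout j).
Local Notation I := ('I_N + E)%type.
Local Notation ends := (I * bool)%type.
Local Notation l := (lfull len lout eps).
Local Notation Theps := (@Thin_eps R V E endpt Thin eps).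

Definition inner_part (x : ends -> R[i]) (h : E * bool) : R[i] := x (inr h.1, h.2).

(** The vertex [v] is separate from [j], so that the vector keeps a meaning when [v] is [endpt h]
    and only propositionally equal to [c j]. *)
Definition connecting_vector (x : ends -> R[i]) (j : 'I_N) (v : V) : 'cV[R[i]]_(1 + deg endpt v) :=
  col_mx (const_mx (x (inl j, false)) : 'cV_1) (at_vertex endpt (inner_part x) v).

Definition connecting_residual (x y : ends -> R[i]) j v : 'cV[R[i]]_(1 + deg endpt v) :=
  vertex_residual (Kproj R _) 0 (connecting_vector x j v) (connecting_vector y j v).

Definition full_inner_residual (x y : ends -> R[i]) (v : V) : 'cV[R[i]]_(deg endpt v) :=
  if [pick j | c j == v] is Some j then dsubmx (connecting_residual x y j v)
  else vertex_residual (Pin v) (Theps v)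
         (at_vertex endpt (inner_part x) v) (at_vertex endpt (inner_part y) v).

(** The Kirchhoff residual at a connecting vertex has [1 + deg] entries. The first is assigned to
    the end [x = 0] of the outer edge, the others to the inner ends, so each end of the full graph
    carries exactly one equation. *)
Definition full_bc (x y : ends -> R[i]) (h : ends) : R[i] :=
  match h with
  | (inl j, false) => usubmx (connecting_residual x y j (c j)) 0 0
  | (inl j, true) => free_end_bc lout Pout Thout (x h) (y h) j
  | (inr e, b) => full_inner_residual x y (endpt (e, b)) (end_rank endpt (e, b)) 0
  end.

Lemma connecting_vector_lin s x x' j v :
  connecting_vector (fun k => x k + s * x' k) j v =
  connecting_vector x j v + s *: connecting_vector x' j v.
Proof.
rewrite /connecting_vector scale_col_mx add_col_mx -const_mx_lin.
by rewrite -(at_vertex_lin endpt (inner_part x) (inner_part x') s v).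
Qed.

Lemma connecting_residual_lin s x y x' y' j v :
  connecting_residual (fun k => x k + s * x' k) (fun k => y k + s * y' k) j v =
  connecting_residual x y j v + s *: connecting_residual x' y' j v.
Proof.
rewrite /connecting_residual !connecting_vector_lin.
move: (connecting_vector x j v) (connecting_vector x' j v).
move: (connecting_vector y j v) (connecting_vector y' j v) => Y Y' X X'.
exact: (vertex_residual_lin (Kproj R _) 0 X Y X' Y' s).
Qed.

Lemma dsubmx_lin n (A A' : 'cV[R[i]]_(1 + n)) (s : R[i]) :
  dsubmx (A + s *: A') = dsubmx A + s *: dsubmx A'.
Proof. by apply/colP => k; rewrite !mxE. Qed.

Lemma usubmx_lin n (A A' : 'cV[R[i]]_(1 + n)) (s : R[i]) :
  usubmx (A + s *: A') = usubmx A + s *: usubmx A'.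
Proof. by apply/colP => k; rewrite !mxE. Qed.

Lemma full_inner_residual_lin s x y x' y' v :
  full_inner_residual (fun k => x k + s * x' k) (fun k => y k + s * y' k) v =
  full_inner_residual x y v + s *: full_inner_residual x' y' v.
Proof.
rewrite /full_inner_residual; case: [pick j | c j == v] => [j|].
  by rewrite connecting_residual_lin dsubmx_lin.
have lin (u u' : ends -> R[i]) : at_vertex endpt (inner_part (fun k => u k + s * u' k)) v =
  at_vertex endpt (inner_part u) v + s *: at_vertex endpt (inner_part u') v.
  exact: at_vertex_lin.
rewrite !lin.
move: (at_vertex endpt (inner_part x) v) (at_vertex endpt (inner_part x') v).
move: (at_vertex endpt (inner_part y) v) (at_vertex endpt (inner_part y') v) => Y Y' X X'.
exact: (vertex_residual_lin (Pin v) (Theps v) X Y X' Y' s).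
Qed.

Lemma full_bc_lin s x y x' y' h :
  full_bc (fun k => x k + s * x' k) (fun k => y k + s * y' k) h =
  full_bc x y h + s * full_bc x' y' h.
Proof.
case: h => [[j|e] b]; last by rewrite /full_bc full_inner_residual_lin entry_lin.
case: b; first exact: free_end_bc_lin.
by rewrite /full_bc connecting_residual_lin usubmx_lin entry_lin.
Qed.

Lemma full_bc_fictitious i x y : l i = +oo%E -> full_bc x y (i, true) = x (i, true).
Proof. by case: i => [j|e]//= lj; rewrite /free_end_bc lj. Qed.

Lemma selfadj_eps v : v \notin codom c -> is_selfadj_in (Pin v) (Theps v).
Proof.
move=> vc; have [PTP aT] := HThin vc; split.
  by rewrite /Thin_eps -scalemxAr -scalemxAl PTP.
rewrite /Thin_eps -{2}aT; apply/matrixP => i j; rewrite !mxE rmorphM; congr (_ * _).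
by apply: eq_ReIm; rewrite ?Re_conj// Im_conj/= oppr0.
Qed.

Lemma pick_connecting j : [pick j' | c j' == c j] = Some j.
Proof. by case: pickP => [j' /eqP/c_inj->|/(_ j)]//; rewrite eqxx. Qed.

Lemma pick_notin v : v \notin codom c -> [pick j | c j == v] = None.
Proof. by move=> vc; case: pickP => // j /eqP jv; rewrite -jv codom_f in vc. Qed.

Section Residuals.
Variables x y : ends -> R[i].

Lemma full_bc_eq0 : (forall h, full_bc x y h = 0) <->
  [/\ forall v, v \notin codom c -> vertex_condition (Pin v) (Theps v)
          (at_vertex endpt (inner_part x) v) (at_vertex endpt (inner_part y) v),
      forall j, free_end_bc lout Pout Thout (x (inl j, true)) (y (inl j, true)) j = 0 &
      forall j, kirchhoff (connecting_vector x j (c j)) (connecting_vector y j (c j))].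
Proof.
have GV v : v \notin codom c -> full_inner_residual x y v = 0 <->
    vertex_condition (Pin v) (Theps v)
          (at_vertex endpt (inner_part x) v) (at_vertex endpt (inner_part y) v).
  move=> vc; rewrite /full_inner_residual pick_notin//.
  by apply: vertex_residual_eq0; [have [] := HPin vc|have [] := selfadj_eps vc].
have GC j : (usubmx (connecting_residual x y j (c j)) 0 0 = 0 /\
    full_inner_residual x y (c j) = 0) <->
    kirchhoff (connecting_vector x j (c j)) (connecting_vector y j (c j)).
  rewrite -vertex_residual_eq0_kirchhoff -/(connecting_residual x y j (c j)).
  rewrite /full_inner_residual pick_connecting.
  split=> [[h1 h2]|->]; last by split; [rewrite !mxE|apply/colP => k; rewrite !mxE].
  rewrite -[LHS]vsubmxK h2 (_ : usubmx _ = 0) ?col_mx0//.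
  by apply/colP => k; rewrite (ord1 k) h1 mxE.
split=> [H|[h1 h2 h3] [[j|e] b]].
- have G0 v : full_inner_residual x y v = 0.
    by apply/end_rank_eq0 => -[e b] _; exact: (H (inr e, b)).
  split=> [v vc|j|j]; [exact/GV|exact: (H (inl j, true))|].
  by apply/GC; split => //; exact: (H (inl j, false)).
- by case: b; [exact: h2|have [_ /(_ (h3 j))[]] := GC j].
- suff G0 v : full_inner_residual x y v = 0.
    by have [_ g] := end_rank_eq0 (full_inner_residual x y) (endpt (e, b)); exact: g.
  have [/codomP[j ->]|vc] := boolP (v \in codom c); last exact/GV/h1.
  by have [_ /(_ (h3 j))[]] := GC j.
Qed.

(** The sum over ends is regrouped by vertices, the end [x = 0] of the outer edge [j] being counted
    with [c j]; each group vanishes by the vertex condition there. *)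
Lemma full_bc_isotropic : (forall h, full_bc x y h = 0) ->
  \sum_h wronskian (x h) (y h) = 0.
Proof.
move=> /full_bc_eq0[h1 h2 h3].
pose W h := wronskian (x h) (y h).
have -> : \sum_h wronskian (x h) (y h) =
    \sum_j (W (inl j, true) + W (inl j, false)) + \sum_(h : E * bool) W (inr h.1, h.2).
  rewrite (eq_bigr (fun p => W (p.1, p.2))); last by case.
  rewrite -(pair_bigA _ (fun i b => W (i, b)))/= big_sumType/=.
  congr (_ + _); first by apply: eq_bigr => j _; rewrite big_bool.
  by rewrite -(pair_bigA _ (fun e b => W (inr e, b))).
rewrite (sum_ends endpt).
pose S v := \sum_(k < deg endpt v) W (inr (enum_val k).1, (enum_val k).2).
rewrite -/S.
have S0 v : v \notin codom c -> S v = 0.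
  move=> vc; have := vertex_condition_isotropic (HPin vc) (selfadj_eps vc) (h1 v vc).
  by rewrite -at_vertex_wronskian.
(* The connecting vertices are distinct and the other vertices contribute 0, so the sum over
   vertices is a sum over [j]. *)
have -> : \sum_v \sum_(k < deg endpt v) W (inr (enum_val k).1, (enum_val k).2) = \sum_j S (c j).
  transitivity (\sum_j \sum_v (if c j == v then S v else 0)); last first.
    by apply: eq_bigr => j _; rewrite -big_mkcond (big_pred1 (c j))// => v; rewrite eq_sym.
  rewrite exchange_big; apply: eq_bigr => v _; rewrite -/(S v).
  have [/codomP[j vj]|vc] := boolP (v \in codom c); last first.
    by rewrite S0// big1// => j _; case: ifP.
  rewrite vj (bigD1 j)//= eqxx big1 ?addr0// => j' jj'.
  by case: eqP => // /c_inj e; rewrite e eqxx in jj'.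
rewrite -big_split/= big1// => j _.
have := free_end_bc_isotropic HPout HThout (h2 j); rewrite -/(W (inl j, true)) => ->.
have := vertex_condition_isotropic (Kproj_orthoproj R _) (selfadj0 _) ((kirchhoffE _ _).1 (h3 j)).
rewrite big_split_ord/= big_ord1 /connecting_vector !col_mxEu ![const_mx _ _ _]mxE add0r => hk.
rewrite -[RHS]hk; congr (_ + _); rewrite /S (at_vertex_wronskian endpt (inner_part x) (inner_part y)).
by apply: eq_bigr => k _; rewrite !col_mxEd.
Qed.

End Residuals.
End FullGraph.

(** * Convergence of the resolvent *)

Section EdgeScaling.
Variable R : realType.

Lemma Re_real (r : R) (w : R[i]) : Re (r%:C * w) = r * Re w.
Proof. by rewrite ReM/= mul0r subr0. Qed.

Lemma Im_real (r : R) (w : R[i]) : Im (r%:C * w) = r * Im w.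
Proof. by rewrite ImM/= mul0r addr0. Qed.

Lemma inL2_scale (k X : R) (f : R -> R[i]) : 0 < k -> inL2 (k * X)%:E f ->
  inL2 X%:E (fun x => f (k * x)).
Proof.
move=> k0 /inL2P; rewrite interval_of_fin => -[[m1 h1] [m2 h2]].
apply/inL2P; rewrite interval_of_fin; split; split.
- exact: (@measurable_scale R k X k0 (fun x => Re (f x))).
- exact: (@L1_scale R k X k0 (fun x => Re (f x) ^+ 2)).
- exact: (@measurable_scale R k X k0 (fun x => Im (f x))).
- exact: (@L1_scale R k X k0 (fun x => Im (f x) ^+ 2)).
Qed.

Lemma inL2_real_scale (l : \bar R) (r : R) (f : R -> R[i]) : inL2 l f ->
  inL2 l (fun x => r%:C * f x).
Proof.
by move=> hf; apply: inL2_ext (inL2_lin (r%:C) (inL2_0 l) hf) => x _; rewrite add0r.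
Qed.

Lemma primitive_of_mul (l : \bar R) (s : R[i]) (g f : R -> R[i]) : inL2 l g ->
  primitive_of l g f -> primitive_of l (fun x => s * g x) (fun x => s * f x).
Proof.
move=> hg h; have [_ _ p0 _] := @edge_solution_0 R l (fun=> 0) 0.
have := primitive_of_lin s (inL2_0 l) hg p0 h.
have E (v : R -> R[i]) : (fun x => 0 + s * v x) = (fun x => s * v x).
  by apply/funext => x; rewrite add0r.
by rewrite !E.
Qed.

Lemma primitive_scale (k X : R) (g f : R -> R[i]) : 0 < k -> inL2 (k * X)%:E g ->
  primitive_of (k * X)%:E g f ->
  primitive_of X%:E (fun x => k%:C * g (k * x)) (fun x => f (k * x)).
Proof.
move=> k0 hg pf x [x0 xX]; rewrite lee_fin in xX.
have kx : ((k * x)%:E <= (k * X)%:E)%E by rewrite lee_fin ler_pM2l.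
have [r i] := inL2_L1 kx hg.
have [r' i'] := (L1_scale k0 r, L1_scale k0 i).
rewrite pf; last by split; rewrite ?mulr_ge0// ltW.
rewrite mulr0; congr (_ + _); apply: eq_ReIm; rewrite /cintegral/=.
  rewrite (integral_scale k0 r) -RintegralZl//; apply: eq_Rintegral => t _.
  by rewrite Re_real.
rewrite (integral_scale k0 i) -RintegralZl//; apply: eq_Rintegral => t _.
by rewrite Im_real.
Qed.

Lemma potential_scale (k X : R) (B : R -> R) : 0 < k -> potential X%:E B ->
  potential (k * X)%:E (fun x => k ^- 2 * B (x / k)).
Proof.
rewrite /potential !interval_of_fin => k0 [mB [M BM]].
have X1 : X = k^-1 * (k * X) by rewrite mulKf// gt_eqF.
have ki : 0 < k^-1 by rewrite invr_gt0.
split.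
  apply: measurable_funM; first exact: measurable_cst.
  rewrite X1 in mB; have := measurable_scale ki mB.
  by apply: eq_measurable_fun => x _; rewrite mulrC.
exists (k ^- 2 * M) => x; rewrite /= in_itv/= => /andP[x0 xX].
rewrite normrM ger0_norm ?invr_ge0 ?sqr_ge0// ler_wpM2l ?invr_ge0 ?sqr_ge0//.
by apply: BM; rewrite /= in_itv/= ler_pdivrMr// (mulrC X k) xX andbT mulr_ge0// invr_ge0 ltW.
Qed.

(** Two derivatives produce [k ^+ 2], which cancels the factor [k ^- 2] of the potential. The
    spectral parameter becomes 0 and [z * u] joins the source. *)
Lemma edge_solution_scale (k X : R) (B : R -> R) z (f u u1 : R -> R[i]) : 0 < k ->
  potential X%:E B -> inL2 (k * X)%:E f ->
  edge_solution (k * X)%:E (fun x => k ^- 2 * B (x / k)) z f u u1 ->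
  edge_solution X%:E B 0 (fun x => (k ^+ 2)%:C * (z * u (k * x) + f (k * x)))
    (fun x => u (k * x)) (fun x => k%:C * u1 (k * x)).
Proof.
move=> k0 pB hf sol; have hw := rhs_inL2 (potential_scale k0 pB) hf sol.
have [hu hu1 pu pu1] := sol; split.
- exact: inL2_scale.
- by apply: inL2_real_scale; exact: inL2_scale.
- exact: primitive_scale.
have := primitive_scale k0 hw pu1.
move/(primitive_of_mul (k%:C) (inL2_real_scale k (inL2_scale k0 hw))).
apply: primitive_of_ext => x _.
have kC : k%:C != 0 :> R[i] by rewrite fmorph_eq0 gt_eqF.
have -> : k * x / k = x by rewrite mulrAC divff ?mul1r// gt_eqF.
rewrite rmorphM fmorphV rmorphXn.
by field.
Qed.

End EdgeScaling.

Lemma bounded_potential_edge (R : realType) (I : Type) (l : I -> \bar R) (B : I -> R -> R) :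
  bounded_potential l B -> forall i, potential (l i) (B i).
Proof. by move=> [mB [M BM]] i; split; [exact: mB|exists M; exact: BM]. Qed.

Section ScaledSource.
Variable R : realType.
Local Notation mu := (@lebesgue_measure R).

Lemma kirchhoff_entries n (X Y : 'cV[R[i]]_n) : kirchhoff X Y ->
  (forall i k, X i 0 = X k 0) /\ \sum_i Y i 0 = 0.
Proof.
have KE (Z : 'cV[R[i]]_n) i : (Kproj R n *m Z) i 0 = n%:R^-1 * \sum_k Z k 0.
  by rewrite mxE mulr_sumr; apply: eq_bigr => k _; rewrite mxE.
move=> [h1 h2]; split=> [i k|].
  have XK : X = Kproj R n *m X.
    by move: h1; rewrite mulmxBl mul1mx => /eqP; rewrite subr_eq0 => /eqP.
  by rewrite XK !KE.
case: n X Y KE h1 h2 => [|n] X Y KE _ h2; first by rewrite big_ord0.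
have := congr1 (fun Z : 'cV_n.+1 => Z 0 0) h2; rewrite KE mxE => /eqP.
by rewrite mulf_eq0 invr_eq0 pnatr_eq0/= => /eqP.
Qed.

Lemma norm1_real (r : R) (w : R[i]) : norm1 (r%:C * w) = `|r| * norm1 w.
Proof. by rewrite /norm1 Re_real Im_real !normrM mulrDr. Qed.

Lemma norm1_L2 (X : R) (f : R -> R[i]) : inL2 X%:E f -> L2 `[0, X] (fun x => norm1 (f x)).
Proof.
move=> hf; have m := L1_measurable (norm1_L1 hf); split => //.
have hs := inL2_sqmod hf; rewrite interval_of_fin in hs.
apply: (@L1_le _ _ _ _ (fun x => 2 * sqmod (f x))) => //.
- exact: measurable_funX.
- by move=> x _; rewrite ger0_norm ?sqr_ge0// norm1_sqmod.
- exact: L1Z.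
Qed.

Lemma integral_norm1_le (X : R) (f : R -> R[i]) : 0 < X -> inL2 X%:E f ->
  \int[mu]_(x in `[0, X]) norm1 (f x) <=
  Num.sqrt (2 * X) * Num.sqrt (\int[mu]_(x in `[0, X]) sqmod (f x)).
Proof.
move=> X0 hf; have h2 := norm1_L2 hf.
have hs := inL2_sqmod hf; rewrite interval_of_fin in hs.
have S0 : 0 <= \int[mu]_(x in `[0, X]) sqmod (f x).
  by apply: Rintegral_ge0 => x _; exact: sqmod_ge0.
have n0 : 0 <= \int[mu]_(x in `[0, X]) norm1 (f x).
  by apply: Rintegral_ge0 => x _; exact: norm1_ge0.
have X20 : 0 <= 2 * X by rewrite mulr_ge0// ltW.
rewrite -sqrtrM// -[leLHS](ger0_norm n0) -sqrtr_sqr; apply: ler_wsqrtr.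
have := integral_abs_sqr X0 h2; rewrite subr0.
under eq_Rintegral do rewrite (ger0_norm (norm1_ge0 _)).
move=> /le_trans; apply; rewrite -mulrA mulrCA ler_wpM2l ?(ltW X0)//.
rewrite -RintegralZl//; apply: le_Rintegral => //; first exact: h2.2.
- exact: L1Z.
- by move=> x _; exact: norm1_sqmod.
Qed.

Lemma norm1_le_sqrt (a S : R) (w : R[i]) : 0 <= a -> sqmod w <= a * S ->
  norm1 w <= Num.sqrt (2 * a) * Num.sqrt S.
Proof.
move=> a0 h; rewrite -sqrtrM ?mulr_ge0// -[leLHS](ger0_norm (norm1_ge0 _)) -sqrtr_sqr.
apply: ler_wsqrtr; apply: (le_trans (norm1_sqmod w)).
by rewrite -mulrA ler_wpM2l.
Qed.

(** The substitution [y = eps * x] consumes one of the two powers of [eps] in front of [f].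
    Cauchy-Schwarz on [[0, eps * X]] gives a further [sqrt eps], estimated here by 1. *)
Lemma scaled_source_le (eps X : R) (w : R[i]) (u f : R -> R[i]) : 0 < eps <= 1 -> 0 < X ->
  inL2 (eps * X)%:E u -> inL2 (eps * X)%:E f ->
  \int[mu]_(x in `[0, X]) norm1 ((eps ^+ 2)%:C * (w * u (eps * x) + f (eps * x))) <=
  eps ^+ 2 * norm1 w * (\int[mu]_(x in `[0, X]) norm1 (u (eps * x))) +
  eps * (Num.sqrt (2 * X) * Num.sqrt (\int[mu]_(x in `[0, eps * X]) sqmod (f x))).
Proof.
move=> /andP[e0 e1] X0 hu hf.
have hue := inL2_scale e0 hu; have hfe := inL2_scale e0 hf.
have Lu := norm1_L1 hue; have Lf := norm1_L1 hfe.
have hg : inL2 X%:E (fun x => (eps ^+ 2)%:C * (w * u (eps * x) + f (eps * x))).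
  apply: inL2_real_scale; apply: inL2_ext (inL2_lin w hfe hue) => x _.
  by rewrite addrC.
have LU : L1 `[0, X] (fun x => eps ^+ 2 * norm1 w * norm1 (u (eps * x))) by exact: L1Z.
have LF : L1 `[0, X] (fun x => eps ^+ 2 * norm1 (f (eps * x))) by exact: L1Z.
apply: (@le_trans _ _ (\int[mu]_(x in `[0, X])
    (eps ^+ 2 * norm1 w * norm1 (u (eps * x)) + eps ^+ 2 * norm1 (f (eps * x))))).
  apply: le_Rintegral => //; [exact: norm1_L1|exact: L1D|move=> x _].
  rewrite norm1_real ger0_norm ?sqr_ge0// -mulrA -mulrDr ler_wpM2l ?sqr_ge0//.
  by apply: (le_trans (norm1D _ _)); rewrite lerD2r norm1M.
rewrite RintegralD// RintegralZl// RintegralZl// lerD2l.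
rewrite expr2 -mulrA ler_pM2l//.
rewrite -(integral_scale e0 (norm1_L1 hf)).
have eX : 0 < eps * X by rewrite mulr_gt0.
apply: (le_trans (integral_norm1_le eX hf)).
apply: ler_wpM2r; first exact: sqrtr_ge0.
apply: ler_wsqrtr; rewrite ler_pM2l//.
by rewrite -[leRHS]mul1r ler_wpM2r// ltW.
Qed.

End ScaledSource.

Section Hamiltonians.
Variables (R : realType) (V E : finType) (endpt : E * bool -> V) (len : E -> R).
Hypothesis len_gt0 : forall e, 0 < len e.
Variables (N : nat) (c : 'I_N -> V).
Hypothesis c_inj : injective c.
Variables (Pin Thin : forall v, 'M[R[i]]_(deg endpt v)) (Bin : E -> R -> R).
Hypothesis HPin : forall v, v \notin codom c -> is_orthoproj (Pin v).
Hypothesis HThin : forall v, v \notin codom c -> is_selfadj_in (Pin v) (Thin v).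
Hypothesis HBin : bounded_potential (fun e => (len e)%:E) Bin.
Variable lout : 'I_N -> \bar R.
Hypothesis lout_gt0 : forall j, (0 < lout j)%E.
Variables (Pout Thout : 'I_N -> 'M[R[i]]_1) (Bout : 'I_N -> R -> R).
Hypothesis HPout : forall j, lout j \is a fin_num -> is_orthoproj (Pout j).
Hypothesis HThout : forall j, lout j \is a fin_num -> is_selfadj_in (Pout j) (Thout j).
Hypothesis HBout : bounded_potential lout Bout.
Variable z : R[i].
Hypothesis Hz : complex.Im z != 0.
Local Notation mu := (@lebesgue_measure R).
Local Notation H0 := (Hout lout Pout Thout Bout).
Local Notation l eps := (lfull len lout eps).
Local Notation Bf eps := (Bfull Bin Bout eps).
Local Notation H eps := (Hfull c len lout Pin Thin Bin Pout Thout Bout eps).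
Local Notation linn := (fun e => (len e)%:E).

Lemma potential_out j : potential (lout j) (Bout j).
Proof. exact: bounded_potential_edge. Qed.

Lemma potential_in e : potential (len e)%:E (Bin e).
Proof. exact: (bounded_potential_edge HBin e). Qed.

Lemma length_in e : (0 < (len e)%:E)%E.
Proof. by rewrite lte_fin. Qed.

Lemma length_full eps : 0 < eps -> forall i, (0 < l eps i)%E.
Proof. by move=> e0 [j|e] //=; rewrite lte_fin mulr_gt0. Qed.

Lemma potential_full eps : 0 < eps -> forall i, potential (l eps i) (Bf eps i).
Proof.
by move=> e0 [j|e]; [exact: potential_out|exact: (potential_scale e0 (potential_in e))].
Qed.

Lemma outer_resolvent_set : in_resolvent_set lout H0 z.
Proof.
apply: (schrodinger_resolvent_set lout_gt0 potential_out
  (@outer_bc_lin R N lout Pout Thout) (@outer_bc_fictitious R N lout Pout Thout)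
  (@outer_bc_isotropic R N lout Pout Thout HPout HThout) Hz).
by move=> psi psi1; exact: outer_bcP.
Qed.

Lemma full_bcP eps (psi psi1 : gfun R ('I_N + E)) :
  [/\ bc_Vin (len_eps len eps) c Pin (Thin_eps Thin eps) (einr psi) (einr psi1),
      bc_Vout lout Pout Thout (einl psi) (einl psi1) &
      forall j : 'I_N,
        kirchhoff
          (col_mx (const_mx (psi (inl j) 0) : 'cV_1)
                  (bvals endpt (len_eps len eps) (einr psi) (c j)))
          (col_mx (const_mx (psi1 (inl j) 0) : 'cV_1)
                  (bders endpt (len_eps len eps) (einr psi1) (c j)))] <->
  forall h, residual (l eps) (full_bc c lout Pin Thin Pout Thout eps) psi psi1 h = 0.
Proof.
rewrite /residual full_bc_eq0//.
split=> [[h1 h2 h3]|[h1 h2 h3]].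
  split=> [v vc|j|j].
  - by have := h1 v vc; rewrite bvalsE bdersE.
  - by move/free_end_bcP: h2; exact.
  - by have := h3 j; rewrite bvalsE bdersE.
split=> [v vc||j].
- by rewrite bvalsE bdersE; exact: h1.
- by apply/free_end_bcP => //; exact: h2.
- by rewrite bvalsE bdersE; exact: h3.
Qed.

Lemma full_resolvent_set eps : 0 < eps -> in_resolvent_set (l eps) (H eps) z.
Proof.
move=> e0.
apply: (schrodinger_resolvent_set (length_full e0) (potential_full e0)
  (@full_bc_lin R V E endpt N c lout Pin Thin Pout Thout eps)
  (@full_bc_fictitious R V E endpt len N c lout Pin Thin Pout Thout eps) _ Hz).
  by move=> x y; exact: full_bc_isotropic.
exact: full_bcP.
Qed.

Lemma outer_resolvent_solution f : gL2 lout f -> exists psi1,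
  graph_solution lout Bout z f (resolvent lout H0 z f) psi1 /\
  forall h, residual lout (outer_bc lout Pout Thout) (resolvent lout H0 z f) psi1 h = 0.
Proof.
move=> hf; have := resolvent_solution lout_gt0 potential_out
  (@outer_bc_lin R N lout Pout Thout) (@outer_bc_fictitious R N lout Pout Thout)
  (@outer_bc_isotropic R N lout Pout Thout HPout HThout) Hz _ hf.
move=> /(_ _ (fun psi psi1 => outer_bcP lout_gt0 HPout HThout psi psi1)).
by move=> [psi1 [sol /(outer_bcP lout_gt0 HPout HThout) hb]]; exists psi1.
Qed.

Lemma full_resolvent_solution eps f : 0 < eps -> gL2 (l eps) f -> exists psi1,
  graph_solution (l eps) (Bf eps) z f (resolvent (l eps) (H eps) z f) psi1 /\
  forall h, residual (l eps) (full_bc c lout Pin Thin Pout Thout eps)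
    (resolvent (l eps) (H eps) z f) psi1 h = 0.
Proof.
move=> e0 hf; have := resolvent_solution (length_full e0) (potential_full e0)
  (@full_bc_lin R V E endpt N c lout Pin Thin Pout Thout eps)
  (@full_bc_fictitious R V E endpt len N c lout Pin Thin Pout Thout eps)
  (fun x y => @full_bc_isotropic R V E endpt N c lout Pin Thin Pout Thout eps c_inj HPin HThin HPout HThout x y) Hz
  _ hf.
move=> /(_ _ (fun psi psi1 => full_bcP eps psi psi1)).
by move=> [psi1 [sol /full_bcP hb]]; exists psi1.
Qed.

Hypothesis Hgen : ~ is_eigenvalue linn (Hin c len Pin Thin Bin) 0.

(** The generic case enters here: a homogeneous solution that is not almost everywhere 0 would be an
    eigenfunction for 0, and one that is has vanishing data by [edge_solution_zero]. *)
Lemma inner_unique psi psi1 : graph_solution linn Bin 0 (fun _ _ => 0) psi psi1 ->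
  (forall h, residual linn (inner_bc c Pin Thin) psi psi1 h = 0) ->
  forall e, psi e 0 = 0 /\ psi1 e 0 = 0.
Proof.
move=> sol hb e.
have psi0 : ae_eq_on linn psi (fun _ _ => 0).
  apply: contrapT => npsi; apply: Hgen.
  have z0 : gL2 linn (fun (_ : E) (_ : R) => 0 : R[i]) by move=> j; exact: inL2_0.
  have := (solves_graph_solution 0 potential_in (fun psi psi1 : gfun R E =>
    bc_Vin len c Pin Thin psi psi1 /\
    forall j, kirchhoff (bvals endpt len psi (c j)) (bders endpt len psi1 (c j))) psi z0).2.
  case; first by exists psi1; split => //; apply/inner_bcP.
  move=> g Hg ge; exists psi, g; split => // i.
  by apply: (ae_imp (ge i)) => x h Ix; have := h Ix; move=> /eqP; rewrite subr_eq0 => /eqP.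
have [_ [M BM]] := potential_in e.
apply: (edge_solution_zero (len_gt0 e) (potential_in e) BM (sol e)).
have [hu _ _ _] := sol e.
have := inL2_sqmod hu; move=> /L1_measurable mu2.
rewrite (@ae_eq_integral_interval R (len e)%:E _ (fun=> 0) (len e))//.
  by rewrite (integral_cst_segment 0 (ltW (len_gt0 e))) mul0r.
by apply: (ae_imp (psi0 e)) => x h Ix; rewrite h// sqmod0.
Qed.

(** Neither the graph nor the operator involves [eps], so a single [C] serves all the rescaled
    problems. *)
Lemma inner_stability : exists2 C, 0 <= C & forall f psi psi1, gL2 linn f ->
  graph_solution linn Bin 0 f psi psi1 ->
  forall e x, 0 <= x <= len e -> norm1 (psi e x) <=
    C * (\sum_e \int[mu]_(t in `[0, len e]) norm1 (f e t) +
         \sum_h norm1 (residual linn (inner_bc c Pin Thin) psi psi1 h)).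
Proof.
have [C C0 hC] := graph_stability length_in potential_in
  (@inner_bc_lin R V E endpt N c Pin Thin)
  (fun i x y (li : (len i)%:E = +oo%E) => ltac:(by []))
  inner_unique (fun i (li : (len i)%:E = +oo%E) => ltac:(by [])) (fun i => isT).
exists C => // f psi psi1 hf sol e x xe.
have := hC f psi psi1 hf sol e x; rewrite interval_of_fin/= in_itv/= => /(_ xe).
by under eq_bigr do rewrite interval_of_fin.
Qed.

Lemma sqnorm_full eps (f : gfun R ('I_N + E)) :
  sqnorm (l eps) f = sqnorm lout (einl f) +
    \sum_e \int[mu]_(x in `[0, eps * len e]) sqmod (f (inr e) x).
Proof.
rewrite /sqnorm big_sumType/=; congr (_ + _); apply: eq_bigr => e _.
by rewrite interval_of_fin.
Qed.

Lemma sqnorm_out_le eps (f : gfun R ('I_N + E)) : sqnorm lout (einl f) <= sqnorm (l eps) f.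
Proof.
rewrite sqnorm_full lerDl; apply: sumr_ge0 => e _.
by apply: Rintegral_ge0 => x _; exact: sqmod_ge0.
Qed.

(** The outer edges are not scaled: the windows at [x = 0], and with them the constant, are
    independent of [eps]. *)
Lemma outer_trace : exists2 C, 0 <= C & forall f psi psi1, gL2 lout f ->
  graph_solution lout Bout z f psi psi1 ->
  forall j, sqmod (psi j 0) + sqmod (psi1 j 0) <= C * (sqnorm lout psi + sqnorm lout f).
Proof.
have tr j : exists C, 0 <= C /\ forall f u u1 : R -> R[i], inL2 (lout j) f ->
    edge_solution (lout j) (Bout j) z f u u1 ->
    sqmod (u 0) + sqmod (u1 0) <= C * (\int[mu]_(x in interval_of (lout j)) sqmod (u x) +
                                       \int[mu]_(x in interval_of (lout j)) sqmod (f x)).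
  have [a a0 al] := ge0_finite_length (lout_gt0 j).
  have [_ [M BM]] := potential_out j; have s := sub_interval al.
  have [C C0 hC] := @edge_trace R a M z a0; exists C; split => // f u u1 hf sol.
  have al' : ((0 + a)%:E <= lout j)%E by rewrite add0r.
  apply: (le_trans (hC _ _ _ _ _ 0 (lexx 0) al' (potential_out j) BM hf sol)).
  rewrite add0r; apply: ler_wpM2l => //; have mI := measurable_interval (lout j).
  have [hu _ _ _] := sol.
  apply: lerD; apply: Rintegral_subset => //; try (by move=> x _; exact: sqmod_ge0);
    exact: inL2_sqmod.
have [C hC] := choice tr.
have CC j : C j <= \sum_j C j.
  by rewrite (bigD1 j)//= lerDl; apply: sumr_ge0 => i _; have [] := hC i.
exists (\sum_j C j); first by apply: sumr_ge0 => i _; have [] := hC i.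
move=> f psi psi1 hf sol j.
apply: (le_trans ((hC j).2 _ _ _ (hf j) (sol j))).
apply: ler_pM => //; first by have [] := hC j.
- by apply: addr_ge0; apply: Rintegral_ge0 => x _; exact: sqmod_ge0.
- by apply: lerD; exact: sqnorm_edge.
Qed.

(** At a vertex outside [codom c] the factor [eps] of the derivative cancels the [eps^-1] of
    [Thin_eps], and the residual is 0. At [c j] the inner values agree, while the inner derivatives
    add up to minus the outer one, so each entry of the residual is [- eps * psi_j'(0) / d]. *)
Lemma inner_residual_le (eps : R) psi psi1 : 0 < eps ->
  (forall h, residual (l eps) (full_bc c lout Pin Thin Pout Thout eps) psi psi1 h = 0) ->
  forall h, norm1 (residual linn (inner_bc c Pin Thin) (fun e x => psi (inr e) (eps * x))
              (fun e x => eps%:C * psi1 (inr e) (eps * x)) h) <=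
    eps * \sum_j norm1 (psi1 (inl j) 0).
Proof.
move=> e0; rewrite /residual full_bc_eq0// => -[h1 _ h3] h.
rewrite /inner_bc; set v := endpt h; move: (end_rank endpt h) => k0; rewrite -/v in k0 *.
set x := graph_value _ psi in h1 h3; set y := graph_derivative _ psi1 in h1 h3.
have S0 : 0 <= \sum_j norm1 (psi1 (inl j) 0) by apply: sumr_ge0 => j _; exact: norm1_ge0.
rewrite /inner_residual.
have -> : at_vertex endpt (graph_value linn (fun e x => psi (inr e) (eps * x))) v =
    at_vertex endpt (inner_part x) v.
  apply/colP => k; rewrite !mxE /x /inner_part /graph_value.
  by case: (enum_val k) => e [] //=; rewrite mulr0.
have -> : at_vertex endpt (graph_derivative linn (fun e x => eps%:C * psi1 (inr e) (eps * x))) v =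
    eps%:C *: at_vertex endpt (inner_part y) v.
  apply/colP => k; rewrite !mxE /y /inner_part /graph_derivative.
  by case: (enum_val k) => e [] /=; rewrite ?mulr0// mulrN.
have [/codomP[j vj]|vc] := boolP (v \in codom c); last first.
  have := h1 v vc; move: (at_vertex _ (inner_part x) v) (at_vertex _ (inner_part y) v) => X Y [c1 c2].
  rewrite (vertex_residual_eq0 _ _ _ _).2 ?mxE ?norm1_0 ?mulr_ge0 ?(ltW e0)//.
    by have [] := HPin vc.
  by have [] := HThin vc.
  split => //; rewrite -[RHS](scaler0 _ eps%:C) -c2 /Thin_eps scalerBr -scalemxAr; congr (_ - _).
  have ee : eps%:C * (eps^-1)%:C = 1 :> R[i].
    by rewrite -[LHS](rmorphM (real_complex R)) divff ?gt_eqF// rmorph1.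
  by rewrite -scalemxAl scalerA ee scale1r.
have := h3 j; rewrite -vj /connecting_vector => /kirchhoff_entries[XE Ysum].
move: XE Ysum; rewrite big_split_ord/= big_ord1.
set X := at_vertex _ (inner_part x) v; set Y := at_vertex _ (inner_part y) v => XE Ysum.
have XE' k : X k 0 = x (inl j, false).
  by have := XE (rshift 1 k) (lshift _ 0); rewrite col_mxEd col_mxEu => ->; rewrite mxE.
have Ysum' : \sum_k Y k 0 = - y (inl j, false).
  apply/eqP; rewrite -addr_eq0; apply/eqP; rewrite addrC -[RHS]Ysum.
  congr (_ + _); first by rewrite col_mxEu mxE.
  by apply: eq_bigr => k _; rewrite col_mxEd.
clearbody X Y.
pose d := deg endpt v.
have d0 : (0 < d)%N by apply: leq_ltn_trans (ltn_ord k0).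
have -> : vertex_residual (Kproj R d) 0 X (eps%:C *: Y) k0 0 =
    eps%:C * ((d%:R^-1)%:C * - y (inl j, false)).
  rewrite /vertex_residual mul0mx subr0 mulmxBl mul1mx -scalemxAr mxE [X in X + _]mxE.
  rewrite [X in _ + X]mxE [X in _ + X + _]mxE.
  have KE (Z : 'cV[R[i]]_d) i : (Kproj R d *m Z) i 0 = d%:R^-1 * \sum_k Z k 0.
    by rewrite mxE mulr_sumr; apply: eq_bigr => k _; rewrite mxE.
  rewrite !KE Ysum' (eq_bigr (fun=> x (inl j, false))) => [|k _]; last exact: XE'.
  rewrite sumr_const card_ord -[X in _ - _ * X]mulr_natl mulKf ?pnatr_eq0 -?lt0n//.
  by rewrite XE' subrr add0r fmorphV rmorph_nat.
rewrite norm1_real gtr0_norm// ler_pM2l// norm1_real norm1N.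
apply: (@le_trans _ _ (norm1 (psi1 (inl j) 0))).
  rewrite /y /graph_derivative/= ger0_norm ?invr_ge0// -[leRHS]mul1r.
  by apply: ler_wpM2r; [exact: norm1_ge0|rewrite invf_le1 ?ltr0n// ler1n].
by rewrite (bigD1 j)//= lerDl; apply: sumr_ge0 => i _; exact: norm1_ge0.
Qed.

Lemma outer_derivative_le : exists2 K, 0 <= K & forall eps f psi psi1, 0 < eps ->
  gL2 (l eps) f -> graph_solution (l eps) (Bf eps) z f psi psi1 ->
  (forall h, residual (l eps) (full_bc c lout Pin Thin Pout Thout eps) psi psi1 h = 0) ->
  forall j, norm1 (psi1 (inl j) 0) <= K * Num.sqrt (sqnorm (l eps) f).
Proof.
have [C C0 hC] := outer_trace.
set y := (`|Im z|^-1) ^+ 2; have y0 : 0 <= y by exact: sqr_ge0.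
exists (Num.sqrt (2 * (C * (y + 1)))); first exact: sqrtr_ge0.
move=> eps f psi psi1 e0 hf sol hb j; apply: norm1_le_sqrt; first by rewrite mulr_ge0// addr_ge0.
have hS : sqnorm (l eps) psi <= y * sqnorm (l eps) f.
  apply: (sqnorm_le_resolvent (length_full e0)
    (potential_full e0) _ Hz hf sol hb) => x1 x2.
  exact: full_bc_isotropic.
have := hC (einl f) (einl psi) (einl psi1) (fun i => hf (inl i)) (fun i => sol (inl i)) j.
have := sqnorm_out_le eps f; have := sqnorm_out_le eps psi.
rewrite /einl => h1 h2 h; have p0 := sqmod_ge0 (psi (inl j) 0).
apply: (@le_trans _ _ (sqmod (psi (inl j) 0) + sqmod (psi1 (inl j) 0))); first by rewrite lerDr.
apply: (le_trans h); rewrite -mulrA ler_wpM2l// mulrDl mul1r.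
by apply: lerD => //; exact: le_trans hS.
Qed.

(* The conclusion is at the same time the a priori bound of the source term
   [eps^2 z u], hence the smallness condition on [eps]. *)
Lemma inner_estimate : exists K e1, [/\ 0 <= K, 0 < e1 <= 1 & forall eps f psi psi1,
  0 < eps < e1 -> gL2 (l eps) f -> graph_solution (l eps) (Bf eps) z f psi psi1 ->
  (forall h, residual (l eps) (full_bc c lout Pin Thin Pout Thout eps) psi psi1 h = 0) ->
  forall e x, 0 <= x <= len e ->
    norm1 (psi (inr e) (eps * x)) <= K * eps * Num.sqrt (sqnorm (l eps) f)].
Proof.
have [C C0 hC] := inner_stability.
have [Kp Kp0 hKp] := outer_derivative_le.
pose La := \sum_e len e.
have La0 : 0 <= La by apply: sumr_ge0 => e _; exact: ltW.
pose n := #|{: E * bool}|.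
(* The first sum comes from the rescaled source, the second from the [n] residuals, each bounded by
   the [N] outer derivatives. *)
pose K1 := \sum_e Num.sqrt (2 * len e) + n%:R * (N%:R * Kp).
have K10 : 0 <= K1.
  apply: addr_ge0; first by apply: sumr_ge0 => e _; exact: sqrtr_ge0.
  by rewrite !mulr_ge0.
have nz0 := norm1_ge0 z; have D0 : 0 <= norm1 z * (La * C) by rewrite !mulr_ge0.
(* For [eps < q^-1] one has both [eps <= 1] and [eps * norm1 z * (La * C) <= 1 / 2], so half of [Bk]
   absorbs the source term [eps ^+ 2 * z * u]. *)
pose q := 1 + 2 * (norm1 z * (La * C)).
have q1 : 1 <= q by rewrite lerDl mulr_ge0.
have q0 : 0 < q by apply: lt_le_trans q1.
exists (C * (2 * K1)), q^-1; split.
- by rewrite !mulr_ge0.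
- by rewrite invr_gt0 q0 invf_le1.
move=> eps f psi psi1 /andP[e0 eq] hf sol hb.
have eq1 : eps * q <= 1 by rewrite -ler_pdivlMr// div1r ltW.
have e1 : eps <= 1 by apply: le_trans eq1; rewrite -[leLHS]mulr1 ler_wpM2l// ltW.
set F := Num.sqrt _; have F0 : 0 <= F by exact: sqrtr_ge0.
pose u e x := psi (inr e) (eps * x).
pose u1 e x := eps%:C * psi1 (inr e) (eps * x).
pose g e x := (eps ^+ 2)%:C * (z * u e x + f (inr e) (eps * x)).
have hu e : inL2 (len e)%:E (u e) by apply: inL2_scale => //; have [] := sol (inr e).
have hg : gL2 linn g.
  move=> e; apply: inL2_real_scale.
  by apply: inL2_ext (inL2_lin z (inL2_scale e0 (hf (inr e))) (hu e)) => x _; rewrite addrC.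
have su : graph_solution linn Bin 0 g u u1.
  move=> e; apply: edge_solution_scale => //; [exact: potential_in|exact: (hf (inr e))|].
  exact: (sol (inr e)).
set Bk := \sum_e \int[mu]_(t in `[0, len e]) norm1 (g e t) +
  \sum_h norm1 (residual linn (inner_bc c Pin Thin) u u1 h).
have hB e x : 0 <= x <= len e -> norm1 (u e x) <= C * Bk by exact: (hC g u u1 hg su).
have Bk0 : 0 <= Bk.
  apply: addr_ge0; apply: sumr_ge0 => i _; last exact: norm1_ge0.
  by apply: Rintegral_ge0 => x _; exact: norm1_ge0.
pose U := \sum_e \int[mu]_(t in `[0, len e]) norm1 (u e t).
(* The sup bound by [Bk] is integrated over the edges. As [Bk] itself contains the integral of
   [z * u], this closes the loop into an inequality between multiples of [Bk]. *)
have hU : U <= La * C * Bk.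
  rewrite /U /La !mulr_suml; apply: ler_sum => e _; rewrite -mulrA mulrC.
  rewrite -[X in _ * X]subr0 -integral_cst_segment ?(ltW (len_gt0 e))//.
  apply: le_Rintegral => //; [exact: norm1_L1|apply: L1_cst => //; exact: segment_finite|].
  by move=> x; rewrite /= in_itv/=; exact: hB.
have hBk : Bk <= eps ^+ 2 * norm1 z * U + eps * (K1 * F).
  rewrite /K1 [(_ + _) * F]mulrDl [eps * (_ + _)]mulrDr [leRHS]addrA.
  apply: lerD.
    rewrite /U mulr_sumr mulr_suml mulr_sumr -big_split/=; apply: ler_sum => e _.
    have eps1 : 0 < eps <= 1 by rewrite e0.
    have hue : inL2 (eps * len e)%:E (psi (inr e)) by have [] := sol (inr e).
    apply: (le_trans (scaled_source_le z eps1 (len_gt0 e) hue (hf (inr e)))).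
    rewrite lerD2l ler_pM2l// ler_wpM2l ?sqrtr_ge0//; apply: ler_wsqrtr.
    by have := sqnorm_edge (l eps) f (inr e); rewrite interval_of_fin.
  have hr h : norm1 (residual linn (inner_bc c Pin Thin) u u1 h) <= eps * (N%:R * Kp * F).
    apply: (le_trans (inner_residual_le e0 hb h)); rewrite ler_pM2l//.
    apply: (@le_trans _ _ (\sum_(j < N) Kp * F)); last by rewrite sumr_const card_ord -mulrA mulr_natl.
    by apply: ler_sum => j _; exact: (hKp eps f psi psi1).
  apply: (@le_trans _ _ (\sum_(h : E * bool) eps * (N%:R * Kp * F))); first by apply: ler_sum => h _.
  rewrite sumr_const -/n -[leLHS]mulr_natl le_eqVlt; apply/orP; left; apply/eqP.
  by clearbody K1 F Bk U n; ring.
have hBk' : Bk <= 2 * K1 * eps * F.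
  have hU2 : eps ^+ 2 * norm1 z * U <= 2^-1 * Bk.
    apply: (@le_trans _ _ (eps ^+ 2 * norm1 z * (La * C * Bk))).
      by rewrite ler_wpM2l// mulr_ge0// sqr_ge0.
    rewrite mulrA ler_wpM2r//.
    have : eps ^+ 2 * norm1 z * (La * C) <= eps * (norm1 z * (La * C)).
      by rewrite -mulrA ler_wpM2r// expr2 -[leRHS]mulr1 ler_pM2l.
    by move: eq1; rewrite /q; clearbody Bk U; move: (norm1 z * (La * C)) => D; lra.
  clearbody Bk U K1 F; lra.
move=> e x xe; apply: (le_trans (hB e x xe)).
rewrite -mulrA -mulrA ler_wpM2l//.
by apply: (le_trans hBk'); rewrite -!mulrA.
Qed.
Hypothesis endpt_surj : forall v, exists h, endpt h = v.

(** Continuity at [c j] passes the sup bound from the inner graph to the outer boundary value,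
    provided some inner edge end meets the vertex; [endpt_surj] supplies one. *)
Lemma connecting_value eps (psi psi1 : gfun R ('I_N + E)) :
  (forall h, residual (l eps) (full_bc c lout Pin Thin Pout Thout eps) psi psi1 h = 0) ->
  forall j, exists e, exists2 x, 0 <= x <= len e & psi (inl j) 0 = psi (inr e) (eps * x).
Proof.
rewrite /residual full_bc_eq0// => -[_ _ h3] j.
have [h hj] := endpt_surj (c j).
have hA : h \in ends endpt (c j) by rewrite inE hj.
have [XE _] := kirchhoff_entries (h3 j).
have := XE (lshift _ 0) (rshift 1 (enum_rank_in hA h)).
rewrite /connecting_vector col_mxEd col_mxEu mxE [RHS]mxE /inner_part /graph_value/=.
case: (enum_val _) => e [] /= ->; exists e.
  by exists (len e) => //; rewrite lexx ltW.
by exists 0; rewrite ?mulr0// lexx ltW.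
Qed.

Lemma sqnorm0 : sqnorm lout (fun _ _ => 0) = 0.
Proof.
rewrite /sqnorm big1// => j _; under eq_Rintegral do rewrite sqmod0.
by rewrite /Rintegral integral0.
Qed.

(* Only the ends [x = 0] contribute to the energy identity, by terms
   [wronskian (w 0) (w' 0)]; the trace estimate for [w' 0] and AM-GM absorb half
   of the left-hand side. *)
Lemma outer_solution_le : exists2 C, 0 <= C & forall w w1,
  graph_solution lout Bout z (fun _ _ => 0) w w1 ->
  (forall j, free_end_bc lout Pout Thout (graph_value lout w (j, true))
    (graph_derivative lout w1 (j, true)) j = 0) ->
  sqnorm lout w <= C * \sum_j sqmod (w j 0).
Proof.
have [Ct Ct0 hCt] := outer_trace.
set y := `|Im z|; have y0 : 0 < y by rewrite normr_gt0.
pose D := N%:R * Ct; have D0 : 0 <= D by rewrite mulr_ge0.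
(* Then [y * t = 2 * (D + 1)], hence [D / (2 * t) <= y / 4]. The factor 2 of [energy_le] makes this
   half of [y * S], and what remains is [y * S <= 2 * t * Q]. *)
pose t := 2 * (D + 1) / y; have t0 : 0 < t by rewrite divr_gt0// mulr_gt0// ltr_wpDl.
exists (2 * t / y); first by apply: divr_ge0; [apply: mulr_ge0|]; rewrite ?(ltW t0) ?(ltW y0).
move=> w w1 sol hb; have z0 : gL2 lout (fun _ _ => 0 : R[i]) by move=> j; exact: inL2_0.
have := energy_le lout_gt0 potential_out Hz z0 sol.
rewrite sqnorm0 mulr0 addr0 -/y.
set S := sqnorm lout w; set Q := \sum_j sqmod _.
have S0 : 0 <= S by exact: sqnorm_ge0.
have hS : `|\sum_h wronskian (graph_value lout w h) (graph_derivative lout w1 h)| <=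
    t / 2 * Q + (2 * t)^-1 * (D * S).
  rewrite -(pair_bigA _ (fun j b => wronskian (graph_value lout w (j, b))
    (graph_derivative lout w1 (j, b))))/=.
  apply: (le_trans (ler_norm_sum _ _ _)).
  have -> : D * S = \sum_(j < N) Ct * S by rewrite sumr_const card_ord -[RHS]mulr_natl mulrA.
  rewrite mulr_sumr [_^-1 * _]mulr_sumr -big_split/=; apply: ler_sum => j _.
  rewrite big_bool/= (free_end_bc_isotropic HPout HThout (hb j)) add0r.
  apply: (le_trans (wronskian_le _ _ t0)); rewrite lerD2l.
  apply: ler_wpM2l; first by rewrite invr_ge0 ltW// mulr_gt0.
  have := hCt (fun _ _ => 0) w w1 z0 sol j; rewrite sqnorm0 addr0.
  by apply: le_trans; rewrite lerDr sqmod_ge0.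
move=> hE.
have e1 : y * t = 2 * (D + 1) by rewrite /t mulrC divfK// gt_eqF.
have e2 : (2 * t)^-1 * (D * S) <= y * S / 4.
  rewrite -(ler_pM2l (_ : 0 < 2 * t)); last by rewrite mulr_gt0.
  rewrite mulVKf; last by rewrite gt_eqF// mulr_gt0.
  have -> : 2 * t * (y * S / 4) = (y * t) * S / 2 by field.
  by rewrite e1; clearbody S D; nra.
have e3 : y * S <= 2 * t * Q by clearbody S Q t y; nra.
by rewrite mulrAC ler_pdivlMr// mulrC.
Qed.

(** On the inner edges the block operator is 0, so the difference is the solution itself, and its
    sup bound is integrated over short edges. On the outer edges the same sup bound controls the
    boundary values of the difference. *)
Lemma resolvent_difference : exists C e1 : R, 0 < e1 /\ forall eps, 0 < eps < e1 ->
  opnorm_le (l eps)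
    (fun f s x => resolvent (l eps) (H eps) z f s x - block_out (resolvent lout H0 z) f s x)
    (C * eps).
Proof.
have [K [e1 [K0 /andP[e10 e11] hK]]] := inner_estimate.
have [C C0 hC] := outer_solution_le.
pose La := \sum_e len e.
have La0 : 0 <= La by apply: sumr_ge0 => e _; exact: ltW.
(* Both parts are multiples of [(K * eps * F) ^+ 2]: [C] for each of the [N] outer boundary values,
   and [len e] for each inner edge, whose scaled length is at most [len e] because [eps <= 1]. *)
pose D := C * N%:R + La; have D0 : 0 <= D by rewrite addr_ge0// mulr_ge0.
exists (K * Num.sqrt D), e1; split=> // eps /andP[e0 ee1] f hf.
have ee : 0 < eps < e1 by rewrite e0.
have [psi1 [sol hb]] := full_resolvent_solution e0 hf.
have hfo : gL2 lout (einl f) by move=> j; exact: (hf (inl j)).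
have [phi1 [sol0 hb0]] := outer_resolvent_solution hfo.
move: sol hb sol0 hb0; rewrite /block_out.
move: (resolvent (l eps) _ z f) (resolvent lout _ z (einl f)) => psi phi sol hb sol0 hb0.
have hpsi : gL2 (l eps) psi by move=> i; have [] := sol i.
have hphi : gL2 lout phi by move=> i; have [] := sol0 i.
set T := fun s x => _.
have TE j x : T (inl j) x = psi (inl j) x + -1 * phi j x by rewrite /T mulN1r.
have Tr e x : T (inr e) x = psi (inr e) x by rewrite /T subr0.
have hT : gL2 (l eps) T.
  move=> [j|e].
    by apply: inL2_ext (inL2_lin (-1) (hpsi (inl j)) (hphi j)) => x _; rewrite TE.
  by apply: inL2_ext (hpsi (inr e)) => x _; rewrite Tr.
split=> //; apply: L2norm_le; first by rewrite !mulr_ge0 ?sqrtr_ge0// ltW.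
have S0 : 0 <= sqnorm (l eps) f by exact: sqnorm_ge0.
set F := Num.sqrt (sqnorm (l eps) f); have F0 : 0 <= F by exact: sqrtr_ge0.
have hu := hK eps f psi psi1 ee hf sol hb.
have KF0 : 0 <= K * eps * F by rewrite !mulr_ge0// ltW.
have usq e x : 0 <= x <= len e -> sqmod (psi (inr e) (eps * x)) <= (K * eps * F) ^+ 2.
  move=> xe; apply: (le_trans (sqmod_norm1 _)).
  by rewrite ler_sqr ?nnegrE ?norm1_ge0//; exact: hu.
have phi0 j : phi j 0 = 0 by have := hb0 (j, false).
pose w j x := psi (inl j) x + -1 * phi j x.
pose w1 j x := psi1 (inl j) x + -1 * phi1 j x.
have w0 j : sqmod (w j 0) <= (K * eps * F) ^+ 2.
  rewrite /w phi0 mulr0 addr0; have [e [x xe ->]] := connecting_value hb j; exact: usq.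
have ws : graph_solution lout Bout z (fun _ _ => 0) w w1.
  have so : graph_solution lout Bout z (einl f) (einl psi) (einl psi1) by move=> i; exact: (sol (inl i)).
  move=> j; have := graph_solution_lin potential_out (-1) hfo hfo so sol0 j.
  by apply: edge_solution_ext_rhs => x _; rewrite mulN1r subrr.
have wb j : free_end_bc lout Pout Thout (graph_value lout w (j, true))
    (graph_derivative lout w1 (j, true)) j = 0.
  have := residual_lin lout (@outer_bc_lin R N lout Pout Thout) (einl psi) (einl psi1) phi phi1 (-1) (j, true).
  rewrite hb0 mulr0 addr0 => h; apply: (etrans h).
  by move: hb; rewrite /residual full_bc_eq0// => -[_ h2 _]; exact: h2.
have hout : sqnorm lout (einl T) <= C * N%:R * (K * eps * F) ^+ 2.
  have -> : einl T = w by apply/funext => j; apply/funext => x; exact: TE.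
  apply: (le_trans (hC w w1 ws wb)); rewrite -mulrA ler_wpM2l//.
  apply: (@le_trans _ _ (\sum_(j < N) (K * eps * F) ^+ 2)); first exact: ler_sum.
  by rewrite sumr_const card_ord -[leLHS]mulr_natl.
have hin e : \int[mu]_(x in `[0, eps * len e]) sqmod (T (inr e) x) <= len e * (K * eps * F) ^+ 2.
  have el : 0 < eps * len e by rewrite mulr_gt0.
  have hTe := inL2_sqmod (hT (inr e)); rewrite interval_of_fin in hTe.
  apply: (@le_trans _ _ ((K * eps * F) ^+ 2 * (eps * len e - 0))); last first.
    rewrite subr0 mulrC ler_wpM2r ?sqr_ge0// -[leRHS]mul1r ler_wpM2r ?(ltW (len_gt0 e))//.
    exact: (le_trans (ltW ee1)).
  rewrite -integral_cst_segment ?(ltW el)//.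
  apply: le_Rintegral => //; first by apply: L1_cst => //; exact: segment_finite.
  move=> x; rewrite /= in_itv/= => /andP[x0 xl]; rewrite Tr.
  have en : eps != 0 by rewrite gt_eqF.
  rewrite -(mulVKf en x); apply: usq.
  by rewrite mulr_ge0 ?invr_ge0 ?(ltW e0)//= mulrC ler_pdivrMr// mulrC.
rewrite sqnorm_full.
apply: (le_trans (lerD hout (ler_sum _ (fun e _ => hin e)))).
rewrite -mulr_suml -mulrDl -/La -/D !exprMn sqr_sqrtr// sqr_sqrtr//.
by rewrite le_eqVlt; apply/orP; left; apply/eqP; clearbody D; ring.
Qed.

End Hamiltonians.

Theorem theorem2p12 (R : realType)
  (* inner graph *)
  (V E : finType) (endpt : E * bool -> V) (len : E -> R)
  (endpt_surj : forall v, exists h, endpt h = v)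
  (len_gt0 : forall e, 0 < len e)
  (* connecting vertices *)
  (N : nat) (c : 'I_N -> V) (c_inj : injective c)
  (* data on the inner graph *)
  (Pin Thin : forall v, 'M[R[i]]_(deg endpt v)) (Bin : E -> R -> R)
  (HPin : forall v, v \notin codom c -> is_orthoproj (Pin v))
  (HThin : forall v, v \notin codom c -> is_selfadj_in (Pin v) (Thin v))
  (HBin : bounded_potential (fun e => (len e)%:E) Bin)
  (* outer edges and data on the outer graph *)
  (lout : 'I_N -> \bar R) (lout_gt0 : forall j, (0 < lout j)%E)
  (Pout Thout : 'I_N -> 'M[R[i]]_1) (Bout : 'I_N -> R -> R)
  (HPout : forall j, lout j \is a fin_num -> is_orthoproj (Pout j))
  (HThout : forall j, lout j \is a fin_num -> is_selfadj_in (Pout j) (Thout j))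
  (HBout : bounded_potential lout Bout)
  (HBout_supp : compactly_supported lout Bout)
  (z : R[i]) (Hz : complex.Im z != 0)
  (* generic case *)
  (Hgen : ~ is_eigenvalue (fun e => (len e)%:E) (Hin c len Pin Thin Bin) 0) :
  let H0 := Hout lout Pout Thout Bout in
  let l eps := lfull len lout eps in
  let H eps := Hfull c len lout Pin Thin Bin Pout Thout Bout eps in
  [/\ in_resolvent_set lout H0 z,
      forall eps, 0 < eps < 1 -> in_resolvent_set (l eps) (H eps) z &
      exists C : R, \forall eps \near 0^'+,
        opnorm_le (l eps)
          (fun f s x => resolvent (l eps) (H eps) z f s x
                        - block_out (resolvent lout H0 z) f s x)
          (C * eps)].
Proof.
split.
- exact: outer_resolvent_set.
- by move=> eps /andP[e0 _]; exact: full_resolvent_set.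
- have [C [e1 [e10 h]]] := resolvent_difference len_gt0 c_inj HPin HThin HBin lout_gt0
    HPout HThout HBout Hz Hgen endpt_surj.
  exists C; near=> eps; apply: h; apply/andP; split; near: eps.
    exact: nbhs_right_gt.
  exact: nbhs_right_lt.
Unshelve. all: by end_near.
Qed.
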